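(* Let $H,K$ be complex Hilbert spaces, let $\mathcal{A}$ be a closed complex subspace of $\mathcal{L}(H,K)$, let $C\in\mathcal{L}(K,H)$, $D\in\mathcal{L}(H)$ and let $\mathcal{X}$ be any complex Banach space. Suppose the set $\mathcal{D}=\{Z\in\mathcal{A}:(CZ+D)^{-1}\text{ exists}\}$ is non-empty and $C$ is a trace class operator. Then $\mathcal{A}\setminus\mathcal{D}$ is an analytic set. Moreover, if $\mathcal{E}$ is a domain in $\mathcal{A}$ and if $h:\mathcal{D}\cap\mathcal{E}\to\mathcal{X}$ is a holomorphic function which is locally bounded in the sense that each operator in $\mathcal{E}\setminus\mathcal{D}$ has a neighborhood $\mathcal{U}$ such that $h$ is bounded on $\mathcal{U}\cap\mathcal{D}$, then $h$ extends to a holomorphic function $\hat h:\mathcal{E}\to\mathcal{X}$.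
   Context: $\mathcal{L}(H,K)$ is the Banach space of bounded linear operators from $H$ to $K$ with the operator norm, and $\mathcal{L}(H)=\mathcal{L}(H,H)$. ''$(CZ+D)^{-1}$ exists'' means that $CZ+D$ is invertible in $\mathcal{L}(H)$. A domain in $\mathcal{A}$ is a non-empty connected open subset of $\mathcal{A}$; the neighborhoods $\mathcal{U}$ are taken in $\mathcal{E}$. Holomorphic means complex Fréchet differentiable on an open set. A subset $S$ of $\mathcal{A}$ is an analytic set if each point of $\mathcal{A}$ has an open neighborhood $V$ in $\mathcal{A}$ on which there are finitely many holomorphic functions $V\to\mathbb{C}$ whose common zero set is $S\cap V$. *)

(* Defs.v *)
From HB Require Import structures.
From mathcomp Require Import all_boot all_order all_algebra.
From mathcomp Require Import all_classical all_reals all_analysis.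
From mathcomp Require Import complex.

Set Implicit Arguments.
Unset Strict Implicit.
Unset Printing Implicit Defensive.

Import Order.TTheory GRing.Theory Num.Theory.
Import numFieldNormedType.Exports.

Local Open Scope classical_set_scope.
Local Open Scope complex_scope.
Local Open Scope ring_scope.

(* [inner] is linear in its first argument and conjugate-linear in the second. *)
HB.mixin Record isHilbert (R : realType) H & CompleteNormedModule R[i] H := {
  inner : {dot H for (@Num.conj R[i])} ;
  inner_norm : forall x : H, inner x x = `|x| ^+ 2
}.

#[short(type="hilbertType")]
HB.structure Definition Hilbert (R : realType) :=
  {H of isHilbert R H & CompleteNormedModule R[i] H}.

Section BoundedOperators.
Context {R : realType}.
Implicit Types U V W : normedModType R[i].

Definition bounded_linear U V : {pred U -> V} :=
  mem [set f : U -> V | linear f /\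
                        exists M : R[i], forall x, `|f x| <= M * `|x|].

Record boundedOp U V := BoundedOp {
  bop_fun :> U -> V ;
  _ : bop_fun \in @bounded_linear U V }.

HB.instance Definition _ U V := [isSub for @bop_fun U V].
HB.instance Definition _ U V := [Choice of boundedOp U V by <:].

Fact bounded_linear_submod_closed U V : submod_closed (@bounded_linear U V).
Proof.
split=> [|a f g]; rewrite !inE.
  split=> [c x y|]; first by rewrite scaler0 addr0.
  by exists 0 => x; rewrite normr0 mul0r.
move=> -[linf [M fM]] [ling [N gN]]; split=> [c x y|].
  rewrite !fctE linf ling scalerDr !scalerDr addrACA; congr (_ + _ + _).
  by rewrite !scalerA mulrC.
exists (`|a| * M + N) => x; rewrite !fctE (le_trans (ler_normD _ _))//.
by rewrite mulrDl lerD// normrZ -mulrA ler_wpM2l.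
Qed.

HB.instance Definition _ U V := GRing.isSubmodClosed.Build _ _
  (@bounded_linear U V) (@bounded_linear_submod_closed U V).
HB.instance Definition _ U V := [SubChoice_isSubLmodule of boundedOp U V by <:].

Lemma bop_linear U V (f : boundedOp U V) : linear f.
Proof. by case: f => f /= /[!inE] -[]. Qed.

Lemma bop_bounded U V (f : boundedOp U V) :
  exists M : R[i], forall x, `|f x| <= M * `|x|.
Proof. by case: f => f /= /[!inE] -[]. Qed.

HB.instance Definition _ U V (f : boundedOp U V) :=
  GRing.isLinear.Build R[i] U V _ (bop_fun f) (bop_linear f).

Lemma bopD U V (f g : boundedOp U V) x : (f + g) x = f x + g x.
Proof. by []. Qed.

Lemma bopZ U V a (f : boundedOp U V) x : (a *: f) x = a *: f x.
Proof. by []. Qed.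

Lemma bopP U V (f g : boundedOp U V) : f =1 g -> f = g.
Proof. by move=> fg; exact/val_inj/funext. Qed.

(* The norms of U and V take their values in R[i], whence the real part. *)
Definition opnorm U V (f : boundedOp U V) : R :=
  sup [set complex.Re `|f x| | x in [set x : U | `|x| <= 1]].

Let ReK V (x : V) : (complex.Re `|x|)%:C = `|x|.
Proof. exact/RRe_real/ger0_real. Qed.

Lemma bop_bounded_real U V (f : boundedOp U V) :
  exists2 M : R, 0 <= M & forall x, `|f x| <= M%:C * `|x|.
Proof.
have [M fM] := bop_bounded f.
have ReM : (complex.Re `|M|)%:C = `|M| by exact/RRe_real/normr_real.
exists (complex.Re `|M|) => [|x]; first by rewrite -ler0c ReM.
rewrite ReM (le_trans (fM x))// -[X in _ <= _ * X]normr_id -normrM.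
by rewrite real_ler_norm// ger0_real// (le_trans _ (fM x)).
Qed.

Lemma opnorm_has_sup U V (f : boundedOp U V) :
  has_sup [set complex.Re `|f x| | x in [set x : U | `|x| <= 1]].
Proof.
split; first by exists (complex.Re `|f 0|), 0 => //=; rewrite normr0.
have [M M0 fM] := bop_bounded_real f; exists M => _ [x /= x1 <-].
rewrite -lecR ReK (le_trans (fM x))// -[leRHS]mulr1.
by rewrite ler_wpM2l// ler0c.
Qed.

Lemma opnorm_ge0 U V (f : boundedOp U V) : 0 <= opnorm f.
Proof.
apply: sup_upper_bound; first exact: opnorm_has_sup.
by exists 0 => /=; rewrite ?linear0 normr0.
Qed.

Lemma opnormP U V (f : boundedOp U V) x : `|f x| <= (opnorm f)%:C * `|x|.
Proof.
have [->|x0] := eqVneq x 0; first by rewrite linear0 !normr0 mulr0.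
have nx : 0 < `|x| by rewrite normr_gt0.
rewrite -ler_pdivrMr// mulrC -[X in X * _]ger0_norm ?invr_ge0//.
rewrite -normrZ -linearZ -[leLHS]ReK lecR.
apply: sup_upper_bound; first exact: opnorm_has_sup.
exists (`|x|^-1 *: x) => //=.
by rewrite normrZ normfV normr_id mulVf// gt_eqF.
Qed.

Lemma opnorm_le U V (f : boundedOp U V) (M : R) : 0 <= M ->
  (forall x, `|f x| <= M%:C * `|x|) -> opnorm f <= M.
Proof.
move=> M0 fM; apply: ge_sup; first by case: (opnorm_has_sup f).
move=> _ [x /= x1 <-]; rewrite -lecR ReK (le_trans (fM x))// -[leRHS]mulr1.
by rewrite ler_wpM2l// ler0c.
Qed.

Fact opnormD U V (f g : boundedOp U V) :
  (opnorm (f + g))%:C <= (opnorm f)%:C + (opnorm g)%:C.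
Proof.
rewrite -rmorphD lecR; apply: opnorm_le; first by rewrite addr_ge0 ?opnorm_ge0.
move=> x; rewrite bopD rmorphD mulrDl (le_trans (ler_normD _ _))//.
by rewrite lerD ?opnormP.
Qed.

Fact opnormZ U V (a : R[i]) (f : boundedOp U V) :
  (opnorm (a *: f))%:C = `|a| * (opnorm f)%:C.
Proof.
have Rea (b : R[i]) : (complex.Re `|b|)%:C = `|b| by exact/RRe_real/normr_real.
have Rea0 (b : R[i]) : 0 <= complex.Re `|b| by rewrite -ler0c (Rea b).
have leZ (b : R[i]) (g : boundedOp U V) :
    (opnorm (b *: g))%:C <= `|b| * (opnorm g)%:C.
  rewrite -[in leRHS]Rea -rmorphM lecR; apply: opnorm_le.
    by rewrite mulr_ge0 ?opnorm_ge0.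
  by move=> x; rewrite bopZ normrZ rmorphM /= (Rea b) -mulrA ler_wpM2l ?opnormP.
have [->|a0] := eqVneq a 0.
  apply/eqP; rewrite eq_le leZ/= normr0 mul0r ler0c; exact: opnorm_ge0.
apply/eqP; rewrite eq_le leZ/= -ler_pdivlMl ?normr_gt0// -normfV.
by apply: le_trans (leZ _ _); rewrite scalerA mulVf// scale1r.
Qed.

Fact opnorm_eq0 U V (f : boundedOp U V) : (opnorm f)%:C = 0 :> R[i] -> f = 0.
Proof.
move=> f0; apply: bopP => x; apply/eqP; rewrite -normr_le0.
by rewrite (le_trans (opnormP f x))// f0 mul0r.
Qed.

HB.instance Definition _ U V := Lmodule_isNormed.Build R[i] (boundedOp U V)
  (@opnormD U V) (@opnormZ U V) (@opnorm_eq0 U V).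

Fact bounded_linear_id U : (id : U -> U) \in @bounded_linear U U.
Proof.
by rewrite inE; split=> //; exists 1 => x; rewrite mul1r.
Qed.

Definition bop_id U : boundedOp U U := BoundedOp (bounded_linear_id U).

Fact bounded_linear_comp U V W (g : boundedOp V W) (f : boundedOp U V) :
  (g \o f : U -> W) \in @bounded_linear U W.
Proof.
rewrite inE; split=> [a x y|]; first by rewrite /= !linearP.
have [N N0 gN] := bop_bounded_real g; have [M M0 fM] := bop_bounded_real f.
exists (N%:C * M%:C) => x; rewrite (le_trans (gN _))// -mulrA.
by rewrite ler_wpM2l ?ler0c.
Qed.

Definition bop_comp U V W (g : boundedOp V W) (f : boundedOp U V) :
  boundedOp U W := BoundedOp (bounded_linear_comp g f).

Definition bop_invertible U (T : boundedOp U U) :=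
  exists S : boundedOp U U, bop_comp S T = bop_id U /\ bop_comp T S = bop_id U.

End BoundedOperators.

Section TraceClass.
Context {R : realType}.
Implicit Types H K : hilbertType R.

Definition is_adjoint H K (T : boundedOp H K) (T' : boundedOp K H) :=
  forall x y, inner (T x) y = inner x (T' y).

(* In the order of R[i], [0 <= z] says that z is real and non-negative. *)
Definition positive_op H (P : boundedOp H H) := forall x, 0 <= inner (P x) x.

(* P = |T|, the positive square root of T^* T *)
Definition is_absolute_value H K (T : boundedOp H K) (P : boundedOp H H) :=
  positive_op P /\
  exists2 T' : boundedOp K H, is_adjoint T T' & bop_comp P P = bop_comp T' T.

Definition orthonormal_basis H (B : set H) :=
  [/\ forall e, B e -> inner e e = 1,
      forall e f, B e -> B f -> e <> f -> inner e f = 0 &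
      closure [set x | exists2 s : seq H, [set` s] `<=` B &
                exists c : H -> R[i], x = \sum_(e <- s) c e *: e] = setT].

(* The trace of |T| does not depend on the orthonormal basis computing it. *)
Definition trace_class H K (T : boundedOp H K) :=
  exists (P : boundedOp H H) (B : set H),
    [/\ is_absolute_value T P, orthonormal_basis B &
        (\esum_(e in B) (complex.Re (inner (P e) e))%:E < +oo)%E].

End TraceClass.

Section ClosedSubspace.
Context {K : numFieldType}.

Record closedSubspace (V : normedModType K) := ClosedSubspace {
  subspace_set : set V ;
  subspace0 : subspace_set 0 ;
  subspaceP : forall (a : K) (x y : V),
    subspace_set x -> subspace_set y -> subspace_set (a *: x + y) ;
  subspace_closed : closed subspace_set }.

Context {V : normedModType K}.
Implicit Type A : closedSubspace V.

Definition subspace_pred A : {pred V} := mem (subspace_set A).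

Record subspace_sort A := SubspaceSort {
  subspace_val :> V ;
  _ : subspace_val \in subspace_pred A }.

HB.instance Definition _ A := [isSub for @subspace_val A].
HB.instance Definition _ A := [Choice of subspace_sort A by <:].

Fact subspace_submod_closed A : submod_closed (subspace_pred A).
Proof.
split=> [|a x y]; rewrite !inE; first exact: subspace0.
exact: subspaceP.
Qed.

HB.instance Definition _ A := GRing.isSubmodClosed.Build _ _
  (subspace_pred A) (subspace_submod_closed A).
HB.instance Definition _ A := [SubChoice_isSubLmodule of subspace_sort A by <:].

Fact subspace_normD A (x y : subspace_sort A) :
  `|val (x + y)| <= `|val x| + `|val y|.
Proof. exact: ler_normD. Qed.

Fact subspace_normZ A (a : K) (x : subspace_sort A) :
  `|val (a *: x)| = `|a| * `|val x|.
Proof. exact: normrZ. Qed.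

Fact subspace_norm_eq0 A (x : subspace_sort A) : `|val x| = 0 -> x = 0.
Proof. by move=> /normr0_eq0 x0; exact/val_inj. Qed.

HB.instance Definition _ A := Lmodule_isNormed.Build K (subspace_sort A)
  (@subspace_normD A) (@subspace_normZ A) (@subspace_norm_eq0 A).

End ClosedSubspace.

Coercion subspace_sort : closedSubspace >-> Sortclass.

Section Holomorphy.
Context {R : realType}.
Implicit Types V W : normedModType R[i].

(* Functions are total and only their values on S matter: S is open in every
   use, so that differentiability at a point of S is local to S. *)
Definition holomorphic_on V W (S : set V) (f : V -> W) :=
  forall x, S x -> differentiable f x.

Definition is_domain V (E : set V) := [/\ E !=set0, open E & connected E].

Definition analytic_set V (S : set V) :=
  forall x : V, exists N : set V, [/\ open N, N x &
    exists (n : nat) (f : 'I_n -> V -> R[i]^o),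
      (forall i, holomorphic_on N (f i)) /\
      S `&` N = [set z | N z /\ forall i, f i z = 0]].

(* Neighbourhoods are neighbourhoods in E. *)
Definition locally_bounded_off V W (E D : set V) (h : V -> W) :=
  forall z, (E `\` D) z -> exists N : set V,
    [/\ nbhs z N, N `<=` E & [bounded h w | w in N `&` D]].

End Holomorphy.

(* Main.v *)
From HB Require Import structures.
Require Import Defs.
From mathcomp Require Import all_boot all_order all_algebra.
From mathcomp Require Import all_classical all_reals all_analysis.
From mathcomp Require Import perm complex.
From mathcomp Require Import ring lra.

Set Implicit Arguments.
Unset Strict Implicit.
Unset Printing Implicit Defensive.

Import Order.TTheory GRing.Theory Num.Theory.
Import numFieldNormedType.Exports.
Local Open Scope classical_set_scope.
Local Open Scope complex_scope.
Local Open Scope ring_scope.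

(** Write P(Z) = CZ + D and let DD be the set where P(Z) is invertible. Fix Z0 in
    DD. A trace class operator is a norm limit of finite rank operators
    ([trace_class_approx]), so that on any given ball of the space A there is a
    factorization
      P(Z) = P(Z0) (I + S(Z)) (I + F(Z))
    in which S(Z) has norm at most 1/2, hence I + S(Z) is invertible by a Neumann
    series, and F(Z) has finite rank. Therefore P(Z) is invertible if and only if
    the determinant f(Z) of a finite matrix representing I + F(Z) is nonzero, and f
    is holomorphic on the ball ([local_determinant]). Locally the complement of DD
    is thus the zero set of a single function, so it is analytic. Since the ball
    may be chosen to contain Z0, the equation f also satisfies f(Z0) <> 0 there.

    For the extension of h, let Z1 be a point outside DD and let v be a small
    multiple of Z0 - Z1. The one-variable function f(Z1 + lambda v) does not vanish
    identically, so its zeros are isolated ([zeros_finite]), and for v small enough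
    Z1 + lambda v lies in DD whenever 0 < |lambda| <= 2 ([good_direction]). Choose a
    closed contour around 0 in this punctured disc. By compactness Z + lambda v
    stays in DD for lambda on the contour and Z near Z1, so the mean
      hhat(Z) = c^-1 * oint h(Z + lambda v) / lambda dlambda,
      c = oint dlambda / lambda
    makes sense on a full neighbourhood of Z1. It is the pointwise limit of
    uniformly bounded Riemann sums, each of them holomorphic in Z, so it is
    holomorphic ([pointwise_limit]). If Z is in DD, then lambda |-> h(Z + lambda v)
    is bounded and holomorphic on a disc with finitely many points removed, none of
    them 0 or on the contour. These singularities are removable, and Cauchy's formula gives
    hhat(Z) = h(Z) ([cauchy_removable]). Finally DD is dense, so that the local
    extensions agree where they overlap ([holomorphic_extension]).

    The one-variable theory concerns functions with values in a Banach space. Their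
    integrals are limits of dyadic Riemann sums along segments, and the contour is
    the square with vertices 1, i, -1, -i. The main tool is Caratheodory's slope: g
    is differentiable at a if and only if the difference quotient at a, completed
    at a itself by some value, is continuous at a. Goursat's theorem still holds
    for a triangle with a vertex at which g is merely continuous
    ([vertex_goursat]); applied to a slope it yields Cauchy's formula
    ([cauchy_formula]), and this in turn shows that the slope of a differentiable
    function is again differentiable ([slope_cdiff]). Dividing by w - a is then
    always possible where a function vanishes: this removes bounded singularities
    of g, by dividing (w - a)^2 g twice ([removable1]), and factors out zeros, whose
    number is bounded by an estimate of Jensen's type ([zeros_bounded]). *)

(** * Real-valued norms over the complex numbers *)

Section RealNorm.
Context {R : realType}.
Local Notation C := R[i].
Implicit Types V W : normedModType C.

(** The norms take their values in R[i], whose order is only partial; their real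
    parts live in a totally ordered field, where linear arithmetic applies. *)
Definition rn V (x : V) : R := complex.Re `|x|.

Lemma rnE V (x : V) : (rn x)%:C = `|x|.
Proof. exact/RRe_real/ger0_real. Qed.

Lemma rn_ge0 V (x : V) : 0 <= rn x.
Proof. by rewrite -ler0c rnE. Qed.

Lemma rn0 V : rn (0 : V) = 0.
Proof. by rewrite /rn normr0. Qed.

Lemma rn0_eq0 V (x : V) : rn x = 0 -> x = 0.
Proof. by move=> x0; apply/normr0_eq0; rewrite -rnE x0. Qed.

Lemma rn_gt0 V (x : V) : (0 < rn x) = (x != 0).
Proof. by rewrite -[LHS](ltcR 0) rnE normr_gt0. Qed.

Lemma rnD V (x y : V) : rn (x + y) <= rn x + rn y.
Proof. by rewrite -lecR rmorphD /= !rnE ler_normD. Qed.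

Lemma rnN V (x : V) : rn (- x) = rn x.
Proof. by rewrite /rn normrN. Qed.

Lemma rnBC V (x y : V) : rn (x - y) = rn (y - x).
Proof. by rewrite -rnN opprB. Qed.

Lemma rnB V (x y : V) : rn (x - y) <= rn x + rn y.
Proof. by rewrite -(rnN y) rnD. Qed.

Lemma rn_tri V (y x z : V) : rn (x - z) <= rn (x - y) + rn (y - z).
Proof. by rewrite (le_trans _ (rnD _ _))// addrA subrK. Qed.

Lemma rnZ V (a : C) (x : V) : rn (a *: x) = rn (a : C^o) * rn x.
Proof.
by apply/complexI; rewrite rmorphM /= !rnE normrZ.
Qed.

Lemma rnM (a b : C^o) : rn (a * b : C^o) = rn a * rn b.
Proof. by apply/complexI; rewrite rmorphM /= !rnE normrM. Qed.

Lemma rnV (a : C^o) : rn (a^-1 : C^o) = (rn a)^-1.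
Proof. by apply/complexI; rewrite fmorphV /= !rnE normfV. Qed.

Lemma rn1 : rn (1 : C^o) = 1.
Proof. by rewrite /rn normr1. Qed.

Lemma rnR (t : R) : rn (t%:C : C^o) = `|t|.
Proof. by rewrite /rn normc_def /= expr0n addr0 sqrtr_sqr. Qed.

Lemma rn_Re (a : C^o) : `|complex.Re a| <= rn a.
Proof.
case: a => x y; rewrite /rn normc_def /= -sqrtr_sqr ler_sqrt ?addr_ge0 ?sqr_ge0//.
by rewrite lerDl sqr_ge0.
Qed.

Lemma rn_Im (a : C^o) : `|complex.Im a| <= rn a.
Proof.
case: a => x y; rewrite /rn normc_def /= -sqrtr_sqr ler_sqrt ?addr_ge0 ?sqr_ge0//.
by rewrite lerDr sqr_ge0.
Qed.

Lemma rn_ReIm (a : C^o) : rn a <= `|complex.Re a| + `|complex.Im a|.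
Proof.
rewrite -(rnR (complex.Re a)) -(rnR (complex.Im a)).
rewrite -[X in _ <= _ + X]mul1r.
have <- : rn ('i : C^o) = 1 by rewrite /rn normc_def /= expr0n add0r expr1n sqrtr1.
by rewrite -rnM; case: a => x y /=; rewrite {1}(complexE (x +i* y)) rnD.
Qed.

Lemma ReD (x y : C) : complex.Re (x + y) = complex.Re x + complex.Re y.
Proof. by case: x y => [? ?] []. Qed.

Lemma ImD (x y : C) : complex.Im (x + y) = complex.Im x + complex.Im y.
Proof. by case: x y => [? ?] []. Qed.

Lemma ReB (x y : C) : complex.Re (x - y) = complex.Re x - complex.Re y.
Proof. by case: x y => [? ?] []. Qed.

Lemma ReZ (t : R) (x : C) : complex.Re (t%:C * x) = t * complex.Re x.
Proof. by case: x => x y /=; rewrite mul0r subr0. Qed.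

Lemma nbhs_rnP V (z : V) (P : set V) :
  (\forall w \near z, P w) <->
  exists2 d : R, 0 < d & forall w, rn (w - z) <= d -> P w.
Proof.
split=> [/nbhs_ballP[e /= e0 eP]|[d d0 dP]].
  have e0' : 0 < complex.Re e.
    by move: e0; rewrite ltcE => /andP[].
  have eE : (complex.Re e)%:C = e by apply/RRe_real/ger0_real/ltW.
  exists (complex.Re e / 2) => [|w wz]; first by rewrite divr_gt0.
  apply: eP; rewrite -ball_normE /= distrC -rnE -eE ltcR (le_lt_trans wz)//.
  by rewrite ltr_pdivrMr// ltr_pMr// ltr1n.
apply/nbhs_ballP; exists d%:C => /=; first by rewrite (ltcR 0).
move=> w; rewrite -ball_normE /= distrC -rnE ltcR => /ltW; exact: dP.
Qed.

Lemma cvg_rnP V (T : Type) (F : set_system T) (FF : Filter F) (f : T -> V) (l : V) :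
  (f @ F --> l) <-> forall e : R, 0 < e -> \forall x \near F, rn (f x - l) <= e.
Proof.
split=> [fl e e0|fl].
  by apply: (fl [set y | rn (y - l) <= e]); apply/nbhs_rnP; exists e.
move=> P /nbhs_rnP[d d0 dP]; apply: filterS (fl _ d0) => x; exact: dP.
Qed.

Lemma cvg_seqP V (u : nat -> V) (l : V) :
  (u @ \oo --> l) <-> forall e : R, 0 < e ->
    exists N, forall n, (N <= n)%N -> rn (u n - l) <= e.
Proof.
rewrite cvg_rnP; split=> ul e /ul; last by move=> [N NP]; exists N.
by move=> [N _ NP]; exists N => n nN; exact: NP.
Qed.

Lemma continuous_rnP V W (f : V -> W) (z : V) :
  {for z, continuous f} <-> forall e : R, 0 < e ->
    exists2 d : R, 0 < d & forall w, rn (w - z) <= d -> rn (f w - f z) <= e.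
Proof.
rewrite /prop_for /continuous_at cvg_rnP.
by split=> fz e /fz/nbhs_rnP.
Qed.

Lemma cauchy_rn_cvg (X : completeNormedModType C) (u : nat -> X) :
  (forall e : R, 0 < e -> exists N, forall m n, (N <= m)%N -> (N <= n)%N ->
     rn (u m - u n) <= e) -> cvgn u.
Proof.
move=> uC; apply/cauchy_cvgP/cauchy_ballP => e e0.
have e0' : 0 < complex.Re e by move: e0; rewrite ltcE => /andP[].
have eE : (complex.Re e)%:C = e by apply/RRe_real/ger0_real/ltW.
have [N NP] := uC _ (divr_gt0 e0' (@ltr0Sn R 1)).
exists (u @` [set n | (N <= n)%N], u @` [set n | (N <= n)%N]).
  by split; exists N => // n nN; exists n.
move=> [_ _] [[/= m mN <-] [n nN <-]]; rewrite -ball_normE /= -rnE -eE ltcR.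
by rewrite (le_lt_trans (NP _ _ mN nN))// ltr_pdivrMr// ltr_pMr// ltr1n.
Qed.

End RealNorm.

Section Complete.
Context {R : realType}.
Local Notation C := R[i].

(** Real and imaginary parts are 1-Lipschitz, so both images of a Cauchy filter
    converge in R. *)
Fact complex_complete (F : set_system C^o) : ProperFilter F -> cauchy F -> cvg F.
Proof.
move=> FF Fc.
have aux (p : C^o -> R) : (forall x y, `|p x - p y| <= rn (x - y)) -> cvg (p @ F).
  move=> pl; apply/cauchy_cvgP/cauchy_ballP => e e0.
  have ec0 : 0 < e%:C :> C by rewrite (ltcR 0).
  move/cauchy_ballP : Fc => /(_ _ ec0) [[P Q] [/= FP FQ] PQ].
  exists (p @` P, p @` Q) => /=.
    by split; [apply: filterS FP | apply: filterS FQ] => x Px; exists x.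
  move=> [_ _] [/= [x Px <-] [y Qy <-]] /=.
  have := PQ (x, y) (conj Px Qy); rewrite -!ball_normE /= -rnE ltcR.
  exact/le_lt_trans/pl.
have /cvg_ex[a /= Fa] : cvg ((@complex.Re R : C^o -> R) @ F).
  by apply: aux => x y; rewrite (le_trans _ (rn_Re _))//; case: x y => [? ?] [].
have /cvg_ex[b /= Fb] : cvg ((@complex.Im R : C^o -> R) @ F).
  by apply: aux => x y; rewrite (le_trans _ (rn_Im _))//; case: x y => [? ?] [].
apply/cvg_ex; exists (a +i* b).
suff: id @ F --> (a +i* b : C^o) by apply.
apply/cvg_rnP => e e0.
have e20 : 0 < e / 2 by rewrite divr_gt0.
move/cvgr_dist_le : Fa => /(_ _ e20) Fa; move/cvgr_dist_le : Fb => /(_ _ e20) Fb.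
near=> x.
rewrite (le_trans (rn_ReIm _))// [e]splitr lerD//.
  rewrite [complex.Re _](_ : _ = complex.Re x - a); last by case: (x).
  by rewrite distrC; near: x; exact: Fa.
rewrite [complex.Im _](_ : _ = complex.Im x - b); last by case: (x).
by rewrite distrC; near: x; exact: Fb.
Unshelve. all: by end_near. Qed.

End Complete.

(** The complex line as a Banach space over itself, so that scalar functions are
    an instance of vector-valued ones. *)
Definition cplane (R : realType) : completeNormedModType R[i] :=
  HB.pack (R[i]^o) (Uniform_isComplete.Build (R[i]^o) (@complex_complete R)).

(** * Complex derivatives and slopes *)

Section ContinuityRules.
Context {R : realType}.
Local Notation C := R[i].
Context {T : topologicalType} {X : normedModType C}.
Implicit Types (f g : T -> X) (a b : T -> C^o) (z : T).

Lemma cts_cst (x : X) z : {for z, continuous (fun _ : T => x)}.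
Proof. exact: cvg_cst. Qed.

Lemma ctsD f g z : {for z, continuous f} -> {for z, continuous g} ->
  {for z, continuous (fun w => f w + g w)}.
Proof. exact: cvgD. Qed.

Lemma ctsB f g z : {for z, continuous f} -> {for z, continuous g} ->
  {for z, continuous (fun w => f w - g w)}.
Proof. exact: cvgB. Qed.

Lemma ctsZ a g z : {for z, continuous a} -> {for z, continuous g} ->
  {for z, continuous (fun w => a w *: g w)}.
Proof. exact: cvgZ. Qed.

Lemma ctsV a z : a z != 0 -> {for z, continuous a} ->
  {for z, continuous (fun w => (a w)^-1 : C^o)}.
Proof. exact: cvgV. Qed.

End ContinuityRules.

Section ComplexDerivative.
Context {R : realType}.
Local Notation C := R[i].
Implicit Types (X : normedModType C).

(** [cder g z d] says that g has derivative d at z; the unknown derivative is an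
    argument, so that no default value enters. *)
Definition cder X (g : C^o -> X) (z : C^o) (d : X) :=
  forall e : R, 0 < e -> exists2 r : R, 0 < r &
    forall w, rn (w - z) <= r -> rn (g w - g z - (w - z) *: d) <= e * rn (w - z).

Definition cdiff X (g : C^o -> X) (z : C^o) := exists d, cder g z d.

(** Caratheodory's difference quotient at z, completed at z by the value d. *)
Definition slope X (g : C^o -> X) (z : C^o) (d : X) : C^o -> X :=
  fun w => if w == z then d else (w - z)^-1 *: (g w - g z).

Lemma slope_at X (g : C^o -> X) z d : slope g z d z = d.
Proof. by rewrite /slope eqxx. Qed.

Lemma slopeE X (g : C^o -> X) z d w : g w = g z + (w - z) *: slope g z d w.
Proof.
rewrite /slope; case: eqP => [->|/eqP wz]; first by rewrite subrr scale0r addr0.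
by rewrite scalerA divff ?subr_eq0// scale1r addrC subrK.
Qed.

Lemma cder_slope X (g : C^o -> X) z d :
  cder g z d <-> {for z, continuous (slope g z d)}.
Proof.
rewrite continuous_rnP; split=> gd e e0; have [r r0 rP] := gd _ e0.
  exists r => // w wr; rewrite slope_at; have [->|wz] := eqVneq w z.
    by rewrite slope_at subrr rn0 ltW.
  have w0 : 0 < rn (w - z : C^o) by rewrite rn_gt0 subr_eq0.
  rewrite -(ler_pM2l w0) -rnZ scalerBr mulrC -[X in X - _](addKr (g z)).
  by rewrite -slopeE addrC; have := rP _ wr; rewrite addrC [_ - g z]addrC.
exists r => // w wr; rewrite (slopeE g z d w) (addrC (g z)) addrK -scalerBr rnZ.
by rewrite mulrC ler_wpM2r ?rn_ge0//; have := rP _ wr; rewrite slope_at.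
Qed.

(** The converse use of slopes: any continuous factor q computes the derivative,
    which reduces the differentiation rules to continuity rules. *)
Lemma cder_caratheodory X (g q : C^o -> X) z :
  {for z, continuous q} -> (forall w, g w = g z + (w - z) *: q w) ->
  cder g z (q z).
Proof.
move=> /continuous_rnP qc gq e e0; have [r r0 rP] := qc _ e0.
exists r => // w wr; rewrite gq (addrC (g z)) addrK -scalerBr rnZ mulrC.
by rewrite ler_wpM2r ?rn_ge0// rP.
Qed.

Lemma cts_sub (p z : C^o) : {for z, continuous (fun w : C^o => w - p : C^o)}.
Proof. by apply: ctsB; [exact: cvg_id | exact: cts_cst]. Qed.

Lemma cder_cts X (g : C^o -> X) z d : cder g z d -> {for z, continuous g}.
Proof.
move=> /cder_slope gs; rewrite (_ : g = fun w => g z + (w - z) *: slope g z d w).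
  apply: ctsD; first exact: cts_cst.
  by apply: ctsZ => //; exact: cts_sub.
by apply/funext => w; rewrite -slopeE.
Qed.

Lemma cdiff_cts X (g : C^o -> X) z : cdiff g z -> {for z, continuous g}.
Proof. by move=> [d]; exact: cder_cts. Qed.

Lemma cder_near X (f g : C^o -> X) z d : (\forall w \near z, f w = g w) ->
  cder f z d -> cder g z d.
Proof.
move=> /nbhs_rnP[r0 r00 fg] fd e e0; have [r r_gt0 rP] := fd _ e0.
exists (Num.min r0 r) => [|w]; first by rewrite lt_min r00.
rewrite le_min => /andP[/fg <- wr]; rewrite -(fg z) ?subrr ?rn0 ?(ltW r00)//.
exact: rP.
Qed.

Lemma cdiff_near X (f g : C^o -> X) z : (\forall w \near z, f w = g w) ->
  cdiff f z -> cdiff g z.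
Proof. by move=> fg [d fd]; exists d; exact: cder_near fd. Qed.

Lemma cder_cst X (x : X) z : cder (cst x) z 0.
Proof.
move=> e e0; exists 1 => // w _.
by rewrite /cst subrr scaler0 subr0 rn0 mulr_ge0 ?rn_ge0// ltW.
Qed.

Lemma cderB X (f g : C^o -> X) z df dg :
  cder f z df -> cder g z dg -> cder (fun w => f w - g w) z (df - dg).
Proof.
move=> /cder_slope fs /cder_slope gs.
rewrite -(slope_at f z df) -(slope_at g z dg).
apply: (@cder_caratheodory _ _ (fun w => slope f z df w - slope g z dg w)).
  exact: ctsB.
move=> w; rewrite {1}(slopeE f z df w) {1}(slopeE g z dg w).
by rewrite scalerBr opprD addrACA.
Qed.

Lemma cderZ X (a : C^o -> C^o) (g : C^o -> X) z da dg :
  cder a z da -> cder g z dg ->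
  cder (fun w => a w *: g w) z (da *: g z + a z *: dg).
Proof.
move=> ad gd; have ac := cder_cts ad; have gc := cder_cts gd.
move: ad gd => /cder_slope as_ /cder_slope gs.
rewrite -(slope_at a z da) -(slope_at g z dg).
apply: (@cder_caratheodory _ _
  (fun w => slope a z da w *: g w + a z *: slope g z dg w)).
  have az : {for z, continuous (fun _ : C^o => a z : C^o)} by exact: (@cst_continuous C^o C^o).
  exact: (ctsD (ctsZ as_ gc) (ctsZ az gs)).
move=> w; rewrite scalerDr !scalerA [(w - z) * a z]mulrC -(scalerA (a z)).
have -> : (w - z) *: slope g z dg w = g w - g z.
  by rewrite [in RHS](slopeE g z dg w) (addrC (g z)) addrK.
have -> : (w - z) * slope a z da w = a w - a z.
  by rewrite [in RHS](slopeE a z da w) (addrC (a z)) addrK.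
by rewrite scalerBl scalerBr subrKA addrC subrK.
Qed.

Lemma cder_id (z : C^o) : cder (id : C^o -> C^o) z 1.
Proof.
move=> e e0; exists 1 => // w _.
rewrite /= [(w - z) *: 1]mulr1 subrr rn0 mulr_ge0 ?rn_ge0//; exact: ltW.
Qed.

(** The slope of w |-> (w - p)^-1 at z is -(w - p)^-1 (z - p)^-1, which is continuous
    at z. *)
Lemma cdiff_inv (p z : C^o) : z != p -> cdiff (fun w : C^o => (w - p)^-1 : C^o) z.
Proof.
move=> zp; have zp0 : z - p != 0 by rewrite subr_eq0.
exists (slope (fun w : C^o => (w - p)^-1 : C^o) z (- ((z - p)^-1 * (z - p)^-1)) z).
apply: (@cder_caratheodory _ _ _ _ _ (slopeE _ _ _)).
apply/continuous_rnP.
have : {for z, continuous (fun w : C^o => (w - p)^-1 *: - (z - p)^-1 : C^o)}.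
  by apply: ctsZ; [apply: ctsV => //; exact: cts_sub | exact: cts_cst].
move=> /continuous_rnP h e e0; have [r r0 rP] := h _ e0.
have zp1 : 0 < rn (z - p : C^o) by rewrite rn_gt0.
exists (Num.min r (rn (z - p : C^o) / 2)) => [|w].
  by rewrite lt_min r0 divr_gt0.
rewrite le_min => /andP[/rP wr wzp].
have wp0 : w - p != 0.
  apply/negP => /eqP/subr0_eq wp; move: wzp; rewrite wp rnBC; lra.
rewrite slope_at /slope; case: eqP => [_|/eqP wz]; first by rewrite subrr rn0 ltW.
apply: le_trans wr; rewrite le_eqVlt; apply/orP; left; apply/eqP; congr (rn (_ - _));
  rewrite /GRing.scale /=; field; rewrite ?zp0 ?wp0 ?subr_eq0 ?wz //.
Qed.

Lemma cder_affine X (g : C^o -> X) (p r z : C^o) d :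
  cder g (p + r * z) d -> cder (fun w : C^o => g (p + r * w)) z (r *: d).
Proof.
have pE w : p + r * w - (p + r * z) = r * (w - z) :> C^o by ring.
have rr : 0 < rn r + 1 by rewrite ltr_wpDl ?rn_ge0.
move=> gd e e0; have [s s0 sP] := gd _ (divr_gt0 e0 rr).
exists (s / (rn r + 1)) => [|w wz]; first by rewrite divr_gt0.
have rs : rn (r * (w - z) : C^o) <= s.
  rewrite rnM (le_trans (ler_wpM2l (rn_ge0 _) wz))// mulrCA ler_piMr ?(ltW s0)//.
  by rewrite ler_pdivrMr// mul1r lerDl.
have := sP (p + r * w); rewrite pE => /(_ rs).
rewrite scalerA [(w - z) * r]mulrC => /le_trans; apply.
rewrite rnM mulrA ler_wpM2r ?rn_ge0// -mulrA ler_piMr ?(ltW e0)//.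
by rewrite mulrC ler_pdivrMr// mul1r lerDl.
Qed.

Lemma cdiffB X (f g : C^o -> X) z :
  cdiff f z -> cdiff g z -> cdiff (fun w => f w - g w) z.
Proof. by move=> [df fP] [dg gP]; exists (df - dg); exact: cderB. Qed.

Lemma cdiffZ X (a : C^o -> C^o) (g : C^o -> X) z :
  cdiff a z -> cdiff g z -> cdiff (fun w => a w *: g w) z.
Proof. by move=> [da aP] [dg gP]; eexists; exact: cderZ aP gP. Qed.

Lemma cdiff_affine X (g : C^o -> X) (p r z : C^o) :
  cdiff g (p + r * z) -> cdiff (fun w : C^o => g (p + r * w)) z.
Proof. by move=> [d gP]; exists (r *: d); exact: cder_affine. Qed.

Lemma cdiff_cst X (x : X) z : cdiff (cst x) z.
Proof. by exists 0; exact: cder_cst. Qed.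

Lemma cdiff_sub p z : cdiff (fun w : C^o => w - p : C^o) z.
Proof. by apply: cdiffB; [exists 1; exact: cder_id | exact: cdiff_cst]. Qed.

(** Away from its base point, a slope is a quotient of differentiable functions. *)
Lemma cdiff_slope X (g : C^o -> X) a d z : z != a -> cdiff g z ->
  cdiff (slope g a d) z.
Proof.
move=> za gz; apply: (@cdiff_near _ (fun w => (w - a)^-1 *: (g w - g a))).
  apply/nbhs_rnP; have za0 : 0 < rn (z - a : C^o) by rewrite rn_gt0 subr_eq0.
  exists (rn (z - a : C^o) / 2) => [|w wz]; first by rewrite divr_gt0.
  rewrite /slope; case: eqP => // wa; move: wz; rewrite wa rnBC => h; exfalso; lra.
apply: cdiffZ; first exact: cdiff_inv.
by apply: cdiffB => //; exact: cdiff_cst.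
Qed.

End ComplexDerivative.

(** * Segments of the complex plane *)

Section Segments.
Context {R : realType}.
Local Notation C := R[i].

Definition seg (a b : C^o) : set C^o :=
  [set x | exists2 t : R, 0 <= t <= 1 & x = a + t%:C * (b - a)].

Definition mid (a b : C^o) : C^o := (a + b) / 2%:R.

Lemma seg_l a b : seg a b a.
Proof. by exists 0; rewrite ?lexx ?ler01// mul0r addr0. Qed.

Lemma seg_r a b : seg a b b.
Proof. by exists 1; rewrite ?lexx ?ler01// mul1r addrC subrK. Qed.

Lemma complex_half : 2^-1 = (2^-1 : R)%:C :> C.
Proof. by rewrite fmorphV rmorphMn. Qed.

Lemma seg_mid a b : seg a b (mid a b).
Proof.
exists (2^-1); first by apply/andP; lra.
by rewrite -complex_half /mid; field.
Qed.

Lemma seg_sub a b x y z : seg a b x -> seg a b y -> seg x y z -> seg a b z.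
Proof.
move=> [t /andP[t0 t1] ->] [s /andP[s0 s1] ->] [u /andP[u0 u1] ->].
exists (t + u * (s - t)); last by rewrite rmorphD rmorphM rmorphB /=; ring.
by apply/andP; split; nra.
Qed.

Lemma segC a b : seg a b = seg b a.
Proof.
have aux x y z : seg x y z -> seg y x z.
  move=> [t t01 ->]; exists (1 - t); first by apply/andP; lra.
  by rewrite rmorphB /=; ring.
by apply/seteqP; split => z; exact: aux.
Qed.

Lemma rn_seg_l a b x : seg a b x -> rn (x - a) <= rn (b - a).
Proof.
move=> [t /andP[t0 t1] ->]; rewrite addrC addKr rnM rnR ger0_norm//.
by rewrite ler_piMl ?rn_ge0.
Qed.

Lemma rn_mid_l a b : rn (mid a b - a) = rn (b - a) / 2.
Proof.
have -> : mid a b - a = (2^-1 : R)%:C * (b - a) :> C^o by rewrite -complex_half /mid; field.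
by rewrite rnM rnR mulrC ger0_norm// invr_ge0.
Qed.

Lemma rn_mid_r a b : rn (b - mid a b) = rn (b - a) / 2.
Proof.
have -> : b - mid a b = (2^-1 : R)%:C * (b - a) :> C^o by rewrite -complex_half /mid; field.
by rewrite rnM rnR mulrC ger0_norm// invr_ge0.
Qed.

(** The tube lemma: a property that is locally uniform along a segment is uniform
    along it, because [0, 1] is compact. The filter F is a neighbourhood filter in
    the applications, either of a point of a normed space or of radii or bounds. *)
Lemma seg_tube (I : Type) (F : set_system I) (FF : Filter F)
    (P : I -> C^o -> Prop) a b :
  (forall x, seg a b x -> exists2 d : R, 0 < d &
     \forall i \near F, forall y, rn (y - x) <= d -> P i y) ->
  \forall i \near F, forall x, seg a b x -> P i x.
Proof.
move=> PP; pose Q (i : I) (t : R) := P i (a + t%:C * (b - a)).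
have /compact_near_coveringP cov : compact `[0 : R, 1] by exact: segment_compact.
have : \near F, `[0 : R, 1]%classic `<=` Q F.
  apply: cov => t /=; rewrite in_itv /= => t01.
  have [|d d0 dP] := PP (a + t%:C * (b - a)); first by exists t.
  have len0 : 0 < rn (b - a) + 1 by rewrite ltr_wpDl ?rn_ge0.
  exists (ball t (d / (rn (b - a) + 1)),
      [set i | forall y, rn (y - (a + t%:C * (b - a))) <= d -> P i y]) => /=.
    by split => //; apply: nbhsx_ballx; rewrite divr_gt0.
  move=> [s i] /= [ts]; apply.
  rewrite opprD addrACA subrr add0r -mulrBl -rmorphB rnM rnR.
  move: ts; rewrite -ball_normE /= distrC => /ltW ts.
  rewrite (le_trans (ler_wpM2r (rn_ge0 _) ts))// -mulrA ler_piMr ?(ltW d0)//.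
  by rewrite mulrC ler_pdivrMr// mul1r lerDl.
apply: filterS => i Qi x [t t01 ->]; apply: (Qi t).
by rewrite /= in_itv.
Qed.

Lemma seg_uniform (X : normedModType C) (g : C^o -> X) a b :
  (forall x, seg a b x -> {for x, continuous g}) ->
  forall e : R, 0 < e -> exists2 d : R, 0 < d &
    forall x y, seg a b x -> rn (y - x) <= d -> rn (g y - g x) <= e.
Proof.
move=> gc e e0; pose P (d : R) (x : C^o) :=
  forall y, rn (y - x) <= d -> rn (g y - g x) <= e.
have PP : \forall d \near (0 : R)^'+, forall x, seg a b x -> P d x.
  apply: seg_tube => x abx.
  have e20 : 0 < e / 2 by rewrite divr_gt0.
  have [r r0 rP] := (continuous_rnP g x).1 (gc x abx) _ e20.
  exists (r / 2); first by rewrite divr_gt0.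
  have r20 : 0 < r / 2 by rewrite divr_gt0.
  near=> d => y yx z zy.
  have d2 : d <= r / 2 by near: d; exact: nbhs_right_le.
  rewrite (le_trans (rn_tri (g x) _ _))// [e]splitr lerD//.
    apply: rP; rewrite (le_trans (rn_tri y _ _))//; lra.
  by rewrite rnBC; apply: rP; lra.
near (0 : R)^'+ => d; exists d => //.
move=> x y abx; have : forall x, seg a b x -> P d x by near: d.
by apply.
Unshelve. all: by end_near. Qed.

Lemma seg_bounded (X : normedModType C) (g : C^o -> X) a b :
  (forall x, seg a b x -> {for x, continuous g}) ->
  exists M : R, forall x, seg a b x -> rn (g x) <= M.
Proof.
move=> gc; pose P (M : R) (x : C^o) := rn (g x) <= M.
have PP : \forall M \near +oo, forall x, seg a b x -> P M x.
  apply: seg_tube => x abx.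
  have [r r0 rP] := (continuous_rnP g x).1 (gc x abx) _ ltr01.
  exists r => //; have := nbhs_pinfty_ge (num_real (1 + rn (g x))).
  apply: filterS => M MP y /rP yx; rewrite /P.
  have -> : g y = (g y - g x) + g x by rewrite subrK.
  by rewrite (le_trans (rnD _ _))// (le_trans (lerD yx (lexx _))).
by have [M MP] := filter_ex PP; exists M.
Qed.

End Segments.

(** * Integration along segments *)

Section Limits.
Context {R : realType} {X : normedModType R[i]}.
Implicit Types (u v : nat -> X) (l k : X).

Lemma seq_lim u l : u @ \oo --> l -> lim (u @ \oo) = l.
Proof. exact: (@cvg_lim _ (@norm_hausdorff _ X)). Qed.

Lemma seq_uniq u l k : u @ \oo --> l -> u @ \oo --> k -> l = k.
Proof. by move=> /seq_lim <- /seq_lim. Qed.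

Lemma cvg_seqD u v l k : u @ \oo --> l -> v @ \oo --> k -> (fun n => u n + v n) @ \oo --> l + k.
Proof. exact: cvgD. Qed.

Lemma cvg_seqB u v l k : u @ \oo --> l -> v @ \oo --> k -> (fun n => u n - v n) @ \oo --> l - k.
Proof. exact: cvgB. Qed.

Lemma cvg_seqZ (c : R[i]) u l : u @ \oo --> l -> (fun n => c *: u n) @ \oo --> c *: l.
Proof. exact: cvgZl_tmp. Qed.

Lemma cvg_seqS u l : u @ \oo --> l -> (fun n => u n.+1) @ \oo --> l.
Proof. by move=> ul; rewrite (@cvg_shiftS _ u (nbhs l)). Qed.

Lemma seq_bound u l (M : R) : u @ \oo --> l -> (forall n, rn (u n) <= M) -> rn l <= M.
Proof.
move=> /cvg_seqP ul uM; apply/ler_addgt0Pr => e e0.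
have [N /(_ N (leqnn N)) Nl] := ul _ e0.
have -> : l = u N - (u N - l) by rewrite opprB addrC subrK.
by rewrite (le_trans (rnB _ _))// lerD.
Qed.

Lemma seq_close u v l : u @ \oo --> l ->
  (forall e : R, 0 < e -> exists N, forall n, (N <= n)%N -> rn (u n - v n) <= e) ->
  v @ \oo --> l.
Proof.
move=> /cvg_seqP ul uv; apply/cvg_seqP => e e0.
have e20 : 0 < e / 2 by rewrite divr_gt0.
have [N NP] := ul _ e20; have [N' NP'] := uv _ e20.
exists (maxn N N') => n; rewrite geq_max => /andP[/NP h /NP' h'].
by rewrite (le_trans (rn_tri (u n) _ _))// rnBC [e]splitr lerD.
Qed.

End Limits.

Lemma div_pow2_small (R : realType) (d c : R) : 0 < d ->
  exists N, forall n, (N <= n)%N -> c / 2 ^+ n <= d.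
Proof.
move=> d0; have p0 n : 0 < 2 ^+ n :> R by rewrite exprn_gt0.
exists (Num.Def.trunc (c / d)).+1 => n nN; rewrite ler_pdivrMr// mulrC -ler_pdivrMr//.
rewrite (@le_trans _ _ n%:R)//.
  have := truncnS_gt (c / d) => /ltW h; rewrite (le_trans h)// ler_nat; exact: nN.
by rewrite -natrX ler_nat ltnW// ltn_expl.
Qed.

(** Nested triangles and Neumann iterates both move by steps that halve; the rate
    locates the limit point of the triangles. *)
Lemma cvg_geometric (R : realType) (X : completeNormedModType R[i]) (u : nat -> X) (d : R) :
  0 <= d -> (forall n, rn (u n.+1 - u n) <= d / 2 ^+ n) ->
  exists l, u @ \oo --> l /\ forall n, rn (l - u n) <= 2 * d / 2 ^+ n.
Proof.
move=> d0 du.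
have uk n k : rn (u (n + k)%N - u n) <= 2 * d / 2 ^+ n - 2 * d / 2 ^+ (n + k).
  elim: k => [|k IH]; first by rewrite addn0 !subrr rn0.
  have h := rn_tri (u (n + k)%N) (u (n + k).+1) (u n); have h' := du (n + k)%N.
  have E : 2 * d / 2 ^+ (n + k).+1 = d / 2 ^+ (n + k).
    by rewrite exprS; field; rewrite expf_neq0.
  have E2 : 2 * d / 2 ^+ (n + k) = d / 2 ^+ (n + k) + d / 2 ^+ (n + k).
    by field; rewrite expf_neq0.
  by rewrite addnS E; rewrite E2 in IH; lra.
have uk' n k : rn (u (n + k)%N - u n) <= 2 * d / 2 ^+ n.
  by apply: (le_trans (uk n k)); rewrite gerBl divr_ge0 ?mulr_ge0 ?exprn_ge0.
have /cvg_ex[/= l ul] : cvgn u.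
  apply: cauchy_rn_cvg => e e0.
  have e20 : 0 < e / 2 by rewrite divr_gt0.
  have [N NP] := div_pow2_small (2 * d) e20; exists N => m n mN nN.
  rewrite (le_trans (rn_tri (u N) _ _))// [e]splitr lerD//.
    by rewrite -(subnKC mN) (le_trans (uk' _ _))// NP.
  by rewrite rnBC -(subnKC nN) (le_trans (uk' _ _))// NP.
exists l; split=> // n.
have h : (fun k => u (n + k)%N - u n) @ \oo --> l - u n.
  apply: cvg_seqB; last exact: cvg_cst.
  apply/cvg_seqP => e; move/cvg_seqP : ul => /[apply] -[N NP].
  by exists N => k kN; apply: NP; rewrite (leq_trans kN)// leq_addl.
exact: seq_bound h (uk' n).
Qed.

Section DyadicIntegral.
Context {R : realType}.
Local Notation C := R[i].

(** The mean of g over the 2^n left end points of the dyadic subdivision of the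
    segment, by recursion on both halves, so that the additivity at the midpoint is
    part of the definition. *)
Fixpoint dsum (X : lmodType C) (n : nat) (g : C^o -> X) (a b : C^o) : X :=
  if n is m.+1 then 2^-1 *: (dsum m g a (mid a b) + dsum m g (mid a b) b) else g a.

Section NormedModule.
Context {X : normedModType C}.
Implicit Types (f g : C^o -> X) (a b : C^o) (n : nat).

Lemma seg_ml a b x : seg a (mid a b) x -> seg a b x.
Proof. exact: (seg_sub (seg_l _ _) (seg_mid _ _)). Qed.

Lemma seg_mr a b x : seg (mid a b) b x -> seg a b x.
Proof. exact: (seg_sub (seg_mid _ _) (seg_r _ _)). Qed.

Lemma halfD (x : X) : 2^-1 *: (x + x) = x.
Proof.
rewrite scalerDr -scalerDl; have -> : 2^-1 + 2^-1 = 1 :> C by field.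
exact: scale1r.
Qed.

Lemma rn_half (x : X) : rn (2^-1 *: x : X) = rn x / 2.
Proof. by rewrite rnZ complex_half rnR ger0_norm ?invr_ge0// mulrC. Qed.

Lemma dsumB n f g a b : dsum n (fun w => f w - g w) a b = dsum n f a b - dsum n g a b.
Proof.
elim: n a b => //= n IH a b; rewrite !IH -scalerBr; congr (_ *: _).
by rewrite opprD addrACA.
Qed.

Lemma dsum_cst n (x : X) a b : dsum n (fun=> x) a b = x.
Proof. by elim: n a b => //= n IH a b; rewrite !IH halfD. Qed.

Lemma dsumZ n (c : C) g a b : dsum n (fun w => c *: g w) a b = c *: dsum n g a b.
Proof.
elim: n a b => //= n IH a b.
by rewrite !IH -scalerDr !scalerA mulrC.
Qed.

Lemma dsum_eq n f g a b : (forall x, seg a b x -> f x = g x) ->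
  dsum n f a b = dsum n g a b.
Proof.
elim: n a b => /= [|n IH] a b fg; first exact/fg/seg_l.
by rewrite !IH// => x xs; apply: fg; [exact: seg_mr | exact: seg_ml].
Qed.

Lemma dsum_bound n g a b (M : R) : (forall x, seg a b x -> rn (g x) <= M) ->
  rn (dsum n g a b) <= M.
Proof.
elim: n a b => /= [|n IH] a b gM; first exact/gM/seg_l.
rewrite rn_half (le_trans (ler_wpM2r _ (rnD _ _)))//.
have h1 := IH _ _ (fun x xs => gM x (seg_ml xs)).
have h2 := IH _ _ (fun x xs => gM x (seg_mr xs)).
by lra.
Qed.

(** The oscillation of g on [a, b] at the scale of the n-th dyadic subdivision. It
    is inherited by both halves at scale n - 1, which is what inductions on [dsum]
    need. *)
Definition osc n g a b (e : R) := forall x y, seg a b x -> seg a b y ->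
  rn (y - x) <= rn (b - a) / 2 ^+ n -> rn (g y - g x) <= e.

Lemma oscS n g a b e : osc n.+1 g a b e -> osc n g a (mid a b) e /\ osc n g (mid a b) b e.
Proof.
move=> h; split=> x y xs ys; rewrite ?rn_mid_l ?rn_mid_r -mulrA -invfM -exprS.
  by apply: h; exact: seg_ml.
by apply: h; exact: seg_mr.
Qed.

Lemma dsum_cauchy n k g a b e : osc n g a b e ->
  rn (dsum (n + k) g a b - dsum n g a b) <= e.
Proof.
elim: n a b => [|n IH] a b h.
  rewrite add0n /= -[X in _ - X](dsum_cst k (g a) a b) -dsumB; apply: dsum_bound => x xs.
  apply: h => //; first exact: seg_l.
  by rewrite expr0 divr1 rn_seg_l.
have [h1 h2] := oscS h; have := IH _ _ h1; have := IH _ _ h2.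
rewrite /= -scalerBr rn_half opprD addrACA.
by have := rnD (dsum (n + k) g a (mid a b) - dsum n g a (mid a b))
  (dsum (n + k) g (mid a b) b - dsum n g (mid a b) b); lra.
Qed.

Lemma midC a b : mid a b = mid b a.
Proof. by rewrite /mid addrC. Qed.

(** Reversal exchanges left and right end points of the subintervals, a change of
    at most one oscillation. *)
Lemma dsum_rev n g a b e : osc n g a b e -> rn (dsum n g a b - dsum n g b a) <= e.
Proof.
elim: n a b => [|n IH] a b h.
  apply: h; [exact: seg_r | exact: seg_l |].
  by rewrite expr0 divr1 rnBC.
have [h1 h2] := oscS h; have := IH _ _ h1; have := IH _ _ h2.
rewrite /= -scalerBr rn_half (midC b a) opprD (addrC (- dsum n g b (mid a b))).
rewrite addrACA.
by have := rnD (dsum n g a (mid a b) - dsum n g (mid a b) a)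
  (dsum n g (mid a b) b - dsum n g b (mid a b)); lra.
Qed.

Definition cts_seg g a b := forall x, seg a b x -> {for x, continuous g}.

Lemma cts_osc g a b : cts_seg g a b -> forall e : R, 0 < e ->
  exists N, forall n, (N <= n)%N -> osc n g a b e.
Proof.
move=> gc e e0; have [d d0 dP] := seg_uniform gc e0.
have [N NP] := div_pow2_small (rn (b - a)) d0.
exists N => n nN x y xs ys xy; apply: dP => //.
exact: le_trans xy (NP _ nN).
Qed.

End NormedModule.

Section Complete.
Context {X : completeNormedModType C}.
Implicit Types (f g : C^o -> X) (a b : C^o) (n : nat).

Definition dint g a b : X := (b - a) *: lim ((fun n => dsum n g a b) @ \oo).

Lemma dsum_cvg g a b : cts_seg g a b -> cvgn (fun n => dsum n g a b).
Proof.
move=> gc; apply: cauchy_rn_cvg => e e0.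
have e20 : 0 < e / 2 by rewrite divr_gt0.
have [N NP] := cts_osc gc e20; exists N => m n mN nN.
rewrite (le_trans (rn_tri (dsum N g a b) _ _))// [e]splitr lerD//.
  by rewrite -(subnKC mN); apply: dsum_cauchy; exact: NP.
by rewrite rnBC -(subnKC nN); apply: dsum_cauchy; exact: NP.
Qed.

Lemma dint_cvg g a b : cts_seg g a b ->
  (fun n => (b - a) *: dsum n g a b) @ \oo --> dint g a b.
Proof. by move=> /dsum_cvg gc; exact: cvg_seqZ. Qed.

Lemma cts_seg_sub g a b x y : seg a b x -> seg a b y ->
  cts_seg g a b -> cts_seg g x y.
Proof. by move=> xs ys gc z zs; apply: gc; exact: seg_sub zs. Qed.

Lemma dint_mid g a b : cts_seg g a b ->
  dint g a b = dint g a (mid a b) + dint g (mid a b) b.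
Proof.
move=> gc; have := dint_cvg gc => /cvg_seqS h.
have h1 := dint_cvg (cts_seg_sub (seg_l _ _) (seg_mid _ _) gc).
have h2 := dint_cvg (cts_seg_sub (seg_mid _ _) (seg_r _ _) gc).
apply: (seq_uniq h); move: (cvg_seqD h1 h2); apply: cvg_trans.
apply: near_eq_cvg; apply: nearW => n /=.
have -> : mid a b - a = (b - a) * 2^-1 by rewrite /mid; field.
have -> : b - mid a b = (b - a) * 2^-1 by rewrite /mid; field.
by rewrite scalerA -scalerDr.
Qed.

Lemma dint_rev g a b : cts_seg g a b -> dint g b a = - dint g a b.
Proof.
move=> gc; have gc' : cts_seg g b a by rewrite /cts_seg segC.
rewrite /dint -scaleNr opprB; congr (_ *: _).
have h : (fun n => dsum n g a b) @ \oo --> lim ((fun n => dsum n g a b) @ \oo).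
  exact: dsum_cvg.
apply: seq_lim; apply: seq_close h _ => e e0.
have [N NP] := cts_osc gc e0; exists N => n nN.
by apply: dsum_rev; exact: NP.
Qed.

Lemma dintB f g a b : cts_seg f a b -> cts_seg g a b ->
  dint (fun w => f w - g w) a b = dint f a b - dint g a b.
Proof.
move=> fc gc; rewrite /dint -scalerBr; congr (_ *: _); apply: seq_lim.
move: (cvg_seqB (dsum_cvg fc) (dsum_cvg gc)); apply: cvg_trans.
by apply: near_eq_cvg; apply: nearW => n /=; rewrite dsumB.
Qed.

Lemma dintZ (c : C) g a b : cts_seg g a b ->
  dint (fun w => c *: g w) a b = c *: dint g a b.
Proof.
move=> gc; rewrite /dint scalerA mulrC -scalerA; congr (_ *: _); apply: seq_lim.
move: (cvg_seqZ (c := c) (dsum_cvg gc)); apply: cvg_trans.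
by apply: near_eq_cvg; apply: nearW => n /=; rewrite dsumZ.
Qed.

Lemma dint_eq f g a b : (forall x, seg a b x -> f x = g x) -> dint f a b = dint g a b.
Proof.
move=> fg; rewrite /dint.
have -> // : (fun n => dsum n f a b) = (fun n => dsum n g a b).
by apply/funext => n; exact: dsum_eq.
Qed.

Lemma dint_bound g a b (M : R) : cts_seg g a b ->
  (forall x, seg a b x -> rn (g x) <= M) -> rn (dint g a b) <= rn (b - a) * M.
Proof.
move=> gc gM; rewrite rnZ ler_wpM2l ?rn_ge0//.
by apply: seq_bound (dsum_cvg gc) _ => n; exact: dsum_bound.
Qed.

Lemma dint_cst (x : X) a b : dint (fun=> x) a b = (b - a) *: x.
Proof.
rewrite /dint; have -> : (fun n => dsum n (fun=> x) a b) = fun=> x.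
  by apply/funext => n; rewrite dsum_cst.
congr (_ *: _); apply: seq_lim; exact: cvg_cst.
Qed.

(** Adding the sums over [a, b] and [b, a] turns the left-point rule into the
    trapezoidal rule, which is exact for linear functions. *)
Lemma dint_linear (x : X) a b :
  dint (fun w => w *: x) a b = ((b * b - a * a) / 2) *: x.
Proof.
have gc u v : cts_seg (fun w : C^o => w *: x) u v.
  by move=> y _; apply: ctsZ; [exact: cvg_id | exact: cts_cst].
have sumE n : dsum n (fun w => w *: x) a b + dsum n (fun w => w *: x) b a = (a + b) *: x.
  elim: n a b => [|n IH] a b /=; first by rewrite scalerDl.
  rewrite -scalerDr (midC b a) (addrC (dsum n _ b _)) addrACA !IH -scalerDl scalerA.
  by congr (_ *: _); rewrite /mid; field.
have h := cvg_seqD (dint_cvg (gc a b)) (cvg_seqZ (c := -1) (dint_cvg (gc b a))).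
rewrite (dint_rev (gc a b)) scaleN1r opprK in h.
have {}h : dint (fun w => w *: x) a b + dint (fun w => w *: x) a b =
    ((b - a) * (a + b)) *: x.
  apply: (seq_uniq h); rewrite (_ : (fun n => _) = fun=> ((b - a) * (a + b)) *: x).
    exact: cvg_cst.
  by apply/funext => n; rewrite scaleN1r -scaleNr opprB -scalerDr sumE scalerA.
by rewrite -(halfD (dint _ a b)) h scalerA; congr (_ *: _); field.
Qed.

End Complete.
End DyadicIntegral.

(** * Goursat's theorem *)

(** The algebra of the subdivision of a triangle into four: the x, y, z are the
    half sides, p, q, r the sides of the middle triangle, each run through in both
    directions. *)
Lemma triangle_cancel (V : zmodType) (x1 x2 y1 y2 z1 z2 p q r : V) :
  (x1 + x2) + (y1 + y2) + (z1 + z2) =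
  (x1 + p + z2) + (x2 + y1 + q) + (r + y2 + z1) + (- q - r - p).
Proof.
rewrite [RHS](AC (3*3*3*3) (1*4*(5*8)*(9*3)*(2*12)*(6*10)*(7*11)))/=.
by rewrite !subrr !addr0.
Qed.

Section Goursat.
Context {R : realType} {X : completeNormedModType R[i]}.
Local Notation C := R[i].
Implicit Types (g : C^o -> X) (a b c : C^o) (U : set C^o).

Definition tint g a b c : X := dint g a b + dint g b c + dint g c a.

Definition cconvex U := forall a b, U a -> U b -> seg a b `<=` U.

Lemma tint_split U g a b c : cconvex U -> (forall z, U z -> {for z, continuous g}) ->
  U a -> U b -> U c ->
  tint g a b c = tint g a (mid a b) (mid c a) + tint g (mid a b) b (mid b c)
    + tint g (mid c a) (mid b c) c + tint g (mid a b) (mid b c) (mid c a).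
Proof.
move=> cvxU gc Ua Ub Uc.
have gs u v : U u -> U v -> cts_seg g u v by move=> ? ? z zs; apply: gc; exact: (cvxU u v).
have Um u v : U u -> U v -> U (mid u v) by move=> ? ?; apply: (cvxU u v) => //; exact: seg_mid.
have ab := Um _ _ Ua Ub; have bc := Um _ _ Ub Uc; have ca := Um _ _ Uc Ua.
rewrite /tint (dint_mid (gs _ _ Ua Ub)) (dint_mid (gs _ _ Ub Uc)) (dint_mid (gs _ _ Uc Ua)).
rewrite (dint_rev (gs _ _ bc ab)) (dint_rev (gs _ _ ca bc)) (dint_rev (gs _ _ ab ca)).
exact: triangle_cancel.
Qed.

Lemma tint_bound g a b c (d M : R) : 0 <= M ->
  cts_seg g a b -> cts_seg g b c -> cts_seg g c a ->
  rn (b - a) <= d -> rn (c - b) <= d -> rn (a - c) <= d ->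
  (forall w, seg a b w \/ seg b c w \/ seg c a w -> rn (g w) <= M) ->
  rn (tint g a b c) <= 3 * d * M.
Proof.
move=> M0 gab gbc gca ab bc ca gM.
have h1 := dint_bound gab (fun w s => gM w (or_introl s)).
have h2 := dint_bound gbc (fun w s => gM w (or_intror (or_introl s))).
have h3 := dint_bound gca (fun w s => gM w (or_intror (or_intror s))).
have h4 := rnD (dint g a b + dint g b c) (dint g c a).
have h5 := rnD (dint g a b) (dint g b c).
have h6 := ler_wpM2r M0 ab; have h7 := ler_wpM2r M0 bc; have h8 := ler_wpM2r M0 ca.
rewrite /tint; nra.
Qed.

(** Affine functions have a quadratic primitive, so their integral over a closed
    triangle vanishes. *)
Lemma tint_affine g (k y : X) a b c :
  cts_seg g a b -> cts_seg g b c -> cts_seg g c a ->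
  tint (fun w => g w - k - w *: y) a b c = tint g a b c.
Proof.
move=> gab gbc gca.
have kc u v : cts_seg (fun=> k) u v by move=> z _; exact: cts_cst.
have yc u v : cts_seg (fun w : C^o => w *: y) u v.
  by move=> z _; apply: ctsZ; [exact: cvg_id | exact: cts_cst].
have E u v : cts_seg g u v -> dint (fun w => g w - k - w *: y) u v =
    dint g u v - ((v - u) *: k + ((v * v - u * u) / 2) *: y).
  move=> gs; rewrite (@dintB _ _ (fun w => g w - k) _ _ _) //.
    by rewrite dintB // dint_cst dint_linear opprD addrA.
  by move=> z zs; apply: ctsB; [exact: gs | exact: cts_cst].
rewrite /tint !E//.
have E2 (x1 x2 x3 u v w : X) : u + v + w = 0 -> x1 - u + (x2 - v) + (x3 - w) = x1 + x2 + x3.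
  move=> s0; rewrite [LHS](AC (2*2*2) ((1*3*5)*(2*4*6)))/=.
  by rewrite -!opprD s0 subr0.
apply: E2; rewrite [LHS](AC (2*2*2) ((1*3*5)*(2*4*6)))/= -!scalerDl.
rewrite [X in X *: k](_ : _ = 0) ?scale0r ?add0r; last by ring.
rewrite [X in X *: y](_ : _ = 0) ?scale0r// /GRing.scale /=; ring.
Qed.

Record tri := Tri { v1 : C^o ; v2 : C^o ; v3 : C^o }.

Definition tri_in U (t : tri) := [/\ U (v1 t), U (v2 t) & U (v3 t)].

Definition tri_size (t : tri) (d : R) :=
  [/\ rn (v2 t - v1 t) <= d, rn (v3 t - v2 t) <= d & rn (v1 t - v3 t) <= d].

Definition tri_int g t := tint g (v1 t) (v2 t) (v3 t).

(** One of the four half-size triangles carries at least a quarter of the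
    integral. The triangle t' is asserted to exist for every t, even outside U, so
    that a choice function can be iterated. *)
Lemma tri_step U g t : cconvex U -> (forall z, U z -> {for z, continuous g}) ->
  exists t', tri_in U t ->
    [/\ tri_in U t', rn (tri_int g t) <= 4 * rn (tri_int g t') &
      forall d, tri_size t d -> tri_size t' (d / 2) /\ rn (v1 t' - v1 t) <= d].
Proof.
move=> cvxU gc; have [|tn] := pselect (tri_in U t); last by exists t.
case: t => a b c [/= Ua Ub Uc].
have Um u v : U u -> U v -> U (mid u v) by move=> ? ?; apply: (cvxU u v) => //; exact: seg_mid.
have ab := Um _ _ Ua Ub; have bc := Um _ _ Ub Uc; have ca := Um _ _ Uc Ua.
have rh (u v w : C^o) (d : R) : rn (u - v) <= d -> w = (u - v) / 2 -> rn w <= d / 2.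
  move=> uv ->; have -> : (u - v) / 2 = 2^-1 *: (u - v) :> C^o by rewrite mulrC.
  by rewrite rn_half; lra.
have rh' (u v : C^o) (d : R) : rn (u - v) <= d -> rn (v - u) <= d by rewrite rnBC.
have rh2 (w : C^o) (d : R) : rn w <= d / 2 -> rn w <= d.
  by have := rn_ge0 w; lra.
have := tint_split cvxU gc Ua Ub Uc.
set t1 := tint g a (mid a b) _; set t2 := tint g (mid a b) b _.
set t3 := tint g (mid c a) _ c; set t4 := tint g (mid a b) _ _ => E.
have h : rn (tint g a b c) <= rn t1 + rn t2 + rn t3 + rn t4.
  by rewrite E; have := rnD (t1 + t2 + t3) t4; have := rnD (t1 + t2) t3; have := rnD t1 t2; lra.
have [h1|h1] := leP (rn (tint g a b c)) (4 * rn t1).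
  exists (Tri a (mid a b) (mid c a)); split=> //= d [/= d1 d2 d3]; split.
    split=> /=.
    - by apply: (rh b a) => //; rewrite /mid; field.
    - by apply: (rh c b) => //; rewrite /mid; field.
    - by apply: (rh a c) => //; rewrite /mid; field.
  by rewrite subrr rn0 (le_trans (rn_ge0 _) d1).
have [h2|h2] := leP (rn (tint g a b c)) (4 * rn t2).
  exists (Tri (mid a b) b (mid b c)); split=> //= d [/= d1 d2 d3]; split.
    split=> /=.
    - by apply: (rh b a) => //; rewrite /mid; field.
    - by apply: (rh c b) => //; rewrite /mid; field.
    - by apply: (rh a c) => //; rewrite /mid; field.
  by apply: rh2; apply: (rh b a) => //; rewrite /mid; field.
have [h3|h3] := leP (rn (tint g a b c)) (4 * rn t3).
  exists (Tri (mid c a) (mid b c) c); split=> //= d [/= d1 d2 d3]; split.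
    split=> /=.
    - by apply: (rh b a) => //; rewrite /mid; field.
    - by apply: (rh c b) => //; rewrite /mid; field.
    - by apply: (rh a c) => //; rewrite /mid; field.
  by apply: rh2; apply: (rh c a); [exact: rh' | rewrite /mid; field].
exists (Tri (mid a b) (mid b c) (mid c a)); split=> //=; first by rewrite -/t4; lra.
move=> d [/= d1 d2 d3]; split.
  split=> /=.
  - by apply: (rh c a); [exact: rh' | rewrite /mid; field].
  - by apply: (rh a b); [exact: rh' | rewrite /mid; field].
  - by apply: (rh b c); [exact: rh' | rewrite /mid; field].
by apply: rh2; apply: (rh b a) => //; rewrite /mid; field.
Qed.

Lemma le0_small (x : R) (K : R) : (forall e : R, 0 < e -> x <= e * K) -> x <= 0.
Proof.
move=> h; apply/ler_addgt0Pr => e e0; rewrite add0r.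
have K1 : 0 < `|K| + 1 by rewrite ltr_wpDl.
apply: le_trans (h _ (divr_gt0 e0 K1)) _.
rewrite -mulrA ler_piMr ?(ltW e0)// mulrC ler_pdivrMr// mul1r.
by rewrite (le_trans (ler_norm _))// lerDl.
Qed.

(** Repeated bisection produces triangles of size d / 2^n shrinking to a point p
    of U, whose integrals decrease at most like 4^-n. Near p the function is affine
    up to e |w - p|, and affine functions integrate to zero, so the integral over
    the n-th triangle is O(e 4^-n) for every e > 0. *)
Lemma goursat U g : closed U -> cconvex U -> (forall z, U z -> cdiff g z) ->
  forall a b c, U a -> U b -> U c -> tint g a b c = 0.
Proof.
move=> clU cvxU gd a b c Ua Ub Uc.
have gc z : U z -> {for z, continuous g} by move=> /gd; exact: cdiff_cts.
have [f fP] := choice (fun t => tri_step t cvxU gc).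
pose u n := iter n f (Tri a b c).
pose d := rn (b - a) + rn (c - b) + rn (a - c).
have d0 : 0 <= d by rewrite !addr_ge0 ?rn_ge0.
have uU n : tri_in U (u n).
  by elim: n => [|n /fP[]//]; split.
have p0 n : 0 < 2 ^+ n :> R by rewrite exprn_gt0.
have us n : tri_size (u n) (d / 2 ^+ n).
  elim: n => [|n IH].
    rewrite expr0 divr1; have := rn_ge0 (b - a); have := rn_ge0 (c - b).
    by have := rn_ge0 (a - c); rewrite /d; split => /=; lra.
  have [_ _ /(_ _ IH)[h _]] := fP _ (uU n).
  by rewrite exprSr invfM mulrA.
have ui n : rn (tri_int g (Tri a b c)) <= 4 ^+ n * rn (tri_int g (u n)).
  elim: n => [|n IH]; first by rewrite expr0 mul1r.
  have [_ h _] := fP _ (uU n); apply: (le_trans IH).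
  by rewrite exprSr -mulrA ler_wpM2l ?exprn_ge0.
have dv n : rn (v1 (u n.+1) - v1 (u n)) <= d / 2 ^+ n.
  by have [_ _ /(_ _ (us n))[]] := fP _ (uU n).
have [p [up pu]] := @cvg_geometric R (cplane R) _ _ d0 dv.
have Up : U p.
  apply: (@closed_cvg _ _ \oo _ (fun n => v1 (u n)) U clU _ p up).
  by apply: nearW => n; have [] := uU n.
have [y yP] := gd p Up.
(* 12 d^2 arises as 3 sides of length d / 2^n, times the distance 4 d / 2^n to p,
   times 4^n. *)
suff : rn (tri_int g (Tri a b c)) <= 0.
  move=> h; apply: rn0_eq0; apply/eqP; rewrite eq_le rn_ge0 andbT; exact: h.
apply: (@le0_small _ (12 * d * d)) => e e0.
have [r r0 rP] := yP _ e0.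
have [n /(_ n (leqnn n)) nP] := div_pow2_small (4 * d) r0.
have [U1 U2 U3] := uU n; have [s1 s2 s3] := us n.
move: (ui n) (pu n) U1 U2 U3 s1 s2 s3; rewrite /tri_int.
set A := v1 (u n); set B := v2 (u n); set D := v3 (u n).
set dn := d / 2 ^+ n => uin pun U1 U2 U3 s1 s2 s3.
have gs x z : U x -> U z -> cts_seg g x z by move=> ? ? w ws; apply: gc; exact: (cvxU x z).
have dn4 : 4 * dn <= r by rewrite /dn mulrA.
have dn0 : 0 <= dn by rewrite divr_ge0// ltW.
have pun' : rn (A - p) <= 2 * dn by rewrite rnBC /dn mulrA.
have near_p w : seg A B w \/ seg B D w \/ seg D A w -> rn (w - p) <= 4 * dn.
  have hA := rn_tri A w p.
  case=> [/rn_seg_l|[/rn_seg_l|]]; first by lra.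
    by have := rn_tri B w A; lra.
  by rewrite segC => /rn_seg_l; rewrite (rnBC D A); lra.
have rho w : seg A B w \/ seg B D w \/ seg D A w ->
    rn (g w - (g p - p *: y) - w *: y) <= e * (4 * dn).
  move=> /near_p wp; have := rP w (le_trans wp dn4).
  have -> : g w - g p - (w - p) *: y = g w - (g p - p *: y) - w *: y.
    by rewrite scalerBl !opprB !addrA; congr (_ - _); rewrite addrAC.
  by move=> /le_trans; apply; rewrite ler_wpM2l// ltW.
have := tint_affine (g p - p *: y) y (gs _ _ U1 U2) (gs _ _ U2 U3) (gs _ _ U3 U1).
have cs x z : U x -> U z -> cts_seg (fun w => g w - (g p - p *: y) - w *: y) x z.
  move=> Ux Uz w ws; apply: ctsB.
    by apply: ctsB; [exact: gs ws | exact: cts_cst].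
  by apply: ctsZ; [exact: cvg_id | exact: cts_cst].
move=> E; move: uin; rewrite -E => /le_trans; apply.
have : 0 <= e * (4 * dn) by rewrite !mulr_ge0// ltW.
move=> /tint_bound /(_ (cs _ _ U1 U2) (cs _ _ U2 U3) (cs _ _ U3 U1) s1 s2 s3 rho) h.
apply: (le_trans (ler_wpM2l (exprn_ge0 n (ler0n _ 4)) h)).
have -> : 4 = 2 * 2 :> R by lra.
rewrite le_eqVlt /dn exprMn; apply/orP; left; apply/eqP; field.
by rewrite lt0r_neq0.
Qed.

End Goursat.

(** * Triangles with an exceptional vertex *)

Section Contour.
Context {R : realType}.
Local Notation C := R[i].
Implicit Types (a b c z w u p : C^o) (U : set C^o).

Lemma closed_rn (V : normedModType C) (U : set V) :
  (forall p : V, (forall e : R, 0 < e -> exists2 w, U w & rn (w - p) <= e) -> U p) ->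
  closed U.
Proof.
move=> UP p clp; apply: UP => e e0.
have /clp[w [Uw wp]] : nbhs p [set w | rn (w - p) <= e] by apply/nbhs_rnP; exists e.
by exists w.
Qed.

Lemma closed_half U u p (d : R) : closed U ->
  closed (U `&` [set w | d <= complex.Re (u * (w - p))]).
Proof.
move=> clU; apply: closedI => //; apply: closed_rn => q qP.
rewrite /=; apply/ler_addgt0Pr => e e0.
have u1 : 0 < rn u + 1 by rewrite ltr_wpDl ?rn_ge0.
have [w /= dw wq] := qP _ (divr_gt0 e0 u1).
have h : `|complex.Re (u * (w - q))| <= e.
  rewrite (le_trans (rn_Re _))// rnM (le_trans (ler_wpM2l (rn_ge0 _) wq))//.
  by rewrite mulrCA ler_piMr ?(ltW e0)// ler_pdivrMr// mul1r lerDl.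
have E : complex.Re (u * (w - p)) = complex.Re (u * (q - p)) + complex.Re (u * (w - q)).
  have -> : u * (w - p) = u * (q - p) + u * (w - q) :> C^o by ring.
  by case: (u * (q - p)) => ? ?; case: (u * (w - q)).
by have := ler_norm (complex.Re (u * (w - q))); lra.
Qed.

Lemma convex_half U u p (d : R) : cconvex U ->
  cconvex (U `&` [set w | d <= complex.Re (u * (w - p))]).
Proof.
move=> cU a b [Ua /= da] [Ub /= db] w ws; split; first exact: (cU a b).
case: ws => t /andP[t0 t1] ->; rewrite /=.
have -> : u * (a + t%:C * (b - a) - p) =
    (1 - t)%:C * (u * (a - p)) + t%:C * (u * (b - p)) by rewrite rmorphB /=; ring.
by rewrite ReD !ReZ; nra.
Qed.

Lemma closed_disc (r : R) : closed [set w : C^o | rn w <= r].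
Proof.
apply: closed_rn => p pP; rewrite /=; apply/ler_addgt0Pr => e /pP[w /= wr wp].
by have := rnB w (w - p); rewrite subKr; lra.
Qed.

Lemma convex_disc (r : R) : cconvex [set w : C^o | rn w <= r].
Proof.
move=> a b /= ar br w [t /andP[t0 t1] ->].
have -> : a + t%:C * (b - a) = (1 - t)%:C * a + t%:C * b :> C^o by rewrite rmorphB /=; ring.
rewrite /= (le_trans (rnD _ _))// !rnM !rnR !ger0_norm ?subr_ge0//; nra.
Qed.

Lemma convexT : cconvex (setT : set C^o). Proof. by []. Qed.

Section Vertex.
Context {X : completeNormedModType C}.
Implicit Type g : C^o -> X.

(** Cutting the triangle at p in four leaves one piece with vertex p. The other
    three lie in a half plane that avoids p, given by the real part of u (w - p),
    where Goursat's theorem applies. *)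
Lemma vertex_halve U g p u b c (d : R) : closed U -> cconvex U -> 0 < d ->
  (forall z, U z -> {for z, continuous g}) ->
  (forall z, U z -> z != p -> cdiff g z) ->
  U p -> U b -> U c -> d <= complex.Re (u * (b - p)) -> d <= complex.Re (u * (c - p)) ->
  tint g p b c = tint g p (mid p b) (mid c p).
Proof.
move=> clU cvxU d0 gc gd Up Ub Uc pb pc.
have mR x y : complex.Re (u * (mid x y - p)) =
    complex.Re (u * (x - p)) / 2 + complex.Re (u * (y - p)) / 2.
  have -> : u * (mid x y - p) = (2^-1 : R)%:C * (u * (x - p)) + (2^-1 : R)%:C * (u * (y - p)).
    by rewrite -complex_half /mid; field.
  by rewrite ReD !ReZ ![2^-1 * _]mulrC.
have p0 : complex.Re (u * (p - p)) = 0 by rewrite subrr mulr0.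
pose W := U `&` [set w | d / 2 <= complex.Re (u * (w - p))].
have Wd z : W z -> cdiff g z.
  move=> [Uz /= zd]; apply: gd => //; apply/eqP => zp; move: zd; rewrite zp p0; lra.
have Um x y : U x -> U y -> U (mid x y) by move=> ? ?; apply: (cvxU x y) => //; exact: seg_mid.
have cau := goursat (closed_half (u := u) (p := p) (d := d / 2) clU)
  (convex_half (u := u) (p := p) (d := d / 2) cvxU) Wd.
have Wb : W b by split=> //=; lra.
have Wc : W c by split=> //=; lra.
have Wpb : W (mid p b) by split; [exact: Um | rewrite /= mR p0; lra].
have Wcp : W (mid c p) by split; [exact: Um | rewrite /= mR p0; lra].
have Wbc : W (mid b c) by split; [exact: Um | rewrite /= mR; lra].
rewrite (tint_split cvxU gc Up Ub Uc) (cau (mid p b) b)// (cau (mid c p) _ c)//.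
rewrite (cau (mid p b) _ (mid c p))//.
by rewrite !addr0.
Qed.

(** The triangle at p can be halved indefinitely without changing the integral,
    whereas its perimeter tends to zero and g is bounded near p. *)
Lemma vertex_goursat U g p u b c (d : R) : closed U -> cconvex U -> 0 < d ->
  (forall z, U z -> {for z, continuous g}) ->
  (forall z, U z -> z != p -> cdiff g z) ->
  U p -> U b -> U c -> d <= complex.Re (u * (b - p)) -> d <= complex.Re (u * (c - p)) ->
  tint g p b c = 0.
Proof.
move=> clU cvxU d0 gc gd Up Ub Uc pb pc.
have Um x y : U x -> U y -> U (mid x y) by move=> ? ?; apply: (cvxU x y) => //; exact: seg_mid.
pose B n := p + (b - p) / 2 ^+ n : C^o.
pose D n := p + (c - p) / 2 ^+ n : C^o.
have n20 n : 2 ^+ n != 0 :> C by rewrite expf_neq0// pnatr_eq0.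
have BS n : B n.+1 = mid p (B n) by rewrite /B /mid exprS; field.
have DS n : D n.+1 = mid (D n) p by rewrite /D /mid exprS; field.
have UB n : U (B n).
  elim: n => [|n IH]; first by rewrite /B expr0 divr1 addrC subrK.
  by rewrite BS; exact: Um.
have UD n : U (D n).
  elim: n => [|n IH]; first by rewrite /D expr0 divr1 addrC subrK.
  by rewrite DS; exact: Um.
have p2 n : 0 < 2 ^+ n :> R by rewrite exprn_gt0.
have n2C n : (2 ^+ n)^-1 = ((2 ^+ n)^-1 : R)%:C :> C by rewrite fmorphV rmorphXn rmorphMn.
have dn n x : d <= complex.Re (u * (x - p)) ->
    d / 2 ^+ n <= complex.Re (u * (p + (x - p) / 2 ^+ n - p)).
  move=> h; rewrite (addrC p) addrK n2C mulrA [_ * _%:C]mulrC ReZ [leRHS]mulrC.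
  by rewrite ler_wpM2r// invr_ge0 ltW.
have TE n : tint g p b c = tint g p (B n) (D n).
  elim: n => [|n ->]; first by rewrite /B /D expr0 !divr1 !(addrC p) !subrK.
  rewrite BS DS; apply: (@vertex_halve U g p u _ _ (d / 2 ^+ n)) => //; try exact: dn.
  by rewrite divr_gt0.
have Bp n x : rn (p + (x - p) / 2 ^+ n - p : C^o) = rn (x - p) / 2 ^+ n.
  by rewrite (addrC p) addrK rnM n2C rnR ger0_norm// invr_ge0 ltW.
suff : rn (tint g p b c) <= 0.
  by move=> h; apply: rn0_eq0; apply/eqP; rewrite eq_le rn_ge0 andbT.
pose s := rn (b - p) + rn (c - p).
have s0 : 0 <= s by rewrite addr_ge0 ?rn_ge0.
have M0 : 0 <= rn (g p) + 1 by rewrite addr_ge0 ?rn_ge0.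
apply: (@le0_small _ _ (3 * (rn (g p) + 1))) => e e0.
have [r r0 rP] := (continuous_rnP g p).1 (gc _ Up) _ ltr01.
have re0 : 0 < Num.min r e by rewrite lt_min r0.
have [n /(_ n (leqnn n))] := div_pow2_small s re0; rewrite le_min => /andP[nr ne].
have sE : s / 2 ^+ n = rn (B n - p) + rn (D n - p) by rewrite /s mulrDl /B /D !Bp.
have hB := rn_ge0 (B n - p); have hD := rn_ge0 (D n - p).
have BDp : rn (D n - B n) <= s / 2 ^+ n.
  by rewrite sE (le_trans (rn_tri p _ _))// (rnBC p) addrC.
have gs x y : U x -> U y -> cts_seg g x y by move=> ? ? w ws; apply: gc; exact: (cvxU x y).
rewrite (TE n); apply: (@le_trans _ _ (3 * (s / 2 ^+ n) * (rn (g p) + 1))); last first.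
  by rewrite mulrCA mulrA -mulrA [e * _]mulrC; nra.
have e1 : rn (B n - p) <= s / 2 ^+ n by rewrite sE; lra.
have e3 : rn (p - D n) <= s / 2 ^+ n by rewrite rnBC sE; lra.
apply: (tint_bound M0 (gs _ _ Up (UB n)) (gs _ _ (UB n) (UD n)) (gs _ _ (UD n) Up)
  e1 BDp e3).
move=> w ws; have : rn (w - p) <= r.
  apply: le_trans nr; rewrite sE.
  case: ws => [/rn_seg_l|[|]]; first by lra.
    move=> [t /andP[t0 t1] ->].
    have -> : B n + t%:C * (D n - B n) - p = (1 - t)%:C * (B n - p) + t%:C * (D n - p) :> C^o.
      by rewrite rmorphB /=; ring.
    rewrite (le_trans (rnD _ _))// !rnM !rnR !ger0_norm ?subr_ge0//; nra.
  by rewrite segC => /rn_seg_l; lra.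
move=> /rP h; have := rnD (g w - g p) (g p); rewrite subrK; lra.
Qed.

End Vertex.
End Contour.

(** * The diamond contour and the Cauchy transform *)

Section Diamond.
Context {R : realType}.
Local Notation C := R[i].
Implicit Types (a b c z w u p : C^o).

(** The contour is the square with vertices 1, i, -1, -i. *)
Definition vtx (k : nat) : C^o := ('i : C) ^+ k.

Lemma rn_vtx k : rn (vtx k) = 1.
Proof.
have i1 : rn ('i : C^o) = 1 by rewrite /rn normc_def /= expr0n add0r expr1n sqrtr1.
by elim: k => [|k IH]; rewrite /vtx ?expr0 ?rn1// exprS rnM i1 IH mulr1.
Qed.

Lemma vtx_neq0 k : vtx k != 0.
Proof. by rewrite -rn_gt0 rn_vtx. Qed.

Lemma vtxS k : vtx k.+1 = 'i * vtx k. Proof. exact: exprS. Qed.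

Lemma vtx4 : vtx 4 = vtx 0.
Proof. by rewrite /vtx expr0 (exprM _ 2 2) sqr_i sqrrN expr1n. Qed.

Definition edge k := seg (vtx k) (vtx k.+1).

Definition diamond := [set w : C^o | exists2 k, (k < 4)%N & edge k w].

(** The edge k lies on the line where the real part of [side k * w] equals 1; this
    functional separates the edge from the centre of the square. *)
Definition side k : C^o := (1 - 'i) / vtx k.

Lemma side_edge k w : edge k w -> complex.Re (side k * w) = 1.
Proof.
move=> [t _ ->]; have v0 := vtx_neq0 k.
have -> : side k * (vtx k + t%:C * (vtx k.+1 - vtx k)) = (1 - 'i) * (1 + t%:C * ('i - 1)).
  by rewrite /side vtxS; field.
by simpc => /=; rewrite /=; ring.
Qed.

Lemma rn_side k : rn (side k) <= 2.
Proof.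
rewrite /side rnM rnV rn_vtx invr1 mulr1 (le_trans (rnB _ _))// rn1.
by rewrite [rn _](_ : _ = 1)// -(rn_vtx 1) /vtx expr1.
Qed.

Lemma side_bound k w : complex.Re (side k * w) <= 2 * rn w.
Proof.
rewrite (le_trans (ler_norm _))// (le_trans (rn_Re _))// rnM.
by rewrite ler_wpM2r ?rn_ge0 ?rn_side.
Qed.

Lemma edge_lower k w : edge k w -> 1 / 2 <= rn w.
Proof. by move=> /side_edge; have := side_bound k w; lra. Qed.

Lemma edge_upper k w : edge k w -> rn w <= 1.
Proof. by move=> kw; apply: (@convex_disc R 1) kw; rewrite /= rn_vtx. Qed.

Lemma edge_sub k w z : edge k w -> rn z <= 1 / 4 -> 1 / 4 <= rn (w - z).
Proof. by move=> /edge_lower; have := rnD (w - z) z; rewrite subrK; lra. Qed.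

Lemma edge_sub0 k w z : edge k w -> rn z <= 1 / 4 -> w - z != 0.
Proof. by move=> kw /(edge_sub kw); rewrite -rn_gt0; lra. Qed.

Lemma edge_neq0 k w : edge k w -> w != 0.
Proof. by move=> /edge_lower; rewrite -rn_gt0; lra. Qed.

Lemma edge_inv k w z : edge k w -> rn z <= 1 / 4 -> rn ((w - z)^-1 : C^o) <= 4.
Proof.
move=> kw z4; have h := edge_sub kw z4; rewrite rnV -(invrK 4) lef_pV2.
- by lra.
- by rewrite posrE; lra.
- by rewrite posrE invr_gt0.
Qed.

Lemma edge_len k : rn (vtx k.+1 - vtx k) <= 2.
Proof. by rewrite (le_trans (rnB _ _))// !rn_vtx. Qed.

Section Integral.
Context {X : completeNormedModType C}.
Implicit Types f g : C^o -> X.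

Definition oint g : X := \sum_(k < 4) dint g (vtx k) (vtx k.+1).

Definition cts_diamond g := forall w, diamond w -> {for w, continuous g}.

Lemma cts_edge g k : (k < 4)%N -> cts_diamond g -> cts_seg g (vtx k) (vtx k.+1).
Proof. by move=> k4 gc w ws; apply: gc; exists k. Qed.

Lemma oint_eq f g : (forall w, diamond w -> f w = g w) -> oint f = oint g.
Proof.
by move=> fg; apply: eq_bigr => k _; apply: dint_eq => w ws; apply: fg; exists k.
Qed.

Lemma ointB f g : cts_diamond f -> cts_diamond g ->
  oint (fun w => f w - g w) = oint f - oint g.
Proof.
move=> fc gc; rewrite /oint -sumrB; apply: eq_bigr => k _.
by rewrite dintB//; apply: cts_edge.
Qed.

Lemma ointZ (x : C) g : cts_diamond g -> oint (fun w => x *: g w) = x *: oint g.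
Proof.
move=> gc; rewrite /oint scaler_sumr; apply: eq_bigr => k _.
by rewrite dintZ//; apply: cts_edge.
Qed.

Lemma oint_bound g (M : R) : cts_diamond g ->
  (forall w, diamond w -> rn (g w) <= M) -> rn (oint g) <= 8 * M.
Proof.
move=> gc gM; have M0 : 0 <= M.
  by apply: le_trans (rn_ge0 _) (gM (vtx 0) _); exists 0%N => //; exact: seg_l.
have h k : (k < 4)%N -> rn (dint g (vtx k) (vtx k.+1)) <= 2 * M.
  move=> k4; apply: le_trans (dint_bound (cts_edge k4 gc) _) _.
    by move=> w ws; apply: gM; exists k.
  by rewrite ler_wpM2r// edge_len.
have h0 := h 0%N isT; have h1 := h 1%N isT; have h2 := h 2%N isT; have h3 := h 3%N isT.
rewrite /oint !big_ord_recl big_ord0 addr0 /=.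
set A := dint _ _ _ in h0 *; set B := dint _ _ _ in h1 *.
set D := dint _ _ _ in h2 *; set E := dint _ _ _ in h3 *.
have := rnD A (B + (D + E)); have := rnD B (D + E); have := rnD D E.
by lra.
Qed.

Lemma diamond_bounded g : cts_diamond g ->
  exists M : R, forall w, diamond w -> rn (g w) <= M.
Proof.
move=> gc; have gM k : (k < 4)%N -> exists M : R, forall w, edge k w -> rn (g w) <= M.
  by move=> k4; apply: seg_bounded => w kw; apply: gc; exists k.
have [M0 h0] := gM 0%N isT; have [M1 h1] := gM 1%N isT.
have [M2 h2] := gM 2%N isT; have [M3 h3] := gM 3%N isT.
exists (Num.max (Num.max M0 M1) (Num.max M2 M3)) => w [[|[|[|[|//]]]] k4 kw];
  by rewrite !le_max ?(h0 _ kw) ?(h1 _ kw) ?(h2 _ kw) ?(h3 _ kw) ?orbT.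
Qed.

Definition cauchy_kernel g z : C^o -> X := fun w => (w - z)^-1 *: g w.

Definition cauchy_transform g z : X := oint (cauchy_kernel g z).

Lemma cts_kernel g z : cts_diamond g -> rn z <= 1 / 4 -> cts_diamond (cauchy_kernel g z).
Proof.
move=> gc z4 w [k k4 kw]; apply: ctsZ; last by apply: gc; exists k.
by apply: ctsV; [exact: edge_sub0 kw z4 | exact: cts_sub].
Qed.

Lemma cauchy_transform_bound g z (M : R) : cts_diamond g -> rn z <= 1 / 4 ->
  (forall w, diamond w -> rn (g w) <= M) -> rn (cauchy_transform g z) <= 32 * M.
Proof.
move=> gc z4 gM; have -> : 32 * M = 8 * (4 * M) by ring.
apply: oint_bound; first exact: cts_kernel.
move=> w wD; have [k k4 kw] := wD; rewrite rnZ.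
apply: ler_pM; rewrite ?rn_ge0//; first exact: edge_inv kw z4.
exact: gM.
Qed.

Lemma rn_quarter0 : rn (0 : C^o) <= 1 / 4.
Proof. by rewrite rn0; lra. Qed.

(** The resolvent identity (w - z)^-1 - w^-1 = z (w - z)^-1 w^-1. It exhibits the
    slope of a Cauchy transform at 0 as another Cauchy transform, whence
    differentiability and Taylor expansions at 0. *)
Lemma cauchy_transform_slope g z : cts_diamond g -> rn z <= 1 / 4 ->
  cauchy_transform g z = cauchy_transform g 0 + z *: cauchy_transform (cauchy_kernel g 0) z.
Proof.
move=> gc z4; have k0c := cts_kernel gc rn_quarter0.
rewrite /cauchy_transform -ointZ; last exact: cts_kernel.
rewrite -[LHS](subrK (oint (cauchy_kernel g 0))) addrC; congr (_ + _).
rewrite -ointB//; last exact: cts_kernel.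
apply: oint_eq => w [k k4 kw]; rewrite /cauchy_kernel subr0 -scalerBl !scalerA.
congr (_ *: _); field.
by rewrite (edge_sub0 kw z4) (edge_neq0 kw).
Qed.

Lemma cauchy_transform_cts0 g : cts_diamond g -> {for 0, continuous (cauchy_transform g)}.
Proof.
move=> gc; apply/continuous_rnP => e e0.
have k0c := cts_kernel gc rn_quarter0.
have [M MP] := diamond_bounded k0c.
have M0 : 0 <= M.
  by apply: le_trans (rn_ge0 _) (MP (vtx 0) _); exists 0%N => //; exact: seg_l.
have M1 : 0 < 32 * M + 1 by lra.
exists (Num.min (1 / 4) (e / (32 * M + 1))) => [|z].
  by rewrite lt_min (divr_gt0 e0 M1) andbT; lra.
rewrite subr0 le_min => /andP[z4]; rewrite ler_pdivlMr// => ze.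
rewrite (cauchy_transform_slope gc z4) addrC addKr rnZ.
have := ler_wpM2l (rn_ge0 z) (cauchy_transform_bound k0c z4 MP); have := rn_ge0 z; nra.
Qed.

Lemma cauchy_transform_cder0 g : cts_diamond g ->
  cder (cauchy_transform g) 0 (cauchy_transform (cauchy_kernel g 0) 0).
Proof.
move=> gc; have k0c := cts_kernel gc rn_quarter0.
(* The slope at 0, given by the Cauchy transform near 0, where the latter is known
   to be continuous, and by its defining quotient elsewhere. *)
pose q z := if rn z <= 1 / 4 then cauchy_transform (cauchy_kernel g 0) z
  else z^-1 *: (cauchy_transform g z - cauchy_transform g 0).
have -> : cauchy_transform (cauchy_kernel g 0) 0 = q 0 by rewrite /q rn_quarter0.
apply: cder_caratheodory => [|z].
  apply/continuous_rnP => e e0.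
  have [d d0 dP] := (continuous_rnP _ _).1 (cauchy_transform_cts0 k0c) _ e0.
  exists (Num.min d (1 / 4)) => [|z]; first by rewrite lt_min d0; lra.
  rewrite le_min subr0 => /andP[zd z4]; rewrite /q z4 rn_quarter0.
  by apply: dP; rewrite subr0.
rewrite subr0 /q; case: ifP => [z4|z4]; first exact: cauchy_transform_slope.
have z0 : z != 0 by apply/eqP => z0; move: z4; rewrite z0 rn_quarter0.
by rewrite scalerA divff// scale1r addrC subrK.
Qed.

End Integral.

Lemma telescope4 (V : zmodType) (F : nat -> V) : F 4 = F 0%N ->
  \sum_(k < 4) (F k.+1 - F k) = 0.
Proof.
move=> F4; rewrite -(big_mkord xpredT (fun k => F k.+1 - F k)).
by rewrite telescope_sumr// F4 subrr.
Qed.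

(** The integral of dw / w over the contour, in the role of 2 pi i. *)
Definition winding : C := oint (fun w => (w - 0)^-1 : cplane R).

Lemma dsum_translate (X : lmodType C) n (g : C^o -> X) z a b :
  dsum n (fun w => g (w - z)) a b = dsum n g (a - z) (b - z).
Proof.
elim: n a b => //= n IH a b; rewrite !IH.
by have -> : mid a b - z = mid (a - z) (b - z) by rewrite /mid; field.
Qed.

Lemma dint_translate (X : completeNormedModType C) (g : C^o -> X) z a b :
  dint (fun w => g (w - z)) a b = dint g (a - z) (b - z).
Proof.
rewrite /dint opprB addrA subrK.
have -> // : (fun n => dsum n (fun w => g (w - z)) a b) =
  (fun n => dsum n g (a - z) (b - z)).
by apply/funext => n; rewrite dsum_translate.
Qed.

Lemma cdiff_inv0 w : w != 0 -> @cdiff R (cplane R) (fun w => (w - 0)^-1) w.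
Proof. exact: cdiff_inv. Qed.

(** Moving the centre from 0 to z amounts to translating the contour by -z. Each
    edge and its translate bound a parallelogram in a half plane that avoids 0, and
    the contributions of the connecting segments telescope around the contour. *)
Lemma winding_const z : rn z <= 1 / 4 ->
  oint (fun w => (w - z)^-1 : cplane R) = winding.
Proof.
move=> z4; pose F : C^o -> cplane R := fun w => (w - 0)^-1.
apply/eqP; rewrite -subr_eq0 /winding /oint -sumrB; apply/eqP.
rewrite -[RHS](@telescope4 _ (fun k => dint F (vtx k) (vtx k - z))); last by rewrite vtx4.
apply: eq_bigr => -[k /= k4] _.
have -> : dint (fun w => (w - z)^-1 : cplane R) (vtx k) (vtx k.+1) =
    dint F (vtx k - z) (vtx k.+1 - z).
  rewrite -dint_translate; apply: dint_eq => w _.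
  by rewrite /F subr0.
pose W := setT `&` [set w : C^o | 1 / 4 <= complex.Re (side k * (w - 0))].
have Wd w : W w -> cdiff F w.
  move=> [_ /= h]; apply: cdiff_inv0; apply/eqP => w0.
  by move: h; rewrite w0 subrr mulr0 /=; lra.
have cW : closed W by apply: closed_half; exact: closedT.
have vW : cconvex W by apply: convex_half; exact: convexT.
have Wv w : edge k w -> W w.
  by move=> /side_edge h; split => //=; rewrite subr0 h; lra.
have Wvz w : edge k w -> W (w - z).
  move=> /side_edge h; split => //=; rewrite subr0 mulrBr.
  have hz : `|complex.Re (side k * z)| <= 1 / 2.
    rewrite (le_trans (rn_Re _))// rnM.
    by have := ler_wpM2r (rn_ge0 z) (rn_side k); lra.
  have -> : complex.Re (side k * w - side k * z) =
      complex.Re (side k * w) - complex.Re (side k * z).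
    by case: (side k * w) (side k * z) => ? ? [].
  by have := ler_norm (complex.Re (side k * z)); lra.
have Wa := Wv _ (seg_l _ _); have Wb := Wv _ (seg_r _ _).
have Waz := Wvz _ (seg_l _ _); have Wbz := Wvz _ (seg_r _ _).
have gs x y : W x -> W y -> cts_seg F x y.
  by move=> ? ? w ws; apply: cdiff_cts; apply: Wd; exact: (vW x y).
have h1 := goursat cW vW Wd Waz Wa Wb; have h2 := goursat cW vW Wd Waz Wb Wbz.
move: h1 h2; rewrite /tint (dint_rev (gs _ _ Waz Wbz)) (dint_rev (gs _ _ Waz Wb)).
rewrite (dint_rev (gs _ _ Wa Waz)).
move=> /eqP; rewrite subr_eq0 => /eqP <- /eqP; rewrite subr_eq0 => /eqP <-.
by rewrite -/F addrAC addrK addrC.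
Qed.

(** With w = (1 - t) v + t i v on the edge from v to i v, the quotient (i v - v) / w
    equals (i - 1) / (1 - t + t i), of imaginary part 1 / ((1 - t)^2 + t^2). *)
Lemma edge_Im k w : edge k w -> 1 <= complex.Im ((vtx k.+1 - vtx k) / w).
Proof.
move=> kw; have w0 := edge_neq0 kw; move: kw => [t /andP[t0 t1] wE].
set y := _ / w; have v0 := vtx_neq0 k.
have yE : y * ((1 - t) +i* t) = -1 +i* 1.
  have -> : (1 - t) +i* t = w / vtx k :> C.
    have -> : (1 - t) +i* t = 1 - t%:C + 'i * t%:C :> C.
      by apply/eqP; rewrite eq_complex /=; apply/andP; split; apply/eqP; ring.
    by rewrite wE vtxS; field; exact: v0.
  rewrite /y vtxS (_ : -1 +i* 1 = 'i - 1); last by simpc.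
  by field; rewrite v0 w0.
move: yE; case: (y) => p q /=; simpc => -[h1 h2].
have h : q * ((1 - t) ^+ 2 + t ^+ 2) = 1.
  have -> : q * ((1 - t) ^+ 2 + t ^+ 2) =
      (1 - t) * (p * t + q * (1 - t)) - t * (p * (1 - t) - q * t) by ring.
  by rewrite h1 h2; ring.
rewrite leNgt; apply/negP => q1; move: h; set s := _ + _ => h.
have s0 : 0 <= s by rewrite addr_ge0 ?sqr_ge0.
have s1 : s <= 1 by rewrite /s; nra.
have : s = 1 by have := mulr_ge0 s0 (ltW (etrans (subr_gt0 _ _) q1)); lra.
by move=> s1'; move: h; rewrite s1'; lra.
Qed.

(** Along each edge the argument increases, so that the four contributions to the
    imaginary part cannot cancel. *)
Lemma winding_neq0 : winding != 0.
Proof.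
have key k : (k < 4)%N ->
    1 <= complex.Im (dint (fun w => (w - 0)^-1 : cplane R) (vtx k) (vtx k.+1)).
  move=> k4; set F : C^o -> cplane R := fun w => (w - 0)^-1.
  have Fc : cts_seg F (vtx k) (vtx k.+1).
    by move=> w kw; apply: cdiff_cts; apply: cdiff_inv0; exact: edge_neq0 kw.
  have Ims n a b : (forall w, seg a b w -> 1 <= complex.Im ((vtx k.+1 - vtx k) *: F w)) ->
      1 <= complex.Im ((vtx k.+1 - vtx k) *: dsum n F a b).
    elim: n a b => [|n IH] a b h; first by apply: h; exact: seg_l.
    have h1 := IH _ _ (fun x xs => h x (seg_ml xs)).
    have h2 := IH _ _ (fun x xs => h x (seg_mr xs)).
    rewrite [dsum n.+1 _ _ _]/= scalerA mulrC -scalerA scalerDr.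
    set x := _ *: _ in h1 *; set y := _ *: _ in h2 *.
    have -> : complex.Im (2^-1 *: (x + y)) = (complex.Im x + complex.Im y) / 2.
      rewrite complex_half /GRing.scale /= -ImD [RHS]mulrC.
      by case: (x + y) => u v /=; rewrite mul0r addr0.
    lra.
  apply/ler_addgt0Pr => e e0.
  have /(@cvg_seqP _ (cplane R)) /(_ _ e0)[N /(_ N (leqnn N)) h] := dint_cvg Fc.
  have h' : 1 <= complex.Im ((vtx k.+1 - vtx k) *: dsum N F (vtx k) (vtx k.+1)).
    by apply: Ims => w kw; rewrite /F subr0; exact: edge_Im.
  move: h h'; set D := dint _ _ _; set S := _ *: _ => h h'.
  have := rn_Im (S - D); have := ler_norm (complex.Im (S - D)).
  have -> : complex.Im (S - D) = complex.Im S - complex.Im D by case: (S) (D) => ? ? [].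
  by move: h; rewrite /=; lra.
have h0 := key 0%N isT; have h1 := key 1%N isT; have h2 := key 2%N isT; have h3 := key 3%N isT.
apply/eqP => c00; have : complex.Im winding = 0 by rewrite c00.
rewrite /winding /oint !big_ord_recl big_ord0 addr0 /= !ImD.
by move: h0 h1 h2 h3; rewrite /bump /=; lra.
Qed.

End Diamond.

(** * Cauchy's formula *)

Section CauchyFormula.
Context {R : realType}.
Local Notation C := R[i].
Implicit Types (a b c z w u p : C^o).

Section Scalar.
Context {X : completeNormedModType C}.

Lemma dint_scalar (f : C^o -> cplane R) (x : X) a b : cts_seg f a b ->
  dint (fun w => (f w : C) *: x) a b = (dint f a b : C) *: x.
Proof.
move=> fc; have dE n u v : dsum n (fun w => (f w : C) *: x) u v = (dsum n f u v : C) *: x.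
  elim: n u v => //= n IH u v.
  by rewrite !IH -scalerDl scalerA.
rewrite /dint -[RHS]scalerA; congr (_ *: _); apply: seq_lim.
have -> : (fun n => dsum n (fun w => (f w : C) *: x) a b) =
    (fun n => (dsum n f a b : C) *: x) by apply/funext => n.
exact: (@cvgZr_tmp C X nat \oo _ _ _ x (dsum_cvg fc)).
Qed.

End Scalar.

Section Formula.
Context {X : completeNormedModType C}.
Implicit Types (g k : C^o -> X).

Lemma cauchy_transform_cst (x : X) z : rn z <= 1 / 4 -> cauchy_transform (fun=> x) z = winding *: x.
Proof.
move=> z4; rewrite -(winding_const z4) /cauchy_transform /oint scaler_suml; apply: eq_bigr => k _.
rewrite /cauchy_kernel -(@dint_scalar X (fun w => (w - z)^-1 : cplane R))// => w kw.
apply: (@ctsV R _ (fun w => w - z)); last exact: cts_sub.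
exact: edge_sub0 kw z4.
Qed.

Lemma diamond_disc w : diamond w -> rn w <= 1.
Proof. by move=> [k _]; exact: edge_upper. Qed.

(** The slope of k at z is continuous on the disc and differentiable off z. Its
    integral over the contour is a sum of integrals over four triangles with vertex
    z, hence zero; this is the formula, since the slope is (w - z)^-1 (k w - k z). *)
Lemma cauchy_formula k z : (forall w, rn w <= 1 -> cdiff k w) -> rn z <= 1 / 4 ->
  cauchy_transform k z = winding *: k z.
Proof.
move=> kd z4; have z1 : rn z <= 1 by lra.
have [d /cder_slope ds] := kd z z1; pose s := slope k z d.
have sd w : rn w <= 1 -> w != z -> cdiff s w.
  by move=> w1 wz; apply: cdiff_slope => //; exact: kd.
have sc w : rn w <= 1 -> {for w, continuous s}.
  move=> w1; have [->//|wz] := eqVneq w z.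
  by apply: cdiff_cts; exact: sd.
have vd j : rn (vtx j : C^o) <= 1 by rewrite rn_vtx.
have half0 : 0 < 1 / 2 :> R by lra.
have sz j x : edge j x -> 1 / 2 <= complex.Re (side j * (x - z)).
  by move=> /side_edge h; have := side_bound j z; rewrite mulrBr ReB; lra.
have T0 j : tint s z (vtx j) (vtx j.+1) = 0.
  exact: (vertex_goursat (@closed_disc R 1) (@convex_disc R 1) half0 sc sd z1 (vd j)
    (vd j.+1) (sz _ _ (seg_l _ _)) (sz _ _ (seg_r _ _))).
have gs x y : rn x <= 1 -> rn y <= 1 -> cts_seg s x y.
  by move=> x1 y1 w ws; apply: sc; exact: (@convex_disc R 1 x y).
have s0 : oint s = 0.
  rewrite -[RHS](@telescope4 _ (fun j => dint s z (vtx j))); last by rewrite vtx4.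
  apply: eq_bigr => j _; have /eqP := T0 j.
  rewrite /tint (dint_rev (gs _ _ z1 (vd _))) subr_eq0 => /eqP <-.
  by rewrite [X in X - _]addrC addrK.
have kc : cts_diamond k.
  by move=> w wD; apply: cdiff_cts; apply: kd; exact: diamond_disc.
have xc : cts_diamond (fun=> k z) by move=> w _; exact: cts_cst.
rewrite -(cauchy_transform_cst _ z4); apply/eqP; rewrite -subr_eq0.
rewrite /cauchy_transform -ointB; try exact: cts_kernel.
rewrite -s0; apply/eqP; apply: oint_eq => w [j _ jw].
rewrite /cauchy_kernel -scalerBr /s /slope ifN//.
by rewrite -subr_eq0; exact: edge_sub0 jw z4.
Qed.

Definition winding_inv_norm : R := rn (winding^-1 : C^o).

Lemma winding_inv_norm_ge0 : 0 <= winding_inv_norm. Proof. exact: rn_ge0. Qed.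

Lemma cauchy_inv k z : (forall w, rn w <= 1 -> cdiff k w) -> rn z <= 1 / 4 ->
  k z = winding^-1 *: cauchy_transform k z.
Proof. by move=> kd z4; rewrite cauchy_formula// scalerA mulVf ?scale1r// winding_neq0. Qed.

Lemma cauchy_bound k (M : R) : (forall w, rn w <= 1 -> cdiff k w) ->
  (forall w, diamond w -> rn (k w) <= M) -> rn (k 0) <= winding_inv_norm * (32 * M).
Proof.
move=> kd kM; rewrite (cauchy_inv kd rn_quarter0) rnZ ler_wpM2l ?rn_ge0//.
apply: cauchy_transform_bound => //; last exact: rn_quarter0.
by move=> w wD; apply: cdiff_cts; apply: kd; exact: diamond_disc.
Qed.

(** Cauchy's formula writes k as a Cauchy transform, and two uses of the resolvent
    identity expand it to second order at 0. The bound on the remainder depends on k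
    only through its supremum on the contour. *)
Lemma unit_expansion k (M : R) : (forall w, rn w <= 1 -> cdiff k w) ->
  exists d, [/\ cder k 0 d, cdiff (slope k 0 d) 0 &
    (forall w, diamond w -> rn (k w) <= M) -> forall z, rn z <= 1 / 4 ->
      rn (k z - k 0 - z *: d) <= winding_inv_norm * (128 * M) * (rn z * rn z)].
Proof.
move=> kd; have r4 := @rn_quarter0 R.
have kc : cts_diamond k.
  by move=> w wD; apply: cdiff_cts; apply: kd; exact: diamond_disc.
have k1c := cts_kernel kc r4; have k2c := cts_kernel k1c r4.
pose q z := winding^-1 *: cauchy_transform (cauchy_kernel k 0) z.
have kE z : rn z <= 1 / 4 -> k z = k 0 + z *: q z.
  move=> z4; rewrite (cauchy_inv kd z4) (cauchy_inv kd r4) cauchy_transform_slope// scalerDr.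
  by congr (_ + _); rewrite /q !scalerA mulrC.
have qs z : rn z <= 1 / 4 -> q z = slope k 0 (q 0) z.
  move=> z4; rewrite /slope; case: eqP => [->//|/eqP z0].
  by rewrite subr0 (kE z z4) addrC addKr scalerA mulVf// scale1r.
have sd : cdiff (slope k 0 (q 0)) 0.
  apply: (@cdiff_near _ _ q).
    by apply/nbhs_rnP; exists (1 / 4) => [|z]; [lra | rewrite subr0; exact: qs].
  apply: (@cdiffZ _ _ (fun=> winding^-1)); first exact: (@cdiff_cst _ (C^o)).
  by eexists; exact: cauchy_transform_cder0.
exists (q 0); split => //.
  by apply/cder_slope; exact: cdiff_cts.
move=> kM z z4.
have -> : k z - k 0 - z *: q 0 =
    (z * z) *: (winding^-1 *: cauchy_transform (cauchy_kernel (cauchy_kernel k 0) 0) z).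
  rewrite (kE z z4) (addrC (k 0)) addrK -scalerBr -scalerA; congr (_ *: _).
  rewrite /q (cauchy_transform_slope k1c z4) scalerDr (addrC (_ *: cauchy_transform _ 0)).
  by rewrite addrK !scalerA mulrC.
rewrite rnZ rnM mulrC ler_wpM2r ?mulr_ge0 ?rn_ge0// rnZ ler_wpM2l ?rn_ge0//.
have -> : 128 * M = 32 * (2 * (2 * M)) by ring.
have inv2 w : diamond w -> rn ((w - 0)^-1 : C^o) <= 2.
  move=> [j j4 /edge_lower h]; rewrite subr0 rnV -(invrK 2) lef_pV2.
  - by lra.
  - by rewrite posrE; lra.
  - by rewrite posrE invr_gt0.
apply: cauchy_transform_bound => // w wD; rewrite /cauchy_kernel !rnZ.
apply: ler_pM; rewrite ?mulr_ge0 ?rn_ge0//; first exact: inv2.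
by apply: ler_pM; rewrite ?rn_ge0//; [exact: inv2 | exact: kM].
Qed.

Lemma cder_unique k z d d' : cder k z d -> cder k z d' -> d = d'.
Proof.
move=> kd kd'; apply/eqP; rewrite -subr_eq0; apply/eqP; apply: rn0_eq0; apply/eqP.
rewrite eq_le rn_ge0 andbT; apply: (@le0_small _ _ 2) => e e0.
have [r r0 rP] := kd _ e0; have [r' r'0 r'P] := kd' _ e0.
pose s := Num.min r r'; have s0 : 0 < s by rewrite lt_min r0.
have szr : rn (z + s%:C - z : C^o) = s by rewrite addrC addKr rnR (ger0_norm (ltW s0)).
have := rP (z + s%:C); have := r'P (z + s%:C).
rewrite szr /s !ge_min !lexx orbT -/s => /(_ isT) h' /(_ isT) h.
have : rn (s%:C *: (d - d')) <= e * s + e * s.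
  have -> : s%:C *: (d - d') = (k (z + s%:C) - k z - (z + s%:C - z) *: d')
      - (k (z + s%:C) - k z - (z + s%:C - z) *: d).
    rewrite (addrC z) addrK scalerBr opprB [RHS]addrC addrA.
    by rewrite subrK.
  by rewrite (le_trans (rnB _ _))// lerD.
rewrite rnZ rnR (ger0_norm (ltW s0)) -mulrDl mulrC ler_pM2r// => /le_trans; apply; lra.
Qed.

(** A second derivative from one derivative on a disc: [unit_expansion] transported
    by an affine change of variable. *)
Lemma slope_cdiff k p (r : R) : 0 < r -> (forall w, rn (w - p) <= r -> cdiff k w) ->
  exists2 d, cder k p d & cdiff (slope k p d) p.
Proof.
move=> r0 kd; have rC0 : r%:C != 0 :> C by rewrite (inj_eq (@complexI R) r 0) gt_eqF.
pose h w := k (p + r%:C * w).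
have [|d [_ sd _]] := @unit_expansion h 0.
  move=> w w1; apply: (@cdiff_affine _ _ k p r%:C); apply: kd.
  by rewrite addrC addKr rnM rnR (ger0_norm (ltW r0)) ger_pMr.
have E w : slope k p (r%:C^-1 *: d) w = r%:C^-1 *: slope h 0 d (- (p / r%:C) + r%:C^-1 * w).
  have wE : - (p / r%:C) + r%:C^-1 * w = (w - p) / r%:C by field.
  rewrite wE /slope subr0 /h mulr0 addr0.
  have -> : ((w - p) / r%:C == 0 :> C^o) = (w == p).
    by rewrite mulf_eq0 invr_eq0 (negPf rC0) orbF subr_eq0.
  case: eqP => // /eqP wp; have -> : p + r%:C * ((w - p) / r%:C) = w by field.
  by rewrite scalerA; congr (_ *: _); field; rewrite rC0 subr_eq0.
have sd' : cdiff (slope k p (r%:C^-1 *: d)) p.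
  rewrite (_ : slope k p _ = fun w => r%:C^-1 *: slope h 0 d (- (p / r%:C) + r%:C^-1 * w)).
    apply: (@cdiffZ _ _ (fun=> r%:C^-1)); first exact: (@cdiff_cst _ (C^o)).
    apply: cdiff_affine; rewrite (_ : _ + _ = 0)//; by field.
  by apply/funext => w; exact: E.
by exists (r%:C^-1 *: d) => //; apply/cder_slope; exact: cdiff_cts.
Qed.

End Formula.
End CauchyFormula.

(** * Removable singularities and zeros *)

Section Removable.
Context {R : realType} {X : completeNormedModType R[i]}.
Local Notation C := R[i].
Implicit Types (z w p a : C^o) (g : C^o -> X).

Definition patch g a (d : X) : C^o -> X := fun w => if w == a then d else g w.

Lemma patch_near g a d w : w != a -> \forall u \near w, g u = patch g a d u.
Proof.
move=> wa; apply/nbhs_rnP; have wa0 : 0 < rn (w - a : C^o) by rewrite rn_gt0 subr_eq0.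
exists (rn (w - a : C^o) / 2) => [|u uw]; first by rewrite divr_gt0.
rewrite /patch; case: eqP => // ua; move: uw; rewrite ua rnBC => h; exfalso; lra.
Qed.

(** Riemann's theorem. As g is bounded, k = (w - a)^2 g is differentiable at a with
    derivative 0. Taking the slope of k at a gives (w - a) g, which is therefore
    differentiable, and taking the slope once more gives g away from a. *)
Lemma removable1 g a (r M : R) : 0 < r ->
  (forall w, 0 < rn (w - a) <= r -> cdiff g w /\ rn (g w) <= M) ->
  exists d, cdiff (patch g a d) a.
Proof.
move=> r0 gr; pose s1 w := (w - a) *: g w; pose k w := (w - a) *: s1 w.
have M0 : 0 <= M.
  have [|_] := gr (a + r%:C); last by apply: le_trans; exact: rn_ge0.
  by rewrite addrC addKr rnR (ger0_norm (ltW r0)) r0 lexx.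
have s1a : s1 a = 0 by rewrite /s1 subrr scale0r.
have gd w : w != a -> rn (w - a) <= r -> cdiff g w /\ rn (g w) <= M.
  by move=> wa wr; apply: gr; rewrite rn_gt0 subr_eq0 wa.
have s1d w : w != a -> rn (w - a) <= r -> cdiff s1 w.
  by move=> wa wr; apply: cdiffZ; [exact: cdiff_sub | exact: (gd w wa wr).1].
have ka : cder k a 0.
  have s1c : {for a, continuous s1}.
    apply/continuous_rnP => e e0; have M1 : 0 < M + 1 by lra.
    exists (Num.min r (e / (M + 1))) => [|w]; first by rewrite lt_min r0 divr_gt0.
    rewrite le_min => /andP[wr]; rewrite ler_pdivlMr// => we.
    have [->|wa] := eqVneq w a; first by rewrite subrr rn0 ltW.
    rewrite s1a subr0 /s1 rnZ; have [_ gM] := gd w wa wr.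
    have := ler_wpM2l (rn_ge0 (w - a)) gM; have := rn_ge0 (w - a); nra.
  rewrite -s1a; apply: cder_caratheodory => // w.
  by rewrite /k subrr scale0r add0r.
have kd w : rn (w - a) <= r -> cdiff k w.
  move=> wr; have [->|wa] := eqVneq w a; first by exists 0.
  by apply: cdiffZ; [exact: cdiff_sub | exact: s1d].
have [d1 kd1 sd1] := slope_cdiff r0 kd.
have d10 := cder_unique kd1 ka; rewrite {}d10 in sd1 {kd1}.
have s1E : slope k a 0 = s1.
  apply/funext => w; rewrite /slope; case: eqP => [->|/eqP wa]; first by rewrite s1a.
  by rewrite /k subrr scale0r subr0 scalerA mulVf ?subr_eq0// scale1r.
have s1d' w : rn (w - a) <= r -> cdiff s1 w.
  move=> wr; have [->|wa] := eqVneq w a; first by rewrite -s1E.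
  exact: s1d.
have [d2 _ sd2] := slope_cdiff r0 s1d'.
exists d2; rewrite (_ : patch g a d2 = slope s1 a d2)//.
apply/funext => w; rewrite /patch /slope; case: eqP => // /eqP wa.
by rewrite s1a subr0 /s1 scalerA mulVf ?subr_eq0// scale1r.
Qed.

Lemma seq_away (a : C^o) (s : seq C) : a \notin s ->
  exists2 r : R, 0 < r & forall w, w \in s -> r < rn (w - a : C^o).
Proof.
elim: s => [|b s IH]; first by exists 1.
rewrite inE negb_or => /andP[ab /IH[r r0 rP]].
have ba : 0 < rn (b - a : C^o) by rewrite rn_gt0 subr_eq0 eq_sym.
exists (Num.min r (rn (b - a : C^o) / 2)) => [|w].
  by rewrite lt_min r0 divr_gt0.
rewrite inE => /orP[/eqP ->|/rP h]; rewrite gt_min; last by rewrite h.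
by apply/orP; right; lra.
Qed.

(** The points of s are treated one by one: each of those inside the disc has a
    punctured disc around it that is free of the remaining points. *)
Lemma removable (s : seq C) g (M : R) :
  (forall w, rn w < 2 -> (w : C) \notin s -> cdiff g w /\ rn (g w) <= M) ->
  exists gh : C^o -> X, (forall w, rn w < 2 -> cdiff gh w) /\
    forall w, (w : C) \notin s -> gh w = g w.
Proof.
elim: s g M => [|a s IH] g M gM.
  by exists g; split=> // w w2; have [] := gM w w2 isT.
have [as_|as_] := boolP (a \in s).
  have [|gh [ghd ghE]] := IH g M.
    by move=> w w2 ws; apply: gM => //; rewrite inE negb_or ws andbT; apply: contraNneq ws => ->.
  by exists gh; split=> // w; rewrite inE negb_or => /andP[_ /ghE].
have [a2|a2] := leP 2 (rn (a : C^o)).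
  have [|gh [ghd ghE]] := IH g M.
    move=> w w2 ws; apply: gM => //; rewrite inE negb_or ws andbT.
    by apply/eqP => wa; move: w2; rewrite wa ltNge a2.
  by exists gh; split=> // w; rewrite inE negb_or => /andP[_ /ghE].
have [r r0 rP] := seq_away as_.
pose r' := Num.min r ((2 - rn (a : C^o)) / 2).
have r'0 : 0 < r' by rewrite lt_min r0; lra.
have r'a w : 0 < rn (w - a) <= r' -> cdiff g w /\ rn (g w) <= M.
  rewrite le_min => /andP[wa /andP[wr wr']]; apply: gM.
    by have := rnD (w - a) (a : C^o); rewrite subrK; lra.
  rewrite inE negb_or; apply/andP; split.
    by move: wa; rewrite rn_gt0 subr_eq0.
  by apply/negP => /rP; rewrite ltNge wr.
have [d dP] := removable1 r'0 r'a.
have [|gh [ghd ghE]] := IH (patch g a d) (Num.max M (rn d)).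
  move=> w w2 ws; have [->|wa] := eqVneq w a.
    by split=> //; rewrite /patch eqxx le_max lexx orbT.
  have wn : (w : C) \notin a :: s by rewrite inE negb_or wa ws.
  have [gw gwM] := gM w w2 wn; split.
    by apply: cdiff_near gw; exact: patch_near.
  by rewrite /patch (negPf wa) le_max gwM.
exists gh; split=> // w; rewrite inE negb_or => /andP[wa ws].
by rewrite ghE// /patch (negPf wa).
Qed.

Lemma cauchy_removable (s : seq C) g (M : R) :
  (forall w, rn w < 2 -> (w : C) \notin s -> cdiff g w /\ rn (g w) <= M) ->
  (forall w, diamond w -> (w : C) \notin s) -> (0 : C) \notin s ->
  cauchy_transform g 0 = winding *: g 0.
Proof.
move=> gM ds s0; have [gh [ghd ghE]] := removable gM.
rewrite -(ghE 0 s0) -cauchy_formula; last exact: rn_quarter0.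
  apply: oint_eq => w /ds wD; by rewrite /cauchy_kernel ghE.
by move=> w w1; apply: ghd; lra.
Qed.

End Removable.

Section Zeros.
Context {R : realType}.
Local Notation C := R[i].
Local Notation P := (cplane R).

(** Each zero is divided out by taking a slope there. *)
Lemma factor_zeros (phi : C^o -> P) (s : seq C) :
  (forall w, rn w < 2 -> cdiff phi w) -> uniq s ->
  (forall p, p \in s -> rn (p : C^o) < 2 /\ phi p = 0) ->
  exists psi : C^o -> P, (forall w, rn w < 2 -> cdiff psi w) /\
    forall w, phi w = (\prod_(p <- s) (w - p)) * psi w :> C.
Proof.
move=> phid; elim: s => [|p s IH] /=.
  by move=> _ _; exists phi; split=> // w; rewrite big_nil mul1r.
move=> /andP[ps us] sP; have [||psi [psid phiE]] := IH => //.
  by move=> q qs; apply: sP; rewrite inE qs orbT.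
have [p2 phip] := sP p (mem_head _ _).
have psip : psi p = 0.
  have := phiE p; rewrite phip => /esym/eqP; rewrite mulf_eq0 => /orP[|/eqP//].
  rewrite prodf_seq_eq0 => /hasP[q qs /=]; rewrite subr_eq0 => /eqP pq.
  by move: ps; rewrite pq qs.
have r0 : 0 < (2 - rn (p : C^o)) / 2 by lra.
have [|d _ sd] := @slope_cdiff R P psi p _ r0.
  by move=> w wp; apply: psid; have := rnD (w - p : C^o) (p : C^o); rewrite subrK; lra.
exists (slope psi p d); split=> [w w2|w].
  have [->//|wp] := eqVneq w p; by apply: cdiff_slope => //; exact: psid.
rewrite phiE big_cons (slopeE psi p d w) psip add0r.
by rewrite [RHS]mulrAC mulrC -mulrA.
Qed.

(** An estimate of Jensen's type. Dividing phi by m zeros in the disc of radius 1/8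
    costs a factor at most 4^m on the contour, as |w - p| >= 1/4 there, but gains
    8^m at 0, as |p| <= 1/8. With Cauchy's bound for the quotient,
    |phi 0| <= const * (4/8)^m, which limits m. *)
Lemma zeros_bounded (phi : C^o -> P) :
  (forall w, rn w < 2 -> cdiff phi w) -> phi 0 <> 0 ->
  exists N, forall s : seq C, uniq s ->
    (forall p, p \in s -> rn (p : C^o) <= 1 / 8 /\ phi p = 0) -> (size s <= N)%N.
Proof.
move=> phid phi0.
have dc : cts_diamond phi.
  by move=> w /diamond_disc w1; apply: cdiff_cts; apply: phid; lra.
have [M MP] := diamond_bounded dc.
have M0 : 0 <= M.
  by apply: le_trans (rn_ge0 _) (MP (vtx 0) _); exists 0%N => //; exact: seg_l.
have phi00 : 0 < rn (phi 0) by rewrite rn_gt0; apply/eqP.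
have [N NP] := div_pow2_small (@winding_inv_norm R * (32 * M)) (divr_gt0 phi00 (ltr0Sn R 1)).
exists N => s us sP; rewrite leqNgt; apply/negP => /ltnW /NP {NP}.
set m := size s; rewrite leNgt => /negP; apply.
have sP2 p : p \in s -> rn (p : C^o) < 2 /\ phi p = 0.
  by move=> /sP[p8 ->]; split=> //; lra.
have [psi [psid phiE]] := factor_zeros phid us sP2.
have prodlow (t : seq C) (w : C^o) : (forall p, p \in t -> rn (p : C^o) <= 1 / 8) ->
    1 / 2 <= rn w -> (1 / 4) ^+ size t <= rn (\prod_(p <- t) (w - p) : C^o).
  elim: t => [|q t IH] tP w2; first by rewrite big_nil rn1 expr0.
  rewrite big_cons rnM /= exprS; apply: ler_pM.
  - by lra.
  - by rewrite exprn_ge0//; lra.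
  - by have := tP q (mem_head _ _); have := rnD (w - q) (q : C^o); rewrite subrK; lra.
  - by apply: IH => // p pt; apply: tP; rewrite inE pt orbT.
have produp (t : seq C) : (forall p, p \in t -> rn (p : C^o) <= 1 / 8) ->
    rn (\prod_(p <- t) (0 - p) : C^o) <= (1 / 8) ^+ size t.
  elim: t => [|q t IH] tP; first by rewrite big_nil rn1 expr0.
  rewrite big_cons rnM /= exprS; apply: ler_pM; rewrite ?rn_ge0//.
    by rewrite sub0r rnN; exact: tP (mem_head _ _).
  by apply: IH => // p pt; apply: tP; rewrite inE pt orbT.
have s8 p : p \in s -> rn (p : C^o) <= 1 / 8 by move=> /sP[].
have psib w : diamond w -> rn (psi w) <= 4 ^+ m * M.
  move=> wD; have [k k4 kw] := wD; have := MP w wD.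
  rewrite (phiE w) (@rnM R) => h.
  have := ler_wpM2r (rn_ge0 (psi w)) (prodlow s w s8 (edge_lower kw)).
  rewrite -/m => h2; have q4 : 0 < 4 ^+ m :> R by rewrite exprn_gt0.
  rewrite -(ler_pM2l (_ : 0 < (1 / 4) ^+ m)); last by rewrite exprn_gt0//; lra.
  apply: le_trans h2 _; apply: le_trans h _.
  rewrite mulrA -exprMn; have -> : 1 / 4 * 4 = 1 :> R by field.
  by rewrite expr1n mul1r.
have psi0 := @cauchy_bound R P psi _ _ psib.
have {}psi0 : rn (psi 0) <= @winding_inv_norm R * (32 * (4 ^+ m * M)).
  by apply: psi0 => w w1; apply: psid; lra.
have h1 : rn (phi 0) <= (1 / 8) ^+ m * (@winding_inv_norm R * (32 * (4 ^+ m * M))).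
  rewrite (phiE 0) (@rnM R); apply: ler_pM; rewrite ?rn_ge0//.
  exact: produp.
have E : (1 / 8) ^+ m * (@winding_inv_norm R * (32 * (4 ^+ m * M))) =
    @winding_inv_norm R * (32 * M) / 2 ^+ m.
  rewrite [LHS](_ : _ = @winding_inv_norm R * (32 * M) * ((1 / 8) ^+ m * 4 ^+ m)); last by ring.
  by rewrite -exprMn -exprVn; congr (_ * _ ^+ _); field.
by rewrite -E; move: h1; lra.
Qed.

Lemma zeros_finite (phi : C^o -> P) :
  (forall w, rn w < 2 -> cdiff phi w) -> phi 0 <> 0 ->
  exists s : seq C, forall w, rn (w : C^o) <= 1 / 8 -> phi w = 0 -> w \in s.
Proof.
move=> phid /(zeros_bounded phid)[N NP].
apply: contrapT => /forallNP noseq.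
have more n : exists s : seq C, [/\ uniq s, size s = n &
    forall p, p \in s -> rn (p : C^o) <= 1 / 8 /\ phi p = 0].
  elim: n => [|n [s [us sn sP]]]; first by exists [::].
  have /existsNP[w /not_implyP[w8 /not_implyP[w0 ws]]] := noseq s.
  exists (w :: s); split => /=; first by rewrite us andbT; apply/negP.
    by rewrite sn.
  by move=> p; rewrite inE => /orP[/eqP -> //|/sP].
have [s [us sn sP]] := more N.+1.
by have := NP s us sP; rewrite sn ltnn.
Qed.

End Zeros.

(** * Frechet derivatives *)

Section Frechet.
Context {R : realType}.
Local Notation C := R[i].
Implicit Types V W : normedModType C.

(** Frechet differentiability with real-valued norms and an explicit differential;
    the two lemmas that follow relate it to [differentiable]. *)
Definition fder V W (h : V -> W) (Z : V) (L : V -> W) := [/\ linear L,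
  exists M : R, forall w, rn (L w) <= M * rn w &
  forall e : R, 0 < e -> exists2 r : R, 0 < r &
    forall w, rn w <= r -> rn (h (Z + w) - h Z - L w) <= e * rn w].

Lemma fder_differentiable V W (h : V -> W) Z L : fder h Z L -> differentiable h Z.
Proof.
move=> [Llin [M LM] hL].
pose Ll : {linear V -> W} := HB.pack L (GRing.isLinear.Build _ _ _ _ L Llin).
have Lc : continuous Ll.
  move=> x; apply/continuous_rnP => e e0.
  have M1 : 0 < `|M| + 1 by rewrite ltr_wpDl.
  exists (e / (`|M| + 1)) => [|w wx]; first by rewrite divr_gt0.
  rewrite -linearB /= (le_trans (LM _))//; move: wx; rewrite ler_pdivlMr// => wx.
  by have := ler_norm M; have := rn_ge0 (w - x); nra.
have hlit : h \o shift Z = cst (h Z) + Ll +o_ 0 id.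
  apply/eqaddoP => e e0.
  have e0' : 0 < complex.Re e by move: e0; rewrite ltcE => /andP[].
  have eE : (complex.Re e)%:C = e by apply/RRe_real/ger0_real/ltW.
  have [r r0 rP] := hL _ e0'; apply/nbhs_rnP; exists r => // w.
  rewrite subr0 => /rP; rewrite -lecR rmorphM /= !rnE eE.
  have -> : (h \o shift Z - (cst (h Z) + Ll)) w = h (Z + w) - h Z - L w.
    by rewrite !fctE /= (addrC w) opprD addrA.
  by [].
apply/diff_locallyP; rewrite (diff_unique Lc hlit); split => //.
Qed.

Lemma differentiable_fder V W (h : V -> W) Z : differentiable h Z -> fder h Z ('d h Z).
Proof.
move=> hd; have [dc] := (diff_locallyP Z h).1 hd.
move=> /eqaddoP hlit; split; first exact: linearP.
  have [r r0 rP] := (continuous_rnP ('d h Z) 0).1 (dc 0) _ ltr01.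
  exists r^-1 => w; have [->|w0] := eqVneq w 0; first by rewrite linear0 !rn0 mulr0.
  have wp : 0 < rn w by rewrite rn_gt0.
  have := rP ((r / rn w)%:C *: w).
  rewrite subr0 linear0 subr0 linearZ !rnZ rnR ger0_norm ?divr_ge0 ?(ltW r0) ?rn_ge0//.
  rewrite divfK ?gt_eqF// => /(_ (lexx _)) h1.
  have -> : rn ('d h Z w) = rn w / r * (r / rn w * rn ('d h Z w)).
    by field; rewrite !gt_eqF.
  by rewrite -[leRHS]mulr1 [r^-1 * _]mulrC ler_wpM2l// divr_ge0// ltW.
move=> e e0; have ec0 : 0 < e%:C :> C by rewrite (ltcR 0).
have /nbhs_rnP[r r0 rP] := hlit _ ec0; exists r => // w wr.
have := rP w; rewrite subr0 => /(_ wr); rewrite -!rnE -rmorphM /= lecR.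
have -> : (h \o shift Z - (cst (h Z) + 'd h Z)) w = h (Z + w) - h Z - 'd h Z w.
  by rewrite !fctE /= (addrC w) opprD addrA.
by [].
Qed.

Lemma linear_scale V W (L : V -> W) (a : C) w : linear L -> L (a *: w) = a *: L w.
Proof.
move=> Llin; pose Ll : {linear V -> W} := HB.pack L (GRing.isLinear.Build _ _ _ _ L Llin).
by rewrite -[L]/(Ll : V -> W) linearZ.
Qed.

Lemma line_cder V W (h : V -> W) Z (w : V) (mu : C^o) L : fder h (Z + mu *: w) L ->
  cder (fun z : C^o => h (Z + z *: w)) mu (L w).
Proof.
move=> [Llin _ hL] e e0; have w1 : 0 < rn w + 1 by rewrite ltr_wpDl ?rn_ge0.
have [r r0 rP] := hL _ (divr_gt0 e0 w1).
exists (r / (rn w + 1)) => [|z]; first by rewrite divr_gt0.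
rewrite ler_pdivlMr// => zr.
have zE : Z + z *: w = (Z + mu *: w) + (z - mu) *: w.
  by rewrite -addrA -scalerDl (addrC mu) subrK.
have LE : L ((z - mu) *: w) = (z - mu) *: L w.
  exact: linear_scale.
have := rP ((z - mu) *: w); rewrite -zE LE !rnZ => h1.
have h2 : rn (z - mu : C^o) * rn w <= r by have := rn_ge0 (z - mu : C^o); have := rn_ge0 w; nra.
apply: le_trans (h1 h2) _; rewrite mulrAC ler_pdivrMr// -mulrA ler_pM2l//.
by rewrite ler_wpM2l ?rn_ge0// lerDl.
Qed.

Lemma line_cdiff V W (h : V -> W) Z (w : V) (mu : C^o) :
  differentiable h (Z + mu *: w) -> cdiff (fun z : C^o => h (Z + z *: w)) mu.
Proof. by move=> /differentiable_fder/line_cder; exists ('d h (Z + mu *: w) w). Qed.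

Definition taylor_cst (M r : R) : R := @winding_inv_norm R * (128 * M) / r ^+ 2.

(** The second-order Taylor estimate on a line through Z, with the one-variable
    remainder bound. It depends on h only through M, so it is uniform along a
    bounded sequence. *)
Lemma taylor2 V (X : completeNormedModType C) (h : V -> X) (Z : V) (r M : R) : 0 < r ->
  (forall Y, rn (Y - Z) <= r -> differentiable h Y /\ rn (h Y) <= M) ->
  forall w, rn w <= r / 4 ->
    rn (h (Z + w) - h Z - 'd h Z w) <= taylor_cst M r * rn w ^+ 2.
Proof.
move=> r0 hP w wr; have [->|w0] := eqVneq w 0.
  by rewrite addr0 subrr linear0 subrr !rn0 expr0n /= mulr0 lexx.
have wp : 0 < rn w by rewrite rn_gt0.
pose w' := (r / rn w)%:C *: w.
have w'r : rn w' = r by rewrite rnZ rnR ger0_norm ?divr_ge0 ?(ltW r0) ?rn_ge0// divfK// gt_eqF.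
pose z : C^o := (rn w / r)%:C.
have zw : z *: w' = w.
  rewrite /w' scalerA -rmorphM /=.
  have -> : rn w / r * (r / rn w) = 1 by field; rewrite !gt_eqF.
  exact: scale1r.
have zr : rn z = rn w / r by rewrite rnR ger0_norm// divr_ge0 ?rn_ge0// ltW.
have inr (u : C^o) : rn u <= 1 -> rn (Z + u *: w' - Z) <= r.
  by move=> u1; rewrite addrC addKr rnZ w'r; nra.
have [|d [dP _ dT]] := @unit_expansion R X (fun u : C^o => h (Z + u *: w')) M.
  by move=> u u1; apply: line_cdiff; have [] := hP _ (inr u u1).
have dE : d = 'd h Z w'.
  apply: cder_unique dP _; apply: line_cder; rewrite scale0r addr0.
  by apply: differentiable_fder; apply: (hP Z _).1; rewrite subrr rn0 ltW.
have z4 : rn z <= 1 / 4 by rewrite zr ler_pdivrMr//; lra.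
have := dT _ z z4; rewrite zw scale0r addr0 dE -linearZ /= zw zr.
have -> : winding_inv_norm * (128 * M) * (rn w / r * (rn w / r)) = taylor_cst M r * rn w ^+ 2.
  by rewrite /taylor_cst; field; rewrite gt_eqF.
by apply => u /diamond_disc u1; have [] := hP _ (inr u u1).
Qed.

(** Two differentials u and v in a direction are close as soon as the values of the
    functions are close at both ends of the step t (d) and the Taylor remainders are
    small (c). *)
Lemma divided_difference_close (X : normedModType C) (A B D E F G u v : X) (t c d : R) :
  0 <= t -> rn (A - B - t%:C *: u) <= c -> rn (D - E - t%:C *: v) <= c ->
  rn (B - F) <= d -> rn (E - F) <= d -> rn (A - G) <= d -> rn (D - G) <= d ->
  t * rn (u - v) <= 2 * c + 4 * d.
Proof.
move=> t0 Tm Tn a1 a2 a3 a4.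
have tE : t * rn (u - v) = rn (t%:C *: (u - v)) by rewrite rnZ rnR ger0_norm.
have E1 : t%:C *: (u - v) =
    ((D - E - t%:C *: v) - (A - B - t%:C *: u)) + (A - D) - (B - E).
  rewrite scalerBr !opprD !opprK; apply/esym.
  rewrite [LHS](AC ((3*3)*2*2) ((6*3)*(4*7)*(1*8)*(2*10)*(5*9)))/=.
  by rewrite !addNr !subrr !addr0.
rewrite tE E1.
have := rnB ((D - E - t%:C *: v) - (A - B - t%:C *: u) + (A - D)) (B - E).
have := rnD ((D - E - t%:C *: v) - (A - B - t%:C *: u)) (A - D).
have := rnB (D - E - t%:C *: v) (A - B - t%:C *: u).
have := rn_tri G A D; rewrite (rnBC G D); have := rn_tri F B E; rewrite (rnBC F E).
lra.
Qed.

(** The uniform Taylor estimate makes the differentials Cauchy pointwise: for a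
    fixed small step t the divided differences converge, and they differ from the
    differentials by O(t). The estimate then passes to the limit and shows that the
    limiting linear map is the differential of h. *)
Lemma pointwise_limit V (X : completeNormedModType C) (hn : nat -> V -> X) (h : V -> X)
    (Z : V) (r M : R) : 0 < r ->
  (forall n Y, rn (Y - Z) <= r -> differentiable (hn n) Y /\ rn (hn n Y) <= M) ->
  (forall Y, rn (Y - Z) <= r -> (fun n => hn n Y) @ \oo --> h Y) ->
  differentiable h Z.
Proof.
move=> r0 hnP hnh; pose K := taylor_cst M r.
have ZZ : rn (Z - Z) <= r by rewrite subrr rn0 ltW.
have M0 : 0 <= M by have [_] := hnP 0%N _ ZZ; apply: le_trans; exact: rn_ge0.
have K0 : 0 <= K.
  rewrite /K /taylor_cst divr_ge0 ?exprn_ge0 ?(ltW r0)// !mulr_ge0//.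
  exact: winding_inv_norm_ge0.
have T n w : rn w <= r / 4 -> rn (hn n (Z + w) - hn n Z - 'd (hn n) Z w) <= K * rn w ^+ 2.
  by apply: taylor2 => // Y; exact: hnP.
have inr w : rn w <= r / 4 -> rn (Z + w - Z) <= r by rewrite addrC addKr; lra.
have Lc w : cvgn (fun n => 'd (hn n) Z w).
  apply: cauchy_rn_cvg => e e0.
  pose Wn := rn w; have W0 : 0 <= Wn by exact: rn_ge0.
  have W1 : 0 < Wn + 1 by lra.
  have KW1 : 0 < 4 * K * Wn ^+ 2 + 1.
    by have := mulr_ge0 K0 (exprn_ge0 2 W0); lra.
  (* The step t keeps t w inside the disc and makes both Taylor remainders, of size
     K t^2 |w|^2, at most e t / 4. *)
  pose t := Num.min (r / 4 / (Wn + 1)) (e / (4 * K * Wn ^+ 2 + 1)).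
  have t0 : 0 < t by rewrite lt_min !divr_gt0.
  have tn : `|t| = t by rewrite ger0_norm// ltW.
  have tw : rn (t%:C *: w) = t * Wn by rewrite rnZ rnR tn.
  have twr : rn (t%:C *: w) <= r / 4.
    have : t <= r / 4 / (Wn + 1) by rewrite ge_min lexx.
    by rewrite tw ler_pdivlMr//; nra.
  have te : t * (4 * K * Wn ^+ 2) <= e.
    have : t <= e / (4 * K * Wn ^+ 2 + 1) by rewrite ge_min lexx orbT.
    by rewrite ler_pdivlMr//; nra.
  have e8 : 0 < e * t / 8 by rewrite divr_gt0// mulr_gt0.
  have [N1 N1P] := (cvg_seqP _ _).1 (hnh _ ZZ) _ e8.
  have [N2 N2P] := (cvg_seqP _ _).1 (hnh _ (inr _ twr)) _ e8.
  exists (maxn N1 N2) => m n; rewrite !geq_max => /andP[m1 m2] /andP[n1 n2].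
  have Tm := T m _ twr; have Tn := T n _ twr; rewrite tw in Tm Tn.
  have a1 := N1P _ m1; have a2 := N1P _ n1; have a3 := N2P _ m2; have a4 := N2P _ n2.
  have dZ k : 'd (hn k) Z (t%:C *: w) = t%:C *: 'd (hn k) Z w.
    by apply: linear_scale; exact: linearP.
  rewrite dZ in Tm; rewrite dZ in Tn.
  have := divided_difference_close (ltW t0) Tm Tn a1 a2 a3 a4.
  move=> h1; rewrite -(ler_pM2l t0); apply: le_trans h1 _.
  have h2 := ler_wpM2l (ltW t0) te; clear -h2; lra.
pose L w := lim ((fun n => 'd (hn n) Z w) @ \oo).
have LL w : (fun n => 'd (hn n) Z w) @ \oo --> L w by exact: Lc.
have TL w : rn w <= r / 4 -> rn (h (Z + w) - h Z - L w) <= K * rn w ^+ 2.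
  move=> wr; apply: seq_bound (fun n => T n w wr).
  apply: (@cvg_seqB R X (fun n => hn n (Z + w) - hn n Z)); last exact: LL.
  by apply: cvg_seqB; apply: hnh => //; exact: inr.
have Llin : linear L.
  move=> a u v; apply: (@seq_uniq R X (fun n => 'd (hn n) Z (a *: u + v))); first exact: LL.
  have -> : (fun n => 'd (hn n) Z (a *: u + v)) =
      (fun n => a *: 'd (hn n) Z u + 'd (hn n) Z v).
    by apply/funext => n; rewrite linearP.
  exact: (@cvg_seqD R X _ _ _ _ (@cvg_seqZ R X a _ _ (LL u)) (LL v)).
have hM Y : rn (Y - Z) <= r -> rn (h Y) <= M.
  by move=> Yr; apply: seq_bound (hnh _ Yr) _ => n; have [] := hnP n _ Yr.
apply: (@fder_differentiable _ _ _ _ L); split=> //.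
  (* The Taylor estimate at norm r / 4 bounds the linear map on that sphere. *)
  pose B := 2 * M + K * (r / 4) ^+ 2; exists (4 * B / r) => w.
  have LZ (a : C) u : L (a *: u) = a *: L u.
    exact: linear_scale.
  have [->|w0] := eqVneq w 0.
    by rewrite -[X in L X](scale0r 0) LZ scale0r !rn0 mulr0 lexx.
  have wp : 0 < rn w by rewrite rn_gt0.
  pose s := r / 4 / rn w; have s0 : 0 < s by rewrite !divr_gt0.
  have sw : rn (s%:C *: w) = r / 4.
    by rewrite rnZ rnR (ger0_norm (ltW s0)) /s divfK// gt_eqF.
  have := TL (s%:C *: w); rewrite sw LZ => /(_ (lexx _)) h1.
  have h2 : rn (s%:C *: L w) <= B.
    have -> : s%:C *: L w = (h (Z + s%:C *: w) - h Z) - (h (Z + s%:C *: w) - h Z - s%:C *: L w).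
      by rewrite subKr.
    have h3 : rn (h (Z + s%:C *: w)) <= M.
      by apply: hM; rewrite addrC addKr sw; clear -r0; lra.
    have h4 := hM _ ZZ; have h5 := rnB (h (Z + s%:C *: w)) (h Z).
    have h6 := rnB (h (Z + s%:C *: w) - h Z) (h (Z + s%:C *: w) - h Z - s%:C *: L w).
    by rewrite /B; clear -h1 h3 h4 h5 h6; lra.
  move: h2; rewrite rnZ rnR (ger0_norm (ltW s0)) mulrC -ler_pdivlMr// => /le_trans; apply.
  by rewrite le_eqVlt; apply/orP; left; apply/eqP; rewrite /s; field; rewrite !gt_eqF.
move=> e e0; have K1 : 0 < K + 1 by lra.
exists (Num.min (r / 4) (e / (K + 1))) => [|w]; first by rewrite lt_min !divr_gt0.
rewrite le_min => /andP[wr]; rewrite ler_pdivlMr// => we.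
apply: le_trans (TL w wr) _; have := rn_ge0 w => w0.
by rewrite expr2 mulrA ler_wpM2r//; nra.
Qed.

End Frechet.

(** * Positive operators and trace class operators *)

Notation "<| x , y |>" := (inner x y : _[i]) (at level 0, format "<| x ,  y |>").

Section Inner.
Context {R : realType} {H : hilbertType R}.
Local Notation C := R[i].
Implicit Types x y z : H.

Lemma innerDl x y z : <| x + y, z |> = <| x, z |> + <| y, z |>.
Proof. exact: linearDl. Qed.

Lemma innerDr x y z : <| z, x + y |> = <| z, x |> + <| z, y |>.
Proof. exact: linearDr. Qed.

Lemma innerBl x y z : <| x - y, z |> = <| x, z |> - <| y, z |>.
Proof. exact: linearBl. Qed.

Lemma innerBr x y z : <| z, x - y |> = <| z, x |> - <| z, y |>.
Proof. exact: linearBr. Qed.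

Lemma innerZl a x y : <| a *: x, y |> = a * <| x, y |>.
Proof. exact: linearZl_LR. Qed.

Lemma innerC x y : <| y, x |> = (<| x, y |>)^*.
Proof. by rewrite (hermC inner) expr0 mul1r. Qed.

Lemma innerZr a x y : <| x, a *: y |> = a^* * <| x, y |>.
Proof. by rewrite innerC innerZl rmorphM [in RHS](innerC y x). Qed.

Lemma inner_suml (I : Type) (r : seq I) (F : I -> H) y :
  <| \sum_(i <- r) F i, y |> = \sum_(i <- r) <| F i, y |>.
Proof. exact: linear_sumlz. Qed.

Lemma inner_sumr (I : Type) (r : seq I) (F : I -> H) y :
  <| y, \sum_(i <- r) F i |> = \sum_(i <- r) <| y, F i |>.
Proof. exact: (linear_sumr inner). Qed.

Lemma inner_self x : <| x, x |> = (rn x ^+ 2)%:C.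
Proof. by rewrite inner_norm -rnE rmorphXn. Qed.

Lemma rn_sqrB x y : rn (x - y) ^+ 2 = rn x ^+ 2 + rn y ^+ 2 - 2 * complex.Re <| x, y |>.
Proof.
have -> : rn (x - y) ^+ 2 = complex.Re <| x - y, x - y |> by rewrite inner_self.
rewrite innerBl !innerBr (innerC x y) !inner_self.
by case: (<| x, y |>) => u v /=; ring.
Qed.

Lemma conj_mul (a : C) : a^* * a = (rn (a : C^o) ^+ 2)%:C.
Proof. by rewrite rmorphXn /= rnE normCK mulrC. Qed.

Lemma cauchy_schwarz x y : rn (<| x, y |> : C^o) <= rn x * rn y.
Proof.
have [->|y0] := eqVneq y 0.
  by rewrite (_ : inner x 0 = 0) ?rn0 ?mulr0//; exact: linear0r.
have yp : 0 < rn y by rewrite rn_gt0.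
pose s := <| x, y |>; pose t := (rn y ^+ 2)^-1.
have := sqr_ge0 (rn (x - (t%:C * s) *: y)).
have cj : (t%:C * s)^* = t%:C * s^*.
  by rewrite rmorphM; congr (_ * _); apply: conj_Creal; apply/complex_realP; exists t.
rewrite rn_sqrB innerZr rnZ cj -mulrA -/s conj_mul ReZ rnM rnR.
rewrite (_ : complex.Re _ = rn (s : C^o) ^+ 2)//.
have t0 : 0 < t by rewrite invr_gt0 exprn_gt0.
rewrite (ger0_norm (ltW t0)).
have -> : (t * rn (s : C^o) * rn y) ^+ 2 = t * rn (s : C^o) ^+ 2.
  by rewrite /t; field; rewrite gt_eqF.
move=> h; have {}h : t * rn (s : C^o) ^+ 2 <= rn x ^+ 2 by lra.
rewrite -(@ler_pXn2r _ 2) ?nnegrE ?mulr_ge0 ?rn_ge0// exprMn.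
by rewrite /t mulrC ler_pdivrMr ?exprn_gt0 in h.
Qed.

End Inner.

Section BoundedOp.
Context {R : realType}.
Implicit Types U V : normedModType R[i].

Lemma bop_rn U V (f : boundedOp U V) x : rn (f x) <= opnorm f * rn x.
Proof. by rewrite -lecR rmorphM /= !rnE; exact: opnormP. Qed.

End BoundedOp.

Section PositiveOperator.
Context {R : realType} {H : hilbertType R} (P : boundedOp H H).
Hypothesis P0 : positive_op P.
Local Notation C := R[i].

Lemma positive_real x : complex.Im <| P x, x |> = 0.
Proof. exact: ger0_Im (P0 x). Qed.

(** Polarization: a complex quadratic form with real values is Hermitian. *)
Lemma positive_selfadjoint x y : <| P x, y |> = <| x, P y |>.
Proof.
rewrite [RHS]innerC.
have h1 := positive_real (x + y); have h2 := positive_real (x + 'i *: y).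
move: h1 h2; rewrite !linearD /= linearZ /= !(innerDl, innerDr, innerZl, innerZr).
have := positive_real x; have := positive_real y.
set a := <| P x, x |>; set b := <| P y, y |>; set u := <| P x, y |>; set v := <| P y, x |>.
move: a b u v => [a1 a2] [b1 b2] [u1 u2] [v1 v2] /=; simpc => /= -> -> h1 h2.
by apply/eqP; rewrite eq_complex /=; apply/andP; split; apply/eqP; lra.
Qed.

(** A consequence of the Cauchy-Schwarz inequality for the semi-inner product
    <P x, y>, obtained here by evaluating it at x - t P x with t = 1 / (|P| + 1). *)
Lemma positive_sqr x : rn (P x) ^+ 2 <= (opnorm P + 1) * complex.Re <| P x, x |>.
Proof.
have M1 : 0 < opnorm P + 1 by rewrite ltr_wpDl ?opnorm_ge0.
pose t := (opnorm P + 1)^-1; have t0 : 0 < t by rewrite invr_gt0.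
have : 0 <= complex.Re <| P (x - t%:C *: P x), x - t%:C *: P x |>.
  by have := P0 (x - t%:C *: P x); rewrite lecE /= => /andP[].
have -> : P (x - t%:C *: P x) = P x - t%:C *: P (P x) by rewrite linearB linearZ.
rewrite innerBl !innerBr !innerZl !innerZr.
have -> : (t%:C)^* = t%:C :> C by apply: conj_Creal; apply/complex_realP; exists t.
rewrite (positive_selfadjoint (P x) x) inner_self !ReB !ReZ /= => h.
have h2 : complex.Re <| P (P x), P x |> <= (opnorm P + 1) * rn (P x) ^+ 2.
  rewrite (le_trans (ler_norm _))// (le_trans (rn_Re _))// (le_trans (cauchy_schwarz _ _))//.
  have := bop_rn P (P x); have := rn_ge0 (P x); nra.
have tM : t * (opnorm P + 1) = 1 by rewrite /t mulVf// gt_eqF.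
have h3 : t * t * complex.Re <| P (P x), P x |> <= t * rn (P x) ^+ 2.
  have := ler_wpM2l (mulr_ge0 (ltW t0) (ltW t0)) h2.
  rewrite (_ : t * t * ((opnorm P + 1) * rn (P x) ^+ 2) = t * rn (P x) ^+ 2)//.
  by rewrite mulrA -(mulrA t t) tM mulr1.
have h4 : t * rn (P x) ^+ 2 <= complex.Re <| P x, x |> by lra.
by rewrite mulrC -ler_pdivrMr// mulrC.
Qed.

End PositiveOperator.

Section AbsoluteValue.
Context {R : realType} {H K : hilbertType R} (T : boundedOp H K) (P : boundedOp H H).
Hypothesis TP : is_absolute_value T P.

(** |T x|^2 = <T* T x, x> = <P^2 x, x> = |P x|^2. *)
Lemma absolute_value_rn x : rn (T x) = rn (P x).
Proof.
have [P0 [T' adj PT]] := TP.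
have E : <| T x, T x |> = <| P x, P x |>.
  rewrite adj [RHS](positive_selfadjoint P0).
  by have := congr1 (fun f : boundedOp H H => f x) PT => /= ->.
move: E; rewrite !inner_self => /complexI /eqP.
by rewrite eqrXn2 ?rn_ge0// => /eqP.
Qed.

End AbsoluteValue.

Section Orthonormal.
Context {R : realType} {H : hilbertType R}.
Local Notation C := R[i].
Implicit Type s : seq H.

Lemma orthonormal_span_sqr (B : set H) s (c : H -> C) :
  (forall e, B e -> inner e e = 1) ->
  (forall e f, B e -> B f -> e <> f -> inner e f = 0) ->
  uniq s -> [set` s] `<=` B ->
  (forall f, B f -> <| \sum_(e <- s) c e *: e, f |> = if f \in s then c f else 0) /\
  rn (\sum_(e <- s) c e *: e) ^+ 2 = \sum_(e <- s) rn (c e : C^o) ^+ 2.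
Proof.
move=> B1 B0 us sB.
have coef f : B f -> <| \sum_(e <- s) c e *: e, f |> = if f \in s then c f else 0.
  move=> Bf; rewrite inner_suml; case: ifP => fs.
    rewrite (bigD1_seq f)// innerZl (B1 f Bf) mulr1 big1_seq ?[LHS]addr0// => e /andP[ef es].
    by rewrite innerZl B0 ?mulr0//; [exact: sB | apply/eqP].
  rewrite big1_seq// => e /andP[_ es]; rewrite innerZl B0 ?mulr0//; first exact: sB.
  by move=> ef; move: fs; rewrite -ef es.
split=> //; apply/complexI; rewrite -inner_self inner_sumr.
rewrite rmorph_sum /=; apply: eq_big_seq => e es.
by rewrite innerZr coef ?es ?conj_mul//; exact: sB.
Qed.

Lemma span_uniq (B : set H) s (c : H -> C) : [set` s] `<=` B ->
  exists s' c', [/\ uniq s', [set` s'] `<=` B &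
    \sum_(e <- s) c e *: e = \sum_(e <- s') (c' e : C) *: e].
Proof.
move=> sB; exists (undup s), (fun e => c e *+ count_mem e s); split.
- exact: undup_uniq.
- by move=> e /=; rewrite mem_undup; exact: sB.
rewrite -big_undup_iterop_count; apply: eq_bigr => e _.
rewrite -scalerMnl; case: (count_mem e s) => [|n]; first by rewrite mulr0n.
by rewrite -[iterop _ _ _ _]/(_ *+ n.+1).
Qed.

End Orthonormal.

Section TraceClassApprox.
Context {R : realType}.
Local Notation C := R[i].

Lemma esum_tail (T : choiceType) (B : set T) (a : T -> R) :
  (forall x, B x -> 0 <= a x) -> (\esum_(x in B) (a x)%:E < +oo)%E ->
  forall e : R, 0 < e -> exists S : seq T, [/\ uniq S, [set` S] `<=` B &
    forall s, uniq s -> [set` s] `<=` B -> (forall x, x \in s -> x \notin S) ->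
      \sum_(x <- s) a x <= e].
Proof.
move=> a0 fin e e0.
have le_esum r : uniq r -> [set` r] `<=` B ->
    ((\sum_(x <- r) a x)%:E <= \esum_(x in B) (a x)%:E)%E.
  move=> ur rB; apply: ereal_sup_ubound; exists [set` r].
    by split=> //; exact: finite_seq.
  by rewrite -fsbig_seq// sumEFin.
have ge0 : (0 <= \esum_(x in B) (a x)%:E)%E.
  by apply: esum_ge0 => x Bx; rewrite lee_fin a0.
have fn : \esum_(x in B) (a x)%:E \is a fin_num by rewrite ge0_fin_numE.
have [_ [A [finA AB] <-]] := ub_ereal_sup_adherent e0 fn.
rewrite fsbig_finite// sumEFin -/(esum B (fun x => (a x)%:E)) => h.
exists (finmap.enum_fset (fset_set A)); split; first exact: finmap.fset_uniq.
  by move=> x /=; rewrite in_fset_set// inE; exact: AB.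
move=> s us sB sS; set S := finmap.enum_fset _ in h sS *.
have SB : [set` S] `<=` B by move=> x /=; rewrite in_fset_set// inE; exact: AB.
have : ((\sum_(x <- S ++ s) a x)%:E <= \esum_(x in B) (a x)%:E)%E.
  apply: le_esum.
    rewrite cat_uniq us andbT finmap.fset_uniq /=; apply/hasPn => x /sS; exact.
  by move=> x /=; rewrite mem_cat => /orP[/SB|/sB].
move: h; rewrite big_cat /= -(fineK fn) -EFinB lte_fin lee_fin.
by lra.
Qed.

(** Trace class operators are Hilbert-Schmidt: |T e|^2 = |P e|^2 is at most a constant
    times <P e, e>, which is summable over the basis. *)
Lemma trace_class_sqr (H K : hilbertType R) (T : boundedOp H K) : trace_class T ->
  exists B : set H, orthonormal_basis B /\
    forall e : R, 0 < e -> exists S : seq H, [/\ uniq S, [set` S] `<=` B &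
      forall s, uniq s -> [set` s] `<=` B -> (forall x, x \in s -> x \notin S) ->
        \sum_(x <- s) rn (T x) ^+ 2 <= e].
Proof.
move=> [P [B [TP onb fin]]]; exists B; split=> // e e0.
have P0 := TP.1.
have M1 : 0 < opnorm P + 1 by rewrite ltr_wpDl ?opnorm_ge0.
have a0 x : B x -> 0 <= complex.Re (inner (P x) x).
  by move=> _; have := P0 x; rewrite lecE => /andP[].
have [S [uS SB SP]] := esum_tail a0 fin (divr_gt0 e0 M1).
exists S; split=> // s us sB sS.
apply: (@le_trans _ _ (\sum_(x <- s) (opnorm P + 1) * complex.Re (inner (P x) x))).
  by apply: ler_sum => x _; rewrite (absolute_value_rn TP); exact: positive_sqr.
by rewrite -mulr_sumr mulrC -ler_pdivlMr//; exact: SP.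
Qed.

Lemma rn_sum (V : normedModType C) (I : Type) (r : seq I) (F : I -> V) :
  rn (\sum_(i <- r) F i) <= \sum_(i <- r) rn (F i).
Proof.
elim: r => [|i r IH]; first by rewrite !big_nil rn0.
by rewrite !big_cons (le_trans (rnD _ _))// lerD2l.
Qed.

(** Expand x = sum c_e e in the basis and subtract the part of T x carried by the
    finite set S. By Cauchy-Schwarz the rest, sum of c_e (T e) over e outside S, is
    at most |x| times the square root of the tail of sum |T e|^2. This is proved for
    finite combinations of basis vectors and extends to all x by density. *)
Lemma trace_class_approx_seq (H K : hilbertType R) (T : boundedOp H K) : trace_class T ->
  forall e : R, 0 < e -> exists S : seq H, forall x,
    rn (T x - \sum_(i <- S) <| x, i |> *: T i) <= e * rn x.
Proof.
move=> /trace_class_sqr[B [[B1 B0 Bd] tail]] e e0.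
have [S [uS SB SP]] := tail _ (exprn_gt0 2 e0); exists S.
have key (s : seq H) (c : H -> C) : uniq s -> [set` s] `<=` B ->
    forall x, x = \sum_(e <- s) c e *: e ->
    rn (T x - \sum_(i <- S) <| x, i |> *: T i) <= e * rn x.
  move=> us sB x xE; have [coef nrm] := orthonormal_span_sqr c B1 B0 us sB.
  have -> : T x - \sum_(i <- S) <| x, i |> *: T i =
      \sum_(i <- [seq i <- s | i \notin S]) c i *: T i.
    rewrite [in T x]xE linear_sum (bigID (mem S)) /= big_filter.
    have -> : \sum_(i <- S) <| x, i |> *: T i = \sum_(i <- s | i \in S) T (c i *: i).
      rewrite xE (eq_big_seq (fun i => if i \in s then c i *: T i else 0)); last first.
        by move=> i iS; rewrite (coef i (SB i iS)); case: ifP => // _; rewrite scale0r.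
      rewrite -big_mkcond -big_filter -[RHS]big_filter.
      rewrite (perm_big [seq i <- s | i \in S]) /=; last first.
        apply: uniq_perm; rewrite ?filter_uniq// => i.
        by rewrite !mem_filter andbC.
      by apply: eq_bigr => i _; rewrite linearZ.
    by rewrite [X in X - _]addrC addrK; apply: eq_bigr => i _; rewrite linearZ.
  have [x0|x0] := eqVneq x 0.
    have n0 : rn x = 0 by rewrite x0 rn0.
    have : \sum_(i <- s) rn (c i : C^o) ^+ 2 = 0 by rewrite -nrm -xE n0 expr0n.
    move/eqP; rewrite psumr_eq0; last by move=> i _; rewrite sqr_ge0.
    move=> /allP ci; rewrite big1_seq ?rn0 ?n0 ?mulr0// => i /andP[_].
    rewrite mem_filter => /andP[_ /ci /=]; rewrite sqrf_eq0 => /eqP/rn0_eq0 ->.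
    by rewrite scale0r.
  have xp : 0 < rn x by rewrite rn_gt0.
  set t := [seq i <- s | _]; have ut : uniq t by rewrite filter_uniq.
  have tB : [set` t] `<=` B.
    by move=> i /=; rewrite mem_filter => /andP[_]; exact: sB.
  have tS i : i \in t -> i \notin S by rewrite mem_filter => /andP[].
  have h1 := SP t ut tB tS.
  have h2 : \sum_(i <- t) rn (c i : C^o) ^+ 2 <= rn x ^+ 2.
    rewrite xE nrm big_filter [leRHS](bigID (fun i => i \notin S)) /= lerDl.
    by apply: sumr_ge0 => i _; rewrite sqr_ge0.
  (* Cauchy-Schwarz in the form u v <= (d u^2 + v^2 / d) / 2; this value of d
     balances the two sums, bounded by |x|^2 and e^2. *)
  apply: (le_trans (rn_sum _ _)); pose d := e / rn x.
  have d0 : 0 < d by rewrite divr_gt0.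
  apply: (@le_trans _ _ (\sum_(i <- t) (d / 2 * rn (c i : C^o) ^+ 2 + (d^-1 / 2) * rn (T i) ^+ 2))).
    apply: ler_sum => i _; rewrite rnZ.
    set u := rn (c i : C^o); set v := rn (T i).
    have h : 0 <= d^-1 / 2 * (d * u - v) ^+ 2.
      by rewrite mulr_ge0 ?sqr_ge0// divr_ge0// invr_ge0 ltW.
    have E : d^-1 / 2 * (d * u - v) ^+ 2 = d / 2 * u ^+ 2 + d^-1 / 2 * v ^+ 2 - u * v.
      by field; rewrite gt_eqF.
    by rewrite E in h; lra.
  rewrite big_split /= -!mulr_sumr.
  have h3 := ler_wpM2l (_ : 0 <= d / 2) h2; have h4 := ler_wpM2l (_ : 0 <= d^-1 / 2) h1.
  have {}h3 := h3 (ltW (divr_gt0 d0 (ltr0Sn R 1))).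
  have {}h4 : d^-1 / 2 * (\sum_(i <- t) rn (T i) ^+ 2) <= d^-1 / 2 * e ^+ 2.
    by apply: h4; rewrite divr_ge0// invr_ge0 ltW.
  apply: le_trans (lerD h3 h4) _.
  rewrite le_eqVlt; apply/orP; left; apply/eqP; rewrite /d; field.
  by rewrite !gt_eqF.
(* Density: G is linear and bounded, and satisfies the estimate on the span. *)
move=> x; pose G y := T y - \sum_(i <- S) <| y, i |> *: T i.
have GB y z : G (y - z) = G y - G z.
  have E : \sum_(i <- S) <| y - z, i |> *: T i =
      \sum_(i <- S) <| y, i |> *: T i - \sum_(i <- S) <| z, i |> *: T i.
    by rewrite -sumrB; apply: eq_bigr => i _; rewrite innerBl scalerBl.
  by rewrite /G E (linearB T) !opprD !opprK addrACA.
pose M := opnorm T + \sum_(i <- S) rn i * rn (T i).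
have M0 : 0 <= M.
  by rewrite addr_ge0 ?opnorm_ge0// sumr_ge0// => i _; rewrite mulr_ge0 ?rn_ge0.
have GM y : rn (G y) <= M * rn y.
  rewrite (le_trans (rnB _ _))// mulrDl lerD ?bop_rn// (le_trans (rn_sum _ _))//.
  rewrite mulr_suml; apply: ler_sum => i _; rewrite rnZ mulrAC.
  by rewrite ler_wpM2r ?rn_ge0// mulrC; exact: cauchy_schwarz.
rewrite -subr_le0; apply: (@le0_small _ _ (M + e)) => d d0.
have xcl : closure [set x | exists2 s : seq H, [set` s] `<=` B &
                exists c : H -> R[i], x = \sum_(e <- s) c e *: e] x by rewrite Bd.
have /xcl[y [[s sB [c yE]] /= yx]] : nbhs x [set y | rn (y - x) <= d].
  by apply/nbhs_rnP; exists d.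
have [s' [c' [us' s'B E]]] := span_uniq c sB.
have h1 : rn (G y) <= e * rn y.
  by apply: (key s' c' us' s'B); rewrite yE.
have h2 : rn (G x) <= rn (G y) + M * d.
  have -> : G x = G y - G (y - x) by rewrite GB subKr.
  by rewrite (le_trans (rnB _ _))// lerD2l (le_trans (GM _))// ler_wpM2l.
have h3 : rn y <= rn x + d by have := rnD (y - x) x; rewrite subrK; lra.
rewrite -/(G x); have := ler_wpM2l (ltW e0) h3; lra.
Qed.

Lemma trace_class_approx (H K : hilbertType R) (T : boundedOp H K) : trace_class T ->
  forall e : R, 0 < e -> exists (n : nat) (f : 'I_n -> H) (u : 'I_n -> K), forall x,
    rn (T x - \sum_(i < n) <| x, f i |> *: u i) <= e * rn x.
Proof.
move=> TT e /(trace_class_approx_seq TT)[S SP].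
exists (size S), (tnth (in_tuple S)), (fun i => T (tnth (in_tuple S) i)) => x.
by have := SP x; rewrite big_tnth.
Qed.

End TraceClassApprox.

(** * Invertible operators *)

Section Invertible.
Context {R : realType}.
Local Notation C := R[i].

Lemma bop_of_linear (U V : normedModType C) (f : U -> V) (M : R) : linear f ->
  (forall x, rn (f x) <= M * rn x) -> exists g : boundedOp U V, forall x, g x = f x.
Proof.
move=> lf fM; have fb : f \in @bounded_linear R U V.
  by rewrite inE; split=> //; exists M%:C => x; rewrite -!rnE -rmorphM lecR.
by exists (BoundedOp fb).
Qed.

Context {H : completeNormedModType C}.
Implicit Types (f g : H -> H).

(** Invertibility for bare functions, so that compositions need not be packaged as
    bounded operators; only the inverse is required to be bounded. *)
Definition binv f := exists S : boundedOp H H, cancel f S /\ cancel S f.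

Lemma bop_invertibleE (T : boundedOp H H) : bop_invertible T <-> binv T.
Proof.
split=> -[S [ST TS]]; exists S; split.
- by move=> x; exact: (congr1 (fun g : boundedOp H H => g x) ST).
- by move=> x; exact: (congr1 (fun g : boundedOp H H => g x) TS).
- by apply: bopP => x; exact: ST.
- by apply: bopP => x; exact: TS.
Qed.

Lemma binv_ext f g : f =1 g -> binv f -> binv g.
Proof.
move=> fg [S [fS Sf]]; exists S; split=> x; first by rewrite -fg.
by rewrite -fg.
Qed.

Lemma binv_comp f g : binv f -> binv g -> binv (f \o g).
Proof.
move=> [S [fS Sf]] [T [gT Tg]]; exists (bop_comp T S).
by split=> x /=; rewrite ?fS ?gT ?Tg ?Sf.
Qed.

Lemma binv_compr f (F : boundedOp H H) g : f =1 F -> binv f -> binv (f \o g) -> binv g.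
Proof.
move=> fF [S [fS Sf]] [T [fgT Tfg]]; exists (bop_comp T F); split=> x /=.
  by rewrite -fF; exact: fgT.
by apply: (can_inj fS); rewrite [RHS]fF; exact: Tfg.
Qed.

Definition half_contraction (s : H -> H) := linear s /\ forall x, rn (s x) <= rn x / 2.

Lemma half_contraction_inj (s : H -> H) x y : half_contraction s ->
  x + s x = y + s y -> x = y.
Proof.
move=> [ls s2] E; apply/eqP; rewrite -subr_eq0; apply/eqP/rn0_eq0.
have sB : s (x - y) = s x - s y.
  by rewrite addrC -scaleN1r ls scaleN1r addrC.
have : x - y = - s (x - y).
  by apply/eqP; rewrite -subr_eq0 opprK sB addrACA -opprD E subrr.
move=> /(congr1 (@rn R H)); rewrite rnN => h; have := s2 (x - y); have := rn_ge0 (x - y).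
by rewrite -h; lra.
Qed.

(** The partial sums of the Neumann series are the iterates of z |-> y - s z, which
    contracts by 1/2. *)
Lemma neumann (s : H -> H) : half_contraction s ->
  exists G : boundedOp H H, [/\ forall x, G (x + s x) = x,
    forall x, G x + s (G x) = x & forall x, rn (G x) <= 2 * rn x].
Proof.
move=> hs; have [ls s2] := hs.
have sB x y : s (x - y) = s x - s y.
  by rewrite addrC -scaleN1r ls scaleN1r addrC.
have surj y : exists z, z + s z = y.
  pose u n := iter n (fun z => y - s z) (0 : H).
  have du n : rn (u n.+1 - u n) <= rn y / 2 ^+ n.
    elim: n => [|n IH].
      by have s0 := sB 0 0; rewrite !subrr in s0; rewrite expr0 divr1 /u /= s0 !subr0.
    have -> : u n.+2 - u n.+1 = - s (u n.+1 - u n).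
      by rewrite sB /= opprD addrACA subrr add0r opprK addrC opprB.
    by rewrite rnN (le_trans (s2 _))// exprSr invfM mulrA ler_wpM2r.
  have [z [uz _]] := cvg_geometric (rn_ge0 y) du.
  exists z; have su : (fun n => s (u n)) @ \oo --> s z.
    apply/cvg_seqP => e e0; have [N NP] := (cvg_seqP _ _).1 uz _ e0.
    exists N => n /NP h; rewrite -sB (le_trans (s2 _))//; have := rn_ge0 (u n - z); lra.
  have yc : (fun _ : nat => y) @ \oo --> y by exact: cvg_cst.
  have h1 := cvg_seqS uz; have h2 := cvg_seqB yc su.
  by rewrite {1}(seq_uniq h1 h2) subrK.
have [g gP] := choice surj.
have gs x : g (x + s x) = x by apply: (half_contraction_inj hs); exact: gP.
have glin : linear g.
  move=> a x y; apply: (half_contraction_inj hs); rewrite gP ls addrACA -scalerDr.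
  by rewrite !gP.
have g2 x : rn (g x) <= 2 * rn x.
  have := s2 (g x); have : rn (g x) <= rn x + rn (s (g x)).
    by rewrite -[X in rn X <= _](addrK (s (g x))) gP rnB.
  lra.
have [G GE] := bop_of_linear glin g2; exists G; split => x; rewrite !GE //.
Qed.

(** The matrix of x |-> x + sum phi_i(x) w_i on coordinates: it is I + Phi W, while the
    operator itself is I + W Phi. *)
Definition fr_matrix n (phi : 'I_n -> H -> C^o) (w : 'I_n -> H) : 'M[C]_n :=
  \matrix_(i, j) ((i == j)%:R + phi i (w j)).

(** Sylvester's identity in disguise: I + W Phi and I + Phi W are invertible together.
    A kernel vector a of I + Phi W gives the kernel vector W a of I + W Phi, which is
    nonzero since Phi W a = - a. Conversely I - W (I + Phi W)^-1 Phi inverts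
    I + W Phi. *)
Lemma finite_rank_invertible n (phi : 'I_n -> H -> C^o) (w : 'I_n -> H) (M : R) :
  (forall i, linear (phi i)) -> (forall i x, rn (phi i x) <= M * rn x) ->
  binv (fun x => x + \sum_i (phi i x : C) *: w i) <-> \det (fr_matrix phi w) != 0.
Proof.
move=> lphi phiM; set f := (fun x => _); set A := fr_matrix phi w.
pose P i : {linear H -> C^o} := HB.pack (phi i) (GRing.isLinear.Build _ _ _ _ (phi i) (lphi i)).
have phisum i (a : 'cV[C]_n) : phi i (\sum_j a j 0 *: w j) = (A *m a) i 0 - a i 0.
  rewrite -[phi i]/(P i : H -> C^o) linear_sum mxE.
  rewrite [X in _ = X - _](eq_bigr (fun j => (i == j)%:R * a j 0 + P i (w j) * a j 0)); last first.
    by move=> j _; rewrite /A /fr_matrix mxE mulrDl.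
  rewrite big_split /=.
  have -> : \sum_(j < n) (i == j)%:R * a j 0 = a i 0.
    rewrite (bigD1 i)//= eqxx mul1r big1 ?addr0// => j ji.
    by rewrite eq_sym (negPf ji) mul0r.
  rewrite [X in _ = X - _]addrC addrK; apply: eq_bigr => j _.
  by rewrite /= (linear_scale _ _ (lphi i)) mulrC.
pose c x : 'cV[C]_n := \col_i phi i x.
have cE x i : c x i 0 = phi i x by rewrite mxE.
have fE x : f x = x + \sum_i c x i 0 *: w i.
  by rewrite /f; congr (_ + _); apply: eq_bigr => i _; rewrite cE.
have phiD i x y : phi i (x + y) = phi i x + phi i y.
  by rewrite -[phi i]/(P i : H -> C^o) linearD.
have phiB i x y : phi i (x - y) = phi i x - phi i y.
  by rewrite -[phi i]/(P i : H -> C^o) linearB.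
split=> [[S [fS Sf]]|detA].
  apply/negP => /eqP det0.
  have /det0P[v v0 vA] : \det A^T == 0 by rewrite det_tr det0.
  pose a := v^T; have Aa : A *m a = 0 by rewrite /a -[A]trmxK -trmx_mul vA trmx0.
  pose x := \sum_j a j 0 *: w j.
  have cx : c x = - a.
    by apply/colP => i; rewrite cE /x phisum Aa !mxE sub0r.
  have fx0 : f x = 0.
    by rewrite fE cx /x -big_split big1// => i _; rewrite /= !mxE scaleNr subrr.
  have x0 : x = 0 by rewrite -(fS x) fx0 linear0.
  move: v0; rewrite -(trmxK v) -/a; have -> : a = 0.
    rewrite -[a]opprK -cx; apply/colP => i; rewrite mxE cE x0.
    by rewrite -[phi i]/(P i : H -> C^o) linear0 !mxE oppr0.
  by rewrite trmx0 eqxx.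
pose N := invmx A; have uA : A \in unitmx by rewrite unitmxE unitfE.
pose g x := x - \sum_i (N *m c x) i 0 *: w i.
have clin (a : C) x y : c (a *: x + y) = a *: c x + c y.
  by apply/colP => i; rewrite !mxE lphi.
have glin : linear g.
  move=> a x y; rewrite /g scalerBr addrACA -opprD; congr (_ - _).
  rewrite scaler_sumr -big_split; apply: eq_bigr => i _ /=.
  by rewrite clin mulmxDr -scalemxAr !mxE scalerDl scalerA.
have gM x : rn (g x) <= (1 + \sum_i \sum_j rn (N i j : C^o) * M * rn (w i)) * rn x.
  rewrite mulrDl mul1r (le_trans (rnB _ _))// lerD2l (le_trans (rn_sum _ _))//.
  rewrite mulr_suml; apply: ler_sum => i _; rewrite rnZ mxE.
  rewrite mulr_suml (le_trans (ler_wpM2r (rn_ge0 _) (@rn_sum R C^o _ _ _)))//.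
  rewrite mulr_suml; apply: ler_sum => j _; rewrite cE rnM.
  have -> : rn (N i j : C^o) * M * rn (w i) * rn x =
      rn (N i j : C^o) * rn (w i) * (M * rn x) by ring.
  by rewrite mulrAC ler_wpM2l ?mulr_ge0 ?rn_ge0 ?phiM.
have [S SE] := bop_of_linear glin gM; exists S.
have phig i x : phi i (g x) = (N *m c x) i 0.
  rewrite /g phiB (phisum i (N *m c x)) mulmxA mulmxV// mul1mx cE.
  by rewrite opprB addrC subrK.
split=> x; rewrite SE.
  have cf : c (f x) = A *m c x.
    apply/colP => i; rewrite cE fE phiD (phisum i (c x)) cE.
    by rewrite addrC subrK.
  by rewrite /g cf mulmxA mulVmx// mul1mx fE addrK.
rewrite /f /g; rewrite -/(g x).
rewrite (eq_bigr (fun i => (N *m c x) i 0 *: w i)); last by move=> i _; rewrite phig.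
by rewrite /g subrK.
Qed.

End Invertible.

(** * Invertibility as the nonvanishing of a determinant *)

Section DifferentiableDet.
Context {R : realType} {V : normedModType R[i]}.
Local Notation C := R[i].

Lemma differentiable_prodC (I : Type) (r : seq I) (f : I -> V -> C^o) Z :
  (forall i, differentiable (f i) Z) -> differentiable (fun z => \prod_(i <- r) f i z : C^o) Z.
Proof.
move=> fd; elim: r => [|i r IH].
  rewrite (_ : (fun z => _) = cst 1); first exact: differentiable_cst.
  by apply/funext => z; rewrite big_nil.
rewrite (_ : (fun z => _) = (fun z => f i z) * (fun z => \prod_(i <- r) f i z : C^o)).
  exact: differentiableM.
by apply/funext => z; rewrite big_cons.
Qed.

Lemma differentiable_sumC (I : Type) (r : seq I) (f : I -> V -> C^o) Z :
  (forall i, differentiable (f i) Z) -> differentiable (fun z => \sum_(i <- r) f i z : C^o) Z.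
Proof.
move=> fd; elim: r => [|i r IH].
  rewrite (_ : (fun z => _) = cst 0); first exact: differentiable_cst.
  by apply/funext => z; rewrite big_nil.
rewrite (_ : (fun z => _) = (fun z => f i z) + (fun z => \sum_(i <- r) f i z : C^o)).
  exact: differentiableD.
by apply/funext => z; rewrite big_cons.
Qed.

Lemma differentiable_det n (m : 'I_n -> 'I_n -> V -> C^o) Z :
  (forall i j, differentiable (m i j) Z) ->
  differentiable (fun z => \det (\matrix_(i, j) m i j z) : C^o) Z.
Proof.
move=> md; rewrite (_ : (fun z => _) =
    (fun z => \sum_(s : 'S_n) (-1) ^+ s * \prod_(i < n) m i (s i) z : C^o)).
  apply: differentiable_sumC => s.
  have pd : differentiable (fun z => \prod_(i < n) m i (s i) z : C^o) Z.
    by apply: differentiable_prodC => i; exact: md.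
  exact: (differentiableM (differentiable_cst ((-1) ^+ s : C^o) Z) pd).
apply/funext => z; rewrite /determinant; apply: eq_bigr => s _; congr (_ * _).
by apply: eq_bigr => i _; rewrite mxE.
Qed.

Lemma differentiable_shift (W : normedModType C) (f : V -> W) (Z a : V) (c : W) :
  differentiable f (Z + a) -> differentiable (fun z => c + f (z + a)) Z.
Proof.
move=> /differentiable_fder[Llin LM fL].
apply: (@fder_differentiable _ _ _ _ _ ('d f (Z + a))); split=> // e /fL[r r0 rP].
exists r => // w /rP; rewrite opprD (addrACA c) subrr add0r.
by rewrite (addrAC Z w).
Qed.

End DifferentiableDet.

Section LocalDeterminant.
Context {R : realType} {H K : hilbertType R} {A : closedSubspace (boundedOp H K)}.
Context (T : boundedOp K H) (D : boundedOp H H).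
Local Notation C := R[i].
Implicit Types (Z W v : A) (x : H).

Definition ev Z x : K := (subspace_val Z : boundedOp H K) x.

Definition pencil Z := bop_comp T (subspace_val Z) + D.

Lemma pencilE Z x : pencil Z x = T (ev Z x) + D x.
Proof. by []. Qed.

Lemma evD Z W x : ev (Z + W) x = ev Z x + ev W x.
Proof. by []. Qed.

Lemma evB Z W x : ev (Z - W) x = ev Z x - ev W x.
Proof. by apply/eqP; rewrite eq_sym subr_eq -evD subrK. Qed.

Lemma evZ (a : C) Z x : ev (a *: Z) x = a *: ev Z x.
Proof. by []. Qed.

Lemma ev_lin Z : linear (ev Z).
Proof. exact: bop_linear. Qed.

Lemma rn_ev Z x : rn (ev Z x) <= rn Z * rn x.
Proof. exact: bop_rn. Qed.

Section Reduction.
(** B inverts the pencil at Z0, and the finite rank operator with data f, u is within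
    eps of T, with eps small compared to the radius rho of the ball under study. *)
Context (Z0 : A) (B : boundedOp H H).
Hypotheses (TB : cancel (pencil Z0) B) (BT : cancel B (pencil Z0)).
Context (n : nat) (f : 'I_n -> K) (u : 'I_n -> H) (eps rho : R).
Hypothesis approx : forall k : K, rn (T k - \sum_(i < n) <| k, f i |> *: u i) <= eps * rn k.
Hypothesis small : opnorm B * eps * rho <= 1 / 2.
Hypotheses (eps0 : 0 <= eps) (rho0 : 0 <= rho).

Let kp := opnorm B * eps.

Let kp0 : 0 <= kp. Proof. by rewrite mulr_ge0 ?opnorm_ge0. Qed.

(** The small part of B T W, after removal of the finite rank approximation of T. *)
Definition rest W x : H := B (T (ev W x) - \sum_(i < n) <| ev W x, f i |> *: u i).

Lemma rn_rest W x : rn (rest W x) <= kp * rn W * rn x.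
Proof.
rewrite /rest (le_trans (bop_rn _ _))// /kp -!mulrA ler_wpM2l ?opnorm_ge0//.
by rewrite (le_trans (approx _))// ler_wpM2l ?rn_ev.
Qed.

Lemma rest_linr W : linear (rest W).
Proof.
move=> a x y; rewrite /rest ev_lin -(linearP B); congr (B _).
rewrite (linearP T) scalerBr addrACA -opprD; congr (_ - _).
rewrite scaler_sumr -big_split; apply: eq_bigr => i _ /=.
by rewrite innerDl innerZl scalerDl scalerA.
Qed.

Lemma rest_linl x : linear (fun W => rest W x).
Proof.
move=> a W W'; rewrite /rest evD evZ -(linearP B); congr (B _).
rewrite (linearP T) scalerBr addrACA -opprD; congr (_ - _).
rewrite scaler_sumr -big_split; apply: eq_bigr => i _ /=.
by rewrite innerDl innerZl scalerDl scalerA.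
Qed.

Lemma rest_contraction W : rn W <= rho -> half_contraction (rest W).
Proof.
move=> Wr; split=> [|x]; first exact: rest_linr.
rewrite (le_trans (rn_rest _ _))// mulrC ler_wpM2l ?rn_ge0//.
by have := ler_wpM2l kp0 Wr; move: small; rewrite -/kp; lra.
Qed.

Lemma resolvent_exists : exists G : A -> boundedOp H H, forall W, rn W <= rho ->
  [/\ forall x, G W (x + rest W x) = x, forall x, G W x + rest W (G W x) = x &
      forall x, rn (G W x) <= 2 * rn x].
Proof.
have h W : exists G : boundedOp H H, rn W <= rho ->
    [/\ forall x, G (x + rest W x) = x, forall x, G x + rest W (G x) = x &
      forall x, rn (G x) <= 2 * rn x].
  have [Wr|Wr] := boolP (rn W <= rho); last by exists 0.
  by have [G GP] := neumann (rest_contraction Wr); exists G.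
by have [G GP] := choice h; exists G.
Qed.

Context (G : A -> boundedOp H H).
Hypothesis GP : forall W, rn W <= rho ->
  [/\ forall x, G W (x + rest W x) = x, forall x, G W x + rest W (G W x) = x &
      forall x, rn (G W x) <= 2 * rn x].

(** The entries of Phi W for the finite rank factor: phi_i = <W x, f_i> and
    w_j = G(W) B u_j. *)
Definition entry (i j : 'I_n) W : C^o := <| ev W (G W (B (u j))), f i |>.

Lemma pencil_factor Z x : pencil Z x = pencil Z0 (x + B (T (ev (Z - Z0) x))).
Proof.
set y := T (ev (Z - Z0) x).
have -> : pencil Z0 (x + B y) = pencil Z0 x + pencil Z0 (B y) by exact: linearD.
rewrite BT !pencilE /y evB.
have -> : T (ev Z x - ev Z0 x) = T (ev Z x) - T (ev Z0 x) by exact: linearB.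
by rewrite [RHS]addrC addrA subrK.
Qed.

(** Up to the invertible factors P(Z0) and I + rest(W), with W = Z - Z0, the pencil is
    the finite rank perturbation I + sum phi_i G(W) B u_i, as (I + rest(W)) G(W) = I. *)
Lemma pencil_det Z : rn (Z - Z0) <= rho ->
  bop_invertible (pencil Z) <->
  \det (\matrix_(i, j) ((i == j)%:R + entry i j (Z - Z0))) != 0.
Proof.
move=> Wr; set W := Z - Z0 in Wr *; have [G1 G2 G3] := GP Wr.
pose phi i x : C^o := <| ev W x, f i |>; pose w i := G W (B (u i)).
have -> : (\matrix_(i, j) ((i == j)%:R + entry i j W)) = fr_matrix phi w.
  by apply/matrixP => i j; rewrite !mxE.
have lphi i : linear (phi i).
  by move=> a x y; rewrite /phi ev_lin innerDl innerZl.
have phiM i x : rn (phi i x) <= rn W * (\sum_i rn (f i)) * rn x.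
  rewrite /phi (le_trans (cauchy_schwarz _ _))// mulrAC.
  apply: ler_pM; rewrite ?rn_ge0 ?rn_ev//.
  by rewrite (bigD1 i)//= lerDl sumr_ge0// => j _; rewrite rn_ge0.
rewrite -(finite_rank_invertible _ lphi phiM) bop_invertibleE.
have rl := rest_linr W.
have Ilin : linear (fun x => x + rest W x).
  by move=> a x y; rewrite rl addrACA scalerDr.
have [|F FE] := @bop_of_linear R H H (fun x => x + rest W x) (3 / 2) Ilin.
  move=> x; rewrite (le_trans (rnD _ _))//.
  by have [_ h] := rest_contraction Wr; have := h x; lra.
have Ginv : binv (fun x => x + rest W x) by exists (G W).
have bT : binv (pencil Z0) by exists B.
pose g x := x + \sum_i phi i x *: w i.
have fE : pencil Z =1 (pencil Z0 : H -> H) \o ((fun x => x + rest W x) \o g).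
  move=> x; rewrite pencil_factor /=; congr (pencil Z0 _).
  have -> : rest W (g x) = rest W x + \sum_i phi i x *: rest W (w i).
    pose r : {linear H -> H} := HB.pack (rest W) (GRing.isLinear.Build _ _ _ _ (rest W) rl).
    rewrite -[rest W]/(r : H -> H) /g linearD linear_sum; congr (_ + _).
    by apply: eq_bigr => i _; rewrite linearZ.
  rewrite /g addrACA -big_split /=.
  rewrite (eq_bigr (fun i => phi i x *: B (u i))); last first.
    by move=> i _; rewrite -scalerDr G2.
  have rE : rest W x + \sum_i phi i x *: B (u i) = B (T (ev W x)).
    have -> : \sum_i phi i x *: B (u i) = B (\sum_i phi i x *: u i).
      by rewrite (linear_sum B); apply: eq_bigr => i _; rewrite linearZ.
    by rewrite /rest -(linearD B) subrK.
  by rewrite -addrA rE.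
split=> h.
  have h1 : binv ((fun x => x + rest W x) \o g).
    have fF x : pencil Z0 x = pencil Z0 x by [].
    exact: (binv_compr fF bT (binv_ext fE h)).
  exact: (binv_compr (F := F) (fun x => esym (FE x)) Ginv h1).
apply: (binv_ext (f := (pencil Z0 : H -> H) \o ((fun x => x + rest W x) \o g))).
  by move=> x; rewrite fE.
by apply: binv_comp => //; exact: binv_comp.
Qed.

(** The resolvent G(W) of I + rest(W) satisfies
    G(W + v) - G(W) = - G(W) rest(v) G(W + v), hence its derivative in the direction v
    is - G(W) rest(v) G(W); with the factor W outside, the product rule gives L. *)
Lemma entry_fder i j W (d : R) : 0 < d -> (forall v, rn v <= d -> rn (W + v) <= rho) ->
  differentiable (entry i j) W.
Proof.
move=> d0 Wd; have Wr : rn W <= rho by have := Wd 0; rewrite addr0 rn0; apply; exact: ltW.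
set b := B (u j); set e := f i; have [G1 G2 G3] := GP Wr; set x := G W b.
pose L v : C^o := <| ev v x, e |> - <| ev W (G W (rest v x)), e |>.
have rlx := rest_linl x.
have Llin : linear L.
  move=> a v v'; rewrite /L rlx (linearP (G W)) ev_lin evD evZ !innerDl !innerZl.
  by rewrite scalerBr opprD addrACA.
pose k1 := 4 * kp * rn b.
have k10 : 0 <= k1 := mulr_ge0 (mulr_ge0 (ler0n _ 4) kp0) (rn_ge0 _).
pose Q := (rho * (2 * (kp * k1)) + k1) * rn e.
have Q0 : 0 <= Q.
  apply: mulr_ge0 (rn_ge0 _); apply: addr_ge0 => //; apply: mulr_ge0 => //.
  exact: mulr_ge0 (ler0n _ 2) (mulr_ge0 kp0 k10).
apply: (@fder_differentiable _ _ _ _ _ L); split=> //.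
  exists ((rn x + rho * (2 * (kp * rn x))) * rn e) => v.
  rewrite /L (le_trans (rnB _ _))// mulrDl mulrDl lerD//.
    rewrite (le_trans (cauchy_schwarz _ _))// mulrAC ler_wpM2r ?rn_ge0//.
    by rewrite mulrC rn_ev.
  rewrite (le_trans (cauchy_schwarz _ _))// mulrAC ler_wpM2r ?rn_ge0//.
  have h1 : rn (G W (rest v x)) <= 2 * (kp * rn v * rn x).
    by rewrite (le_trans (G3 _))// ler_wpM2l// rn_rest.
  rewrite (le_trans (rn_ev _ _))//.
  have -> : rho * (2 * (kp * rn x)) * rn v = rho * (2 * (kp * rn v * rn x)) by ring.
  by apply: ler_pM; rewrite ?rn_ge0.
(* x' is G(W + v) b; x' - x is of first order in v, and x' - x + G(W) rest(v) x of
   second order. *)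
have main v : rn v <= d -> rn (entry i j (W + v) - entry i j W - L v) <= Q * rn v ^+ 2.
  move=> vd; have [G1' G2' G3'] := GP (Wd v vd); set x' := G (W + v) b.
  have restD y : rest (W + v) y = rest W y + rest v y.
    by have := rest_linl y 1 W v; rewrite !scale1r.
  have restB y y' : rest W (y - y') = rest W y - rest W y'.
    by rewrite addrC -scaleN1r rest_linr scaleN1r addrC.
  have restvB y y' : rest v (y - y') = rest v y - rest v y'.
    by rewrite addrC -scaleN1r rest_linr scaleN1r addrC.
  have xe : x + rest W x = b by exact: G2.
  have xe' : x' + rest W x' + rest v x' = b.
    by rewrite -addrA -restD; exact: G2'.
  have dE : x' - x = - G W (rest v x').
    have -> : - G W (rest v x') = G W (- rest v x') by rewrite linearN.
    rewrite -[LHS]G1 restB addrACA -opprD xe; congr (G W _).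
    by rewrite -xe' opprD addrA subrr sub0r.
  have dE2 : x' - x + G W (rest v x) = - G W (rest v (x' - x)).
    have -> : G W (rest v (x' - x)) = G W (rest v x') - G W (rest v x).
      by rewrite restvB linearB.
    by rewrite dE addrC opprB.
  have rx' : rn x' <= 2 * rn b by exact: G3'.
  have rv : rn (x' - x) <= k1 * rn v.
    rewrite dE rnN (le_trans (G3 _))// /k1.
    have h := rn_rest v x'; have h2 := ler_wpM2l (mulr_ge0 kp0 (rn_ge0 v)) rx'.
    by lra.
  have rv2 : rn (x' - x + G W (rest v x)) <= 2 * (kp * k1) * rn v ^+ 2.
    rewrite dE2 rnN (le_trans (G3 _))//.
    have h := rn_rest v (x' - x); have h2 := ler_wpM2l (mulr_ge0 kp0 (rn_ge0 v)) rv.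
    by lra.
  have -> : entry i j (W + v) - entry i j W - L v =
      <| ev W (x' - x + G W (rest v x)), e |> + <| ev v (x' - x), e |>.
    have evBr Y y y' : ev Y (y - y') = ev Y y - ev Y y'
      by exact: (linearB (subspace_val Y : boundedOp H K)).
    have evDr Y y y' : ev Y (y + y') = ev Y y + ev Y y'
      by exact: (linearD (subspace_val Y : boundedOp H K)).
    rewrite /entry /L -/b -/e -/x -/x' evD evDr !evBr !(innerBl, innerDl) /=.
    by ring.
  rewrite (le_trans (rnD _ _))// /Q.
  have h1 := le_trans (cauchy_schwarz (ev W (x' - x + G W (rest v x))) e)
    (ler_wpM2r (rn_ge0 e) (rn_ev _ _)).
  have h2 := le_trans (cauchy_schwarz (ev v (x' - x)) e)
    (ler_wpM2r (rn_ge0 e) (rn_ev _ _)).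
  have h3 : rn W * rn (x' - x + G W (rest v x)) <= rho * (2 * (kp * k1) * rn v ^+ 2).
    by apply: ler_pM; rewrite ?rn_ge0.
  have h4 : rn v * rn (x' - x) <= rn v * (k1 * rn v) by rewrite ler_wpM2l ?rn_ge0.
  have h5 := ler_wpM2r (rn_ge0 e) h3; have h6 := ler_wpM2r (rn_ge0 e) h4.
  apply: le_trans (lerD h1 h2) _; apply: le_trans (lerD h5 h6) _.
  by rewrite le_eqVlt; apply/orP; left; apply/eqP; ring.
move=> e' e'0; have Q1 : 0 < Q + 1 by rewrite ltr_wpDl.
exists (Num.min d (e' / (Q + 1))) => [|v]; first by rewrite lt_min d0 divr_gt0.
rewrite le_min => /andP[vd]; rewrite ler_pdivlMr// => ve.
apply: le_trans (main v vd) _; have v0 := rn_ge0 v.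
by rewrite expr2 mulrA ler_wpM2r//; nra.
Qed.

End Reduction.

(** The radius r is arbitrary: the accuracy eps of the finite rank approximation is
    chosen after the ball, so the ball may reach Z0 from Z1. *)
Lemma local_determinant (Z0 : A) : bop_invertible (pencil Z0) -> trace_class T ->
  forall (Z1 : A) (r : R), 0 < r -> exists g : A -> C^o,
    (forall Z, rn (Z - Z1) < r -> differentiable g Z) /\
    (forall Z, rn (Z - Z1) < r -> (bop_invertible (pencil Z) <-> g Z != 0)).
Proof.
move=> /bop_invertibleE[B [TB BT]] tc Z1 r r0.
(* The ball of radius rho about Z0 contains the ball of radius r about Z1. *)
pose rho := r + rn (Z1 - Z0).
have rho0 : 0 < rho by rewrite ltr_pwDl ?rn_ge0.
have den : 0 < 2 * (opnorm B + 1) * rho by rewrite !mulr_gt0// ltr_wpDl ?opnorm_ge0.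
have eps0 : 0 < (2 * (opnorm B + 1) * rho)^-1 by rewrite invr_gt0.
have [n [f [u approx]]] := trace_class_approx tc eps0.
have small : opnorm B * (2 * (opnorm B + 1) * rho)^-1 * rho <= 1 / 2.
  rewrite mulrAC ler_pdivrMr//; have := opnorm_ge0 B => B0.
  by nra.
have [G GP] := resolvent_exists approx small (ltW eps0).
pose g (Z : A) : C^o := \det (\matrix_(i, j) ((i == j)%:R + entry B f u G i j (Z - Z0))).
have inr Z : rn (Z - Z1) < r -> rn (Z - Z0) < rho.
  by move=> h; rewrite (le_lt_trans (rn_tri Z1 _ _))// ltrD2r.
exists g; split=> Z /inr Zr; last exact: (pencil_det TB BT approx small (ltW eps0) GP (ltW Zr)).
pose d := rho - rn (Z - Z0); have d0 : 0 < d by rewrite subr_gt0.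
have inW v : rn v <= d -> rn (Z - Z0 + v) <= rho.
  by move=> vd; rewrite (le_trans (rnD _ _))// addrC -lerBrDr.
apply: (@differentiable_det _ _ _ (fun i j Z => (i == j)%:R + entry B f u G i j (Z - Z0))) => i j.
have entd := entry_fder approx (ltW eps0) (ltW rho0) GP i j d0 inW.
exact: (differentiable_shift _ entd).
Qed.

End LocalDeterminant.

(** * Extension across the singular set *)

Section Extension.
Context {R : realType} {V : normedModType R[i]} {X : completeNormedModType R[i]}.
Local Notation C := R[i].
Implicit Types (Z Y v w : V) (h : V -> X).
(** What follows uses only that, on every ball, DD is the set where some holomorphic
    function does not vanish, and that DD is not empty. *)
Context (DD : set V) (Z0 : V).
Hypothesis DZ0 : DD Z0.
Hypothesis local_equation : forall Z1 (r : R), 0 < r -> exists g : V -> C^o,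
  (forall Z, rn (Z - Z1) < r -> differentiable g Z) /\
  (forall Z, rn (Z - Z1) < r -> (DD Z <-> g Z != 0)).

Lemma open_near Z : DD Z -> exists2 d : R, 0 < d & forall Y, rn (Y - Z) <= d -> DD Y.
Proof.
move=> DZ; have [g [gd gE]] := local_equation Z ltr01.
have Z1 : rn (Z - Z) < 1 by rewrite subrr rn0.
have gZ : 0 < rn (g Z) by rewrite rn_gt0; exact: (gE Z Z1).1.
have /continuous_rnP gc := differentiable_continuous (gd Z Z1).
have [d d0 dP] := gc _ (divr_gt0 gZ (ltr0Sn R 1)).
exists (Num.min d (1 / 2)) => [|Y]; first by rewrite lt_min d0; lra.
rewrite le_min => /andP[/dP gY Y2]; apply/gE; first by lra.
by apply/eqP => gY0; move: gY; rewrite gY0 sub0r rnN; lra.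
Qed.

Lemma open_disc (Z : V) (r : R) : open [set Y | rn (Y - Z) < r].
Proof.
rewrite openE => Y /= Yr; apply/nbhs_rnP; exists ((r - rn (Y - Z)) / 2); first by lra.
by move=> w wY; have := rn_tri Y w Z; rewrite /=; lra.
Qed.

Lemma analytic_complement : analytic_set (~` DD).
Proof.
move=> Z; have [g [gd gE]] := local_equation Z ltr01.
exists [set Y | rn (Y - Z) < 1]; split.
- exact: open_disc.
- by rewrite /= subrr rn0.
exists 1%N, (fun=> g); split; first by move=> _ Y; exact: gd.
apply/seteqP; split=> Y /= [].
  move=> nD Y1; split=> // _; apply: contrapT => /eqP gY.
  by apply: nD; apply/gE.
move=> Y1 gY; split=> //; move/(gE Y Y1).1; rewrite (gY ord0) eqxx.
exact: notF.
Qed.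

(** Along a complex line through a point of DD, the local equation is a holomorphic
    function of one variable that is nonzero at the origin. *)
Lemma finite_bad Y w : DD Y -> exists s : seq C,
  (forall mu : C^o, rn mu <= 2 -> (mu : C) \notin s -> DD (Y + mu *: w)) /\
  (forall mu : C^o, (mu : C) \in s -> ~ DD (Y + mu *: w)).
Proof.
(* Zeros are controlled in the disc of radius 1/8 for functions on the disc of
   radius 2; scaling the direction by 16 turns 1/8 into 2. *)
move=> DY; have r0 : 0 < 32 * rn w + 1 by rewrite ltr_wpDl ?mulr_ge0 ?rn_ge0.
have [g [gd gE]] := local_equation Y r0.
have r16 : rn (16 : C^o) = 16.
  have -> : 16 = (16 : R)%:C :> C by rewrite rmorphMn.
  by rewrite rnR ger0_norm.
have inr (z : C^o) : rn z < 2 -> rn (Y + z *: ((16 : C) *: w) - Y) < 32 * rn w + 1.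
  move=> z2; rewrite addrC addKr !rnZ r16.
  have := ler_wpM2r (rn_ge0 w) (ltW z2); lra.
pose phi (z : C^o) : cplane R := g (Y + z *: ((16 : C) *: w)).
have [||s sP] := @zeros_finite R phi.
- by move=> z z2; apply: line_cdiff; apply: gd; exact: inr.
- by rewrite /phi scale0r addr0; apply/eqP; apply/gE => //; rewrite subrr rn0.
exists [seq mu <- [seq 16 * z | z <- s] | `[< ~ DD (Y + mu *: w) >]]; split.
  move=> mu mu2; apply: contraNP => nD; rewrite mem_filter; apply/andP; split.
    exact/asboolP.
  have E : mu = 16 * (mu / 16) :> C by field.
  rewrite E; apply: map_f; apply: sP.
    by rewrite rnM rnV r16; lra.
  have muE : (mu / 16 : C) *: ((16 : C) *: w) = mu *: w.
    by rewrite scalerA; congr (_ *: _); field.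
  rewrite /phi muE; apply: contrapT => /eqP gn; apply: nD.
  apply/gE => //; rewrite -muE; apply: inr.
  by rewrite rnM rnV r16; lra.
by move=> mu; rewrite mem_filter => /andP[/asboolP].
Qed.

(** The line from Z0 through Z1 meets the complement of DD in finitely many points
    near Z1, so a short enough multiple of Z0 - Z1 avoids them all except Z1. *)
Lemma good_direction Z1 : ~ DD Z1 -> forall eta : R, 0 < eta -> exists v,
  rn v <= eta /\ forall mu : C^o, 0 < rn mu <= 2 -> DD (Z1 + mu *: v).
Proof.
move=> nD eta eta0; have [s [sD sN]] := finite_bad (Z1 - Z0) DZ0.
(* On the line Z0 + nu (Z1 - Z0), the point Z1 has parameter 1. *)
have a1 : (1 : C) \notin [seq x <- s | x != 1] by rewrite mem_filter eqxx.
have [r r0 rP] := seq_away a1.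
pose v0 := Z0 - Z1; have v1 : 0 < rn v0 + 1 by rewrite ltr_wpDl ?rn_ge0.
pose t := Num.min (Num.min r 1 / 2) (eta / (rn v0 + 1)).
have t0 : 0 < t by rewrite !lt_min !divr_gt0// lt_min r0 ltr01.
have tr : t * 2 <= r.
  have : t <= Num.min r 1 / 2 by rewrite ge_min lexx.
  have : Num.min r 1 <= r by rewrite ge_min lexx.
  lra.
have t1 : t * 2 <= 1.
  have : t <= Num.min r 1 / 2 by rewrite ge_min lexx.
  have : Num.min r 1 <= 1 by rewrite ge_min lexx orbT.
  lra.
have te : t * (rn v0 + 1) <= eta by rewrite -ler_pdivlMr// ge_min lexx orbT.
exists (t%:C *: v0); split.
  by rewrite rnZ rnR (ger0_norm (ltW t0)); have := rn_ge0 v0; lra.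
move=> mu /andP[mu0 mu2]; pose nu : C^o := mu * t%:C.
have nuE : rn nu = rn mu * t by rewrite rnM rnR (ger0_norm (ltW t0)).
have nu0 : 0 < rn nu by rewrite nuE mulr_gt0.
have nun : nu != 0 by rewrite -rn_gt0.
have nut : rn nu <= t * 2 by rewrite nuE mulrC ler_wpM2l// ltW.
have -> : Z1 + mu *: (t%:C *: v0) = Z0 + (1 - nu) *: (Z1 - Z0).
  rewrite scalerA -/nu scalerBl scale1r addrA (addrC Z0) subrK.
  by rewrite -scalerN opprB.
apply: sD.
  have := rnB (1 : C^o) nu; rewrite rn1; lra.
apply/negP => bad; have : (1 - nu : C) \in [seq x <- s | x != 1].
  by rewrite mem_filter bad andbT -subr_eq0 addrC addKr oppr_eq0.
by move=> /rP; rewrite addrC addKr rnN; lra.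
Qed.

Lemma dense_near Z1 (e : R) : 0 < e -> exists2 Y, DD Y & rn (Y - Z1) <= e.
Proof.
move=> e0; have [D1|/good_direction/(_ _ e0)[v [ve vD]]] := pselect (DD Z1).
  by exists Z1 => //; rewrite subrr rn0 ltW.
exists (Z1 + (1 : C) *: v); last by rewrite addrC addKr scale1r.
by apply: vD; rewrite rn1; lra.
Qed.

(** The contour is compact and DD is open. *)
Lemma diamond_tube Z1 v : (forall mu : C^o, diamond mu -> DD (Z1 + mu *: v)) ->
  exists2 d : R, 0 < d & forall Z, rn (Z - Z1) <= d ->
    forall mu : C^o, diamond mu -> DD (Z + mu *: v).
Proof.
move=> good; have v1 : 0 < rn v + 1 by rewrite ltr_wpDl ?rn_ge0.
have edgeP k : (k < 4)%N ->
    \forall Z \near Z1, forall mu : C^o, edge k mu -> DD (Z + mu *: v).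
  move=> k4; apply: (@seg_tube R V (nbhs Z1) _ (fun Z mu => DD (Z + mu *: v))) => x kx.
  have [|d d0 dP] := @open_near (Z1 + x *: v); first by apply: good; exists k.
  exists (d / 2 / (rn v + 1)); first by rewrite !divr_gt0.
  apply/nbhs_rnP; exists (d / 2); first by rewrite divr_gt0.
  move=> Z Zd y; rewrite ler_pdivlMr// => yx; apply: dP.
  rewrite opprD addrACA -scalerBl (le_trans (rnD _ _))// rnZ.
  by have := rn_ge0 (y - x : C^o); lra.
have /nbhs_rnP[d d0 dP] : \forall Z \near Z1, forall mu : C^o, diamond mu -> DD (Z + mu *: v).
  have e0 := edgeP 0%N isT; have e1 := edgeP 1%N isT.
  have e2 := edgeP 2%N isT; have e3 := edgeP 3%N isT.
  near=> Z => mu [[|[|[|[|//]]]] _]; [move: mu; near: Z; exact: e0 | move: mu; near: Z; exact: e1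
    | move: mu; near: Z; exact: e2 | move: mu; near: Z; exact: e3].
by exists d.
Unshelve. all: by end_near. Qed.

(** The factor is written with w - 0 so that this is convertible to the Cauchy
    kernel at 0 of the function w |-> h (Z + w v). *)
Definition loop_integrand h v Z : C^o -> X :=
  fun w : C^o => (w - 0)^-1 *: h (Z + w *: v).

(** This is h Z, by Cauchy's formula, when h is holomorphic on the disc of center Z
    in the direction v. *)
Definition loop_mean h v Z : X := winding^-1 *: oint (loop_integrand h v Z).

(** Riemann sums of [loop_mean]: finite combinations of translates of h, hence
    differentiable in Z. *)
Definition loop_sum h v n Z : X := winding^-1 *: \sum_(k < 4)
  (vtx k.+1 - vtx k : C) *: dsum n (loop_integrand h v Z) (vtx k) (vtx k.+1).

Lemma dsum_differentiable n (G : V -> C^o -> X) a b Z :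
  (forall x, seg a b x -> differentiable (G^~ x) Z) ->
  differentiable (fun z => dsum n (G z) a b) Z.
Proof.
elim: n a b => [|n IH] a b Gd; first by apply: Gd; exact: seg_l.
have h1 := IH _ _ (fun x xs => Gd x (seg_ml xs)).
have h2 := IH _ _ (fun x xs => Gd x (seg_mr xs)).
exact: (differentiableZ (2^-1) (differentiableD h1 h2)).
Qed.

Lemma loop_sum_differentiable h v n Z :
  (forall mu : C^o, diamond mu -> differentiable h (Z + mu *: v)) ->
  differentiable (loop_sum h v n) Z.
Proof.
move=> hd; have kd k : (k < 4)%N -> differentiable (fun z =>
    (vtx k.+1 - vtx k : C) *: dsum n (loop_integrand h v z) (vtx k) (vtx k.+1)) Z.
  move=> k4; apply: (differentiableZ (vtx k.+1 - vtx k : C)); apply: dsum_differentiable => x kx.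
  apply: (differentiableZ ((x - 0)^-1 : C)).
  have := @differentiable_shift R V X h Z (x *: v) 0 (hd x _).
  have -> : (fun z => 0 + h (z + x *: v)) = (fun z => h (z + x *: v)).
    by apply/funext => z; rewrite add0r.
  by apply; exists k.
have -> : loop_sum h v n = (fun z => winding^-1 *:
    ((vtx 1 - vtx 0 : C) *: dsum n (loop_integrand h v z) (vtx 0) (vtx 1) +
    ((vtx 2 - vtx 1 : C) *: dsum n (loop_integrand h v z) (vtx 1) (vtx 2) +
    ((vtx 3 - vtx 2 : C) *: dsum n (loop_integrand h v z) (vtx 2) (vtx 3) +
    (vtx 4 - vtx 3 : C) *: dsum n (loop_integrand h v z) (vtx 3) (vtx 4))))).
  by apply/funext => z; rewrite /loop_sum !big_ord_recl big_ord0 addr0.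
apply: differentiableZ; apply: (differentiableD (kd 0%N isT)).
apply: (differentiableD (kd 1%N isT)).
exact: (differentiableD (kd 2%N isT) (kd 3%N isT)).
Qed.

Lemma loop_integrand_cts h v Z (mu : C^o) : diamond mu -> differentiable h (Z + mu *: v) ->
  {for mu, continuous (loop_integrand h v Z)}.
Proof.
move=> [k k4 kmu] hd; apply: ctsZ.
  by apply: (@ctsV R _ (fun w : C^o => w - 0));
    [rewrite subr0; exact: edge_neq0 kmu | exact: cts_sub].
by apply: cdiff_cts; exact: line_cdiff.
Qed.

Lemma loop_sum_cvg h v Z :
  (forall mu : C^o, diamond mu -> differentiable h (Z + mu *: v)) ->
  (fun n => loop_sum h v n Z) @ \oo --> loop_mean h v Z.
Proof.
move=> hd; apply: cvg_seqZ.
have kc k : (k < 4)%N -> (fun n => (vtx k.+1 - vtx k : C) *: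
    dsum n (loop_integrand h v Z) (vtx k) (vtx k.+1)) @ \oo -->
    dint (loop_integrand h v Z) (vtx k) (vtx k.+1).
  move=> k4; apply: dint_cvg => x kx; have xD : diamond x by exists k.
  by apply: loop_integrand_cts => //; exact: hd.
rewrite /oint !big_ord_recl big_ord0 addr0.
have -> : (fun n => \sum_(k < 4) (vtx k.+1 - vtx k : C) *:
     dsum n (loop_integrand h v Z) (vtx k) (vtx k.+1)) = (fun n =>
    ((vtx 1 - vtx 0 : C) *: dsum n (loop_integrand h v Z) (vtx 0) (vtx 1) +
    ((vtx 2 - vtx 1 : C) *: dsum n (loop_integrand h v Z) (vtx 1) (vtx 2) +
    ((vtx 3 - vtx 2 : C) *: dsum n (loop_integrand h v Z) (vtx 2) (vtx 3) +
    (vtx 4 - vtx 3 : C) *: dsum n (loop_integrand h v Z) (vtx 3) (vtx 4))))).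
  by apply/funext => n; rewrite !big_ord_recl big_ord0 addr0.
apply: (cvg_seqD (kc 0%N isT)); apply: (cvg_seqD (kc 1%N isT)).
exact: (cvg_seqD (kc 2%N isT) (kc 3%N isT)).
Qed.

Lemma loop_sum_bound h v n Z (M : R) :
  (forall mu : C^o, diamond mu -> rn (h (Z + mu *: v)) <= M) ->
  rn (loop_sum h v n Z) <= @winding_inv_norm R * (4 * (2 * (2 * M))).
Proof.
move=> hM; rewrite rnZ ler_wpM2l ?rn_ge0// (le_trans (rn_sum _ _))//.
have -> : 4 * (2 * (2 * M)) = \sum_(k < 4) 2 * (2 * M).
  by rewrite sumr_const card_ord mulr_natl.
apply: ler_sum => -[k k4] _ /=; rewrite rnZ.
apply: ler_pM; rewrite ?rn_ge0 ?edge_len//; apply: dsum_bound => x kx.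
have xD : diamond x by exists k.
rewrite rnZ; apply: ler_pM; rewrite ?rn_ge0 ?hM// subr0 rnV.
have := edge_lower kx => x2; rewrite -(invrK 2) lef_pV2 ?posrE ?invr_gt0//; lra.
Qed.

(** The mean over the contour is taken in a direction in which the contour stays in
    DD for all Z near Z1. For Z in DD, the one-variable function in that direction
    is bounded with finitely many singularities, none at 0 or on the contour, so the
    mean reproduces its value at 0. *)
Lemma local_extension h Z1 (eta M : R) : ~ DD Z1 -> 0 < eta ->
  (forall Z, rn (Z - Z1) < eta -> DD Z -> differentiable h Z /\ rn (h Z) <= M) ->
  exists (d : R) (hh : V -> X), 0 < d /\
    forall Z, rn (Z - Z1) <= d -> differentiable hh Z /\ (DD Z -> hh Z = h Z).
Proof.
move=> nD eta0 hP; have e8 : 0 < eta / 8 by rewrite divr_gt0.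
have [v [v8 vD]] := good_direction nD e8.
have dD mu : diamond mu -> DD (Z1 + mu *: v).
  move=> [k k4 kmu]; apply: vD; have := edge_lower kmu; have := edge_upper kmu; lra.
have [d d0 dP] := diamond_tube dD.
(* Half of the admissible radius, so that the disc of radius r about each point
   considered is still admissible, as [pointwise_limit] requires. *)
pose r := Num.min d (eta / 4) / 2.
have r0 : 0 < r by rewrite divr_gt0// lt_min d0 divr_gt0.
have rd : 2 * r <= d.
  by have : Num.min d (eta / 4) <= d by [rewrite ge_min lexx]; rewrite /r; lra.
have re : 2 * r <= eta / 4.
  by have : Num.min d (eta / 4) <= eta / 4 by [rewrite ge_min lexx orbT]; rewrite /r; lra.
have inb Z (mu : C^o) : rn (Z - Z1) <= 2 * r -> rn mu <= 2 -> rn (Z + mu *: v - Z1) < eta.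
  move=> Zr mu2; have -> : Z + mu *: v - Z1 = (Z - Z1) + mu *: v by rewrite addrAC.
  rewrite (le_lt_trans (rnD _ _))// rnZ.
  have := ler_pM (rn_ge0 mu) (rn_ge0 v) mu2 v8; lra.
have good Z (mu : C^o) : rn (Z - Z1) <= 2 * r -> diamond mu ->
    differentiable h (Z + mu *: v) /\ rn (h (Z + mu *: v)) <= M.
  move=> Zr muD; apply: hP; last by apply: dP => //; exact: le_trans Zr rd.
  by apply: inb => //; have [k k4 /edge_upper] := muD; lra.
exists r, (loop_mean h v); split=> // Z Zr; split.
  apply: (@pointwise_limit R V X (loop_sum h v) (loop_mean h v) Z r
      (@winding_inv_norm R * (4 * (2 * (2 * M))))) => //.
    move=> n Y Yr; have Yr2 : rn (Y - Z1) <= 2 * r.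
      by have := rn_tri Z Y Z1; lra.
    split; first by apply: loop_sum_differentiable => mu muD; exact: (good Y mu Yr2 muD).1.
    by apply: loop_sum_bound => mu muD; exact: (good Y mu Yr2 muD).2.
  move=> Y Yr; have Yr2 : rn (Y - Z1) <= 2 * r.
    by have := rn_tri Z Y Z1; lra.
  by apply: loop_sum_cvg => mu muD; exact: (good Y mu Yr2 muD).1.
move=> DZ; have Zr2 : rn (Z - Z1) <= 2 * r by lra.
have [s [sD sN]] := finite_bad v DZ.
have E : cauchy_transform (fun w : C^o => h (Z + w *: v)) 0 = winding *: h (Z + (0 : C) *: v).
  apply: (@cauchy_removable R X s (fun w : C^o => h (Z + w *: v)) M).
  - move=> w w2 ws; have Dw : DD (Z + w *: v) by apply: sD => //; lra.
    have [|hd hM] := hP _ _ Dw; first by apply: inb => //; lra.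
    by split=> //; exact: line_cdiff.
  - move=> w wD; apply/negP => /sN; apply; apply: dP => //; exact: le_trans Zr2 rd.
  - by apply/negP => /sN; rewrite scale0r addr0.
rewrite /loop_mean -[oint _]/(cauchy_transform (fun w : C^o => h (Z + w *: v)) 0) E scale0r addr0.
by rewrite scalerA mulVf ?scale1r// winding_neq0.
Qed.

Lemma differentiable_near f h Z (d : R) : 0 < d ->
  (forall Y, rn (Y - Z) <= d -> f Y = h Y) -> differentiable f Z -> differentiable h Z.
Proof.
move=> d0 fh /differentiable_fder[Llin LM fL].
apply: (@fder_differentiable _ _ _ _ _ ('d f Z)); split=> // e /fL[r r0 rP].
exists (Num.min d r) => [|w]; first by rewrite lt_min d0.
rewrite le_min => /andP[wd /rP].
have -> : f (Z + w) = h (Z + w) by apply: fh; rewrite addrC addKr.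
by have -> : f Z = h Z by apply: fh; rewrite subrr rn0 ltW.
Qed.

Lemma agree_on_dense f h Z (d : R) : 0 < d -> differentiable f Z -> differentiable h Z ->
  (forall Y, rn (Y - Z) <= d -> DD Y -> f Y = h Y) -> f Z = h Z.
Proof.
move=> d0 /differentiable_continuous/continuous_rnP fc.
move=> /differentiable_continuous/continuous_rnP hc fh.
apply/eqP; rewrite -subr_eq0; apply/eqP/rn0_eq0/eqP; rewrite eq_le rn_ge0 andbT.
apply: (@le0_small _ _ 2) => e e0.
have [r1 r10 r1P] := fc _ e0; have [r2 r20 r2P] := hc _ e0.
have m0 : 0 < Num.min d (Num.min r1 r2) by rewrite !lt_min d0 r10.
have [Y DY] := dense_near Z m0; rewrite !le_min => /and3P[Yd Y1 Y2].
have a := r1P _ Y1; have b := r2P _ Y2; rewrite (fh Y Yd DY) in a.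
have := rn_tri (h Y) (f Z) (h Z); rewrite (rnBC (f Z) (h Y)); lra.
Qed.

Lemma bounded_rn (S : set V) h : [bounded h w | w in S] ->
  exists M : R, forall w, S w -> rn (h w) <= M.
Proof.
move=> /pinfty_ex_gt0[M M0 hM]; exists (complex.Re M) => w Sw.
have ME : (complex.Re M)%:C = M by apply/RRe_real/ger0_real/ltW.
by rewrite -lecR rnE ME; exact: hM.
Qed.

(** Each point Z1 outside DD has its own local extension, and hhat takes at Z1 the
    value of that one. Near Z1 all these values agree with the extension chosen at
    Z1, as two extensions coincide on DD, which is dense, and are continuous. *)
Lemma holomorphic_extension (E : set V) h : open E ->
  holomorphic_on (DD `&` E) h -> locally_bounded_off E DD h ->
  exists hhat : V -> X, holomorphic_on E hhat /\
    forall Z, (DD `&` E) Z -> hhat Z = h Z.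
Proof.
move=> oE hol lb.
(* The choice at Z1 is a pair (radius, extension), with a dummy value where nothing
   has to be extended. *)
have ext Z1 : exists p : R * (V -> X), E Z1 -> ~ DD Z1 -> 0 < p.1 /\
    forall Z, rn (Z - Z1) <= p.1 -> [/\ E Z, differentiable p.2 Z & DD Z -> p.2 Z = h Z].
  have [EZ|nE] := pselect (E Z1); last by exists (0, h).
  have [DZ|nD] := pselect (DD Z1); first by exists (0, h).
  have [N [/nbhs_rnP[eta eta0 NP] NE /bounded_rn[M hM]]] := lb Z1 (conj EZ nD).
  have [|d [hh [d0 hhP]]] := @local_extension h Z1 eta M nD eta0.
    move=> Z Ze DZ; have NZ : N Z by apply: NP; exact: ltW.
    by split; [apply: hol; split=> //; exact: NE | exact: hM].
  exists (Num.min d eta, hh) => _ _; split; first by rewrite /= lt_min d0.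
  move=> Z /=; rewrite le_min => /andP[/hhP[hd hE] Ze]; split=> //.
  by apply: NE; exact: NP.
have [p pP] := choice ext.
pose hhat Z := if `[< DD Z >] then h Z else (p Z).2 Z.
have hhatD Z : DD Z -> hhat Z = h Z by rewrite /hhat => /asboolP ->.
exists hhat; split=> [Z EZ|Z [DZ _]]; last exact: hhatD.
have [DZ|nD] := pselect (DD Z).
  have [d d0 dP] := open_near DZ.
  apply: (differentiable_near d0 _ (hol Z (conj DZ EZ))) => Y /dP DY.
  by rewrite hhatD.
have [d0 dP] := pP Z EZ nD.
have ZZ : rn (Z - Z) <= (p Z).1 by rewrite subrr rn0 ltW.
have [_ hd _] := dP Z ZZ.
apply: (differentiable_near (divr_gt0 d0 (ltr0Sn R 1)) _ hd) => Y Yd.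
have [|EY hdY hE] := dP Y; first by lra.
have [DY|nDY] := pselect (DD Y); first by rewrite hhatD// hE.
have [d1 dP1] := pP Y EY nDY.
rewrite /hhat asboolF//.
have Y0 : rn (Y - Y) <= (p Y).1 by rewrite subrr rn0 ltW.
have [_ hdY' _] := dP1 Y Y0.
have m0 : 0 < Num.min ((p Z).1 / 2) (p Y).1 by rewrite lt_min d1 divr_gt0.
apply: (agree_on_dense m0 hdY hdY') => W; rewrite le_min => /andP[W1 W2] DW.
have [_ _ ->//] := dP1 W W2; have [|_ _ ->//] := dP W.
by have := rn_tri Y W Z; lra.
Qed.

End Extension.

Theorem theorem3 (R : realType) (H K : hilbertType R)
    (A : closedSubspace (boundedOp H K))
    (C : boundedOp K H) (D : boundedOp H H) (X : completeNormedModType R[i]) :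
  let DD : set A :=
    [set Z : A | bop_invertible (bop_comp C (subspace_val Z) + D)] in
  DD !=set0 -> trace_class C ->
  analytic_set (~` DD) /\
  forall (E : set A) (h : A -> X),
    is_domain E -> holomorphic_on (DD `&` E) h -> locally_bounded_off E DD h ->
    exists hhat : A -> X,
      holomorphic_on E hhat /\ forall Z, (DD `&` E) Z -> hhat Z = h Z.
Proof.
move=> DD [Z0 DZ0] tc.
have le := local_determinant DZ0 tc.
split=> [|E h [_ oE _] hol lb]; first exact: analytic_complement le.
exact: (holomorphic_extension DZ0 le oE hol lb).
Qed.
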